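(* Let $L\geq 1$ and $\Psi=\{\psi^1,\psi^2,\dots,\psi^L\}\subseteq L^2(K)$. For $s\in\mathbb{N}_0\setminus q\mathbb{N}_0$ put $$t_s(\xi)=\sum_{l=1}^L\sum_{j=0}^{\infty}\hat{\psi}^l(\mathfrak{p}^{-j}\xi)\,\overline{\hat{\psi}^l(\mathfrak{p}^{-j}(\xi+u(s)))}.$$ The affine system $X(\Psi)$ is a tight frame with constant $1$ for $L^2(K)$, i.e. $$\|f\|_2^2=\sum_{l=1}^L\sum_{j\in\mathbb{Z}}\sum_{k\in\mathbb{N}_0}|\langle f,\psi^l_{j,k}\rangle|^2\quad\text{for all } f\in L^2(K),$$ if and only if the functions $\psi^1,\dots,\psi^L$ satisfy the following two conditions: $$\sum_{l=1}^L\sum_{j\in\mathbb{Z}}|\hat{\psi}^l(\mathfrak{p}^{-j}\xi)|^2=1\quad\text{for a.e. }\xi\in K,$$ and $$t_s(\xi)=0\quad\text{for a.e. }\xi\in K\text{ and for all } s\in\mathbb{N}_0\setminus q\mathbb{N}_0.$$ In particular, $\Psi$ is a set of basic wavelets of $L^2(K)$ if and only if $\|\psi^l\|_2=1$ for $l=1,2,\dots,L$ and both of these conditions hold.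
   Context: $K$ is a local field of characteristic $p>0$, i.e. a nondiscrete, totally disconnected, locally compact topological field of characteristic $p$. Let $dx$ be a Haar measure on $K^+$; the absolute value is defined by $d(\alpha x)=|\alpha|\,dx$ for $\alpha\neq 0$, and $|0|=0$. Put $\mathfrak{D}=\{x\in K:|x|\leq 1\}$, $\mathfrak{P}=\{x\in K:|x|<1\}$, $\mathfrak{D}^*=\mathfrak{D}\setminus\mathfrak{P}$; $dx$ is normalized so that $\mathfrak{D}$ has measure $1$. Fix a prime element $\mathfrak{p}$, i.e. an element of maximal absolute value in $\mathfrak{P}$. The residue field $\mathfrak{D}/\mathfrak{P}$ is isomorphic to $GF(q)$, $q=p^c$ with $c\in\mathbb{N}$, and $|\mathfrak{p}|=q^{-1}$. $\mathbb{N}_0=\mathbb{N}\cup\{0\}$. Fix $\{1=\epsilon_0,\epsilon_1,\dots,\epsilon_{c-1}\}\subset\mathfrak{D}^*$ whose span over $GF(p)$ is a subfield of $K$ isomorphic to $GF(q)$. For $0\leq n<q$ write $n=a_0+a_1p+\dots+a_{c-1}p^{c-1}$ with $0\leq a_k<p$ and set $u(n)=(a_0+a_1\epsilon_1+\dots+a_{c-1}\epsilon_{c-1})\mathfrak{p}^{-1}$. For general $n\in\mathbb{N}_0$ write $n=b_0+b_1q+\dots+b_rq^r$ with $0\leq b_k<q$ and set $u(n)=u(b_0)+u(b_1)\mathfrak{p}^{-1}+\dots+u(b_r)\mathfrak{p}^{-r}$. The set $\{u(n):n\in\mathbb{N}_0\}$ is a subgroup of $K^+$ and a complete list of distinct coset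 representatives of $\mathfrak{D}$ in $K^+$. $\chi$ is the continuous unitary character of $K^+$ determined by $\chi(\epsilon_\mu\mathfrak{p}^{-j})=\exp(2\pi i/p)$ if $\mu=0$ and $j=1$, and $\chi(\epsilon_\mu\mathfrak{p}^{-j})=1$ if $\mu\in\{1,\dots,c-1\}$ or $j\neq 1$. It is trivial on $\mathfrak{D}$ and nontrivial on $\mathfrak{P}^{-1}=\mathfrak{p}^{-1}\mathfrak{D}$. The Fourier transform is $\hat f(\xi)=\int_K f(x)\overline{\chi(\xi x)}\,dx$ for $f\in L^1(K)\cap L^2(K)$, extended to a unitary operator on $L^2(K)$. For $\Psi=\{\psi^1,\dots,\psi^L\}\subset L^2(K)$, the affine system is the family $X(\Psi)=\{\psi^l_{j,k}:1\leq l\leq L,\ j\in\mathbb{Z},\ k\in\mathbb{N}_0\}$, where $\psi^l_{j,k}(x)=q^{j/2}\psi^l(\mathfrak{p}^{-j}x-u(k))$. $\Psi$ is called a set of basic wavelets of $L^2(K)$ if $X(\Psi)$ is an orthonormal basis of $L^2(K)$. *)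

(* Defs.v *)
From HB Require Import structures.
From mathcomp Require Import all_boot all_order all_algebra.
From mathcomp Require Import complex.
From mathcomp Require Import all_classical all_reals all_analysis.

Set Implicit Arguments.
Unset Strict Implicit.
Unset Printing Implicit Defensive.

Import Order.TTheory GRing.Theory Num.Theory.
Import numFieldNormedType.Exports.

Local Open Scope classical_set_scope.
Local Open Scope ring_scope.

HB.mixin Record isTopologicalField K
    & TopologicalZmodule K & GRing.Field K := {
  mul_continuous : continuous (fun x : K * K => x.1 * x.2) ;
  inv_continuous : forall x : K, x != 0 -> {for x, continuous (@GRing.inv K)}
}.

#[short(type="topologicalFieldType")]
HB.structure Definition TopologicalField :=
  {K of TopologicalZmodule K & GRing.Field K & isTopologicalField K}.

(* Measurable types must be pointed, and topological fields are not, hence the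
   alias for the carrier of the Borel sigma-algebra. *)
Definition borel_carrier (K : topologicalFieldType) : Type := K.
HB.instance Definition _ (K : topologicalFieldType) :=
  Choice.on (borel_carrier K).
HB.instance Definition _ (K : topologicalFieldType) :=
  isPointed.Build (borel_carrier K) (0 : K).

Notation borel K := (@g_sigma_algebraType (borel_carrier K) (@open K)).

(* Total disconnectedness (components are singletons) makes K Hausdorff. *)
Definition local_field (p : nat) (K : topologicalFieldType) : Prop :=
  [/\ p \in [pchar K],
      @nbhs K K <> principal_filter,
      totally_disconnected [set: K] &
      locally_compact [set: K]].

Section HaarMeasure.
Context {R : realType} {K : topologicalFieldType}.
Variable mu : {measure set (borel K) -> \bar R}.

Definition haar_measure : Prop :=
  [/\ forall (a : K) (E : set (borel K)), measurable E ->
        mu [set a + x | x in E] = mu E,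
      forall C : set K, compact C -> (mu C < +oo)%E &
      forall U : set K, open U -> U !=set0 -> (0 < mu U)%E].

Definition is_absolute_value (abs : K -> R) : Prop :=
  abs 0 = 0 /\
  forall (a : K) (E : set (borel K)), a != 0 -> measurable E ->
    mu [set a * x | x in E] = ((abs a)%:E * mu E)%E.

End HaarMeasure.

Section LocalFieldArithmetic.
Context {R : realType} {K : topologicalFieldType}.
Variable abs : K -> R.

Definition integers : set K := [set x | abs x <= 1].
Definition max_ideal : set K := [set x | abs x < 1].
Definition integer_units : set K := integers `\` max_ideal.

Definition prime_element (varpi : K) : Prop :=
  max_ideal varpi /\ forall x, max_ideal x -> abs x <= abs varpi.

(* The residue field is isomorphic to the finite field F with q elements: F is
   the image of the integers under a ring morphism r with kernel max_ideal
   (the values of r outside the integers are irrelevant). *)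
Definition residue_field_card (q : nat) : Prop :=
  exists (F : finFieldType) (r : K -> F),
    #|F| = q /\
    [/\ r 1 = 1,
        {in integers &, {morph r : x y / x + y}},
        {in integers &, {morph r : x y / x * y}},
        forall a : F, exists2 x, integers x & r x = a &
        forall x, integers x -> r x = 0 <-> max_ideal x].

(* The prime field of K consists of the n%:R with n a natural number. *)
Definition residue_basis (p c : nat) (eps : 'I_c -> K) : Prop :=
  [/\ forall i, val i = 0%N -> eps i = 1,
      forall i, integer_units (eps i) &
      exists (F : finFieldType) (f : {rmorphism F -> K}),
        #|F| = (p ^ c)%N /\
        range f = [set \sum_(i < c) (a i)%:R * eps i | a in [set: 'I_c -> nat]]].

End LocalFieldArithmetic.

Section Translations.
Context {K : topologicalFieldType}.
Variables (p c : nat) (varpi : K) (eps : 'I_c -> K).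
Let q := (p ^ c)%N.

Definition digit_rep (b : nat) : K :=
  (\sum_(i < c) ((b %/ p ^ i) %% p)%:R * eps i) / varpi.

(* The base-q digits of n of index greater than n vanish. *)
Definition coset_rep (n : nat) : K :=
  \sum_(k < n.+1) digit_rep ((n %/ q ^ k) %% q) * varpi ^- k.

End Translations.

(* The topology of the complex numbers is the library's one on R[i]^o. *)
Definition standard_character {R : realType} {K : topologicalFieldType}
    (p c : nat) (varpi : K) (eps : 'I_c -> K) (chi : K -> R[i]) : Prop :=
  [/\ continuous (chi : K -> R[i]^o),
      forall x y, chi (x + y) = chi x * chi y,
      forall x, Normc.normc (chi x) = 1 &
      forall (i : 'I_c) (j : int),
        chi (eps i * varpi ^ (- j)) =
        if (val i == 0%N) && (j == 1)
        then (cos (2 * pi / p%:R) +i* sin (2 * pi / p%:R))%C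
        else 1].

Section LebesgueSpaces.
Context {R : realType} {K : topologicalFieldType}.
Variable mu : {measure set (borel K) -> \bar R}.
Implicit Types f g : K -> R[i].

Definition cintegral f : R[i] :=
  (Rintegral mu setT (fun x => complex.Re (f x)) +i*
   Rintegral mu setT (fun x => complex.Im (f x)))%C.

Definition cmeasurable f : Prop :=
  measurable_fun [set: borel K] (fun x : borel K => complex.Re (f x)) /\
  measurable_fun [set: borel K] (fun x : borel K => complex.Im (f x)).

Definition cLnorm (r : R) f : \bar R :=
  Lnorm mu r%:E (fun x : borel K => (Normc.normc (f x))%:E).

Definition cLfun (r : R) f : Prop := cmeasurable f /\ (cLnorm r f < +oo)%E.

Definition inner f g : R[i] := cintegral (fun x => f x * conjc (g x)).

(* Equality of functions in L^2 is equality almost everywhere, so the density of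
   the linear span is expressed with the L^2 seminorm. *)
Definition orthonormal_basis (I : eqType) (e : I -> K -> R[i]) : Prop :=
  [/\ forall i, cLfun 2 (e i),
      forall i j, inner (e i) (e j) = (i == j)%:R &
      forall f, cLfun 2 f -> forall d : R, 0 < d ->
        exists (s : seq I) (a : I -> R[i]),
          (cLnorm 2 (fun x => f x - \sum_(i <- s) a i * e i x)%R < d%:E)%E].

Variable chi : K -> R[i].

Definition fourier1 f (xi : K) : R[i] :=
  cintegral (fun x => f x * conjc (chi (xi * x))).

(* The continuous extension of fourier1 from L^1 /\ L^2 to L^2: g is the limit
   in L^2 of the transforms of some sequence converging to f in L^2. *)
Definition is_fourier f g : Prop :=
  cLfun 2 g /\
  exists f_ : nat -> K -> R[i],
    [/\ forall n, cLfun 1 (f_ n) /\ cLfun 2 (f_ n),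
        (fun n => cLnorm 2 (fun x => f_ n x - f x)) @ \oo --> 0%E &
        (fun n => cLnorm 2 (fun x => fourier1 (f_ n) x - g x)) @ \oo --> 0%E].

(* A representative of the almost everywhere class of the transform of f. *)
Definition fourier f : K -> R[i] := xget (fun=> 0) (is_fourier f).

End LebesgueSpaces.

Section AffineSystems.
Context {R : realType} {K : topologicalFieldType}.
Variable mu : {measure set (borel K) -> \bar R}.
Variables (p c : nat) (varpi : K) (eps : 'I_c -> K) (chi : K -> R[i]).
Variables (L : nat) (Psi : 'I_L -> K -> R[i]).
Let q := (p ^ c)%N.
Let u := coset_rep p varpi eps.
Let Psihat l := fourier mu chi (Psi l).

Definition affine (psi : K -> R[i]) (j : int) (k : nat) (x : K) : R[i] :=
  (q%:R `^ (j%:~R / 2))%:C%C * psi (varpi ^ (- j) * x - u k).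

Definition tight_frame : Prop :=
  forall f : K -> R[i], cLfun mu 2 f ->
    (cLnorm mu 2 f ^+ 2 =
     \sum_(l < L) \esum_(j in [set: int]) \esum_(k in [set: nat])
       ((Normc.normc (inner mu f (affine (Psi l) j k)) ^+ 2)%R)%:E)%E.

Definition basic_wavelets : Prop :=
  orthonormal_basis mu
    (fun i : 'I_L * int * nat => affine (Psi i.1.1) i.1.2 i.2).

Definition calderon_condition : Prop :=
  {ae mu, forall xi : borel K,
    (\sum_(l < L) \esum_(j in [set: int])
       ((Normc.normc (Psihat l (varpi ^ (- j) * xi)) ^+ 2)%R)%:E = 1)%E}.

Definition t_ (s : nat) (xi : K) : R[i] :=
  \sum_(l < L) limn (series (fun j : nat =>
    Psihat l (varpi ^- j * xi) *
    conjc (Psihat l (varpi ^- j * (xi + u s))) : R[i]^o)).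

Definition t_condition : Prop :=
  forall s : nat, ~~ (q %| s)%N -> {ae mu, forall xi : borel K, t_ s xi = 0}.

End AffineSystems.

(* Main.v *)
From HB Require Import structures.
Require Import Defs.
From mathcomp Require Import all_boot all_order all_algebra.
From mathcomp Require Import complex finfield finmap.
From mathcomp Require Import all_classical all_reals all_analysis measurable_realfun.
From mathcomp Require Import ring lra zify.

Set Implicit Arguments.
Unset Strict Implicit.
Unset Printing Implicit Defensive.

Import Order.TTheory GRing.Theory Num.Theory.
Import numFieldNormedType.Exports.
Local Open Scope classical_set_scope.
Local Open Scope ring_scope.

(** Write D for the ring of integers, q for the order of the residue field and u n for the
representatives of the cosets of D.

Passage to the Fourier side. The inverse transforms of locally constant functions F with
compact support are dense in L2, so the frame identity has only to be tested on them
([frame_dense]). A coefficient of such a function against psi_(j,k) is, up to a factor, the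
integral of F(varpi^(-j) eta) conj(psi^(eta)) chi(u_k eta), with psi^ the transform of psi
([coefficient_sq]). The characters chi(u_k .) form an orthonormal basis of L2(D), and
chi(u_k u_s) = 1, so that they are periodic under the u_s: Parseval's identity on D turns
the sum over k into the squared norm of the periodization of the integrand
([parseval_periodization]). This is the energy at scale j.

One generator. Let F be constant on the cosets of D, with values F(u_n) for n < q^N and zero
elsewhere. At a scale j >= 0 the square of the periodization expands into a diagonal part,
the integral of |F|^2 |psi^(varpi^j .)|^2, and into cross terms indexed by the pairs n <> n'
that are congruent modulo q^j. For every such pair u_n' - u_n = varpi^(-r) u_s with s not
divisible by q, where r counts the lowest digits on which n and n' agree ([coset_rep_pair]);
so the pair occurs exactly at the scales 0, ..., r, and its cross terms are, up to
conjugation and a factor, the integrals over varpi^r (u_n + D) of the first r + 1 terms of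
the series t_s. What is missing is the tail of that series. At the scales j < 0, Cauchy-
Schwarz bounds the energy by the number of nonzero values of F times the integral of
|F(varpi^(-j) .)|^2 |psi^|^2. Altogether the energy is the diagonal part plus the integrals
of t_s, up to the number of nonzero values of F times the sum of the latter integrals over j
< 0, called the outer tail ([main_estimate]).

Getting rid of the error. Replacing F by F(varpi^M .) multiplies the energy and the diagonal
part by q^M, whereas the outer tail tends to 0 if F vanishes near 0 ([outer_tail_small]).

Sufficiency. If t_s = 0 then only the diagonal part is left, which is the integral of |F|^2
times the Calderon sum. The number of values of F(varpi^M .) is O(q^M), so that dividing by q^M
and letting M tend to infinity gives the frame identity ([sufficiency]).

Necessity. Take for F the indicator of a small ball b away from 0, plus omega times the
indicator of b + u_s. The function F(varpi^M .) is a sum of pieces with two nonzero values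
each. The estimate for one piece has an error bounded by a fixed multiple of its outer tail,
and these tails add up to the tail of the whole function. In the limit, the squared norm of F
is the integral of |F|^2 times the Calderon sum plus twice the real part of omega times the
integral of t_s over b ([necessity_identity]). With omega = 0 this makes the Calderon sum equal
to 1 in mean over all small balls, hence almost everywhere; then omega = 1 and omega = -i show
that the integrals of t_s over small balls vanish ([ae_eq_balls]).

The claim about wavelets follows, because a tight frame of unit vectors is an orthonormal
basis ([tight_frame_orthonormal_basis]) and dilations and translations preserve norms.

The structure of K (ultrametric inequality, compactness of D, |varpi| = 1/q) is derived from
the Haar modulus: the key points are that the integers lie in a compact set
([integers_bounded]) and that (1 + x)^(p^n) = 1 + x^(p^n) ([abs_add1]). *)

Local Notation Re := complex.Re.
Local Notation Im := complex.Im.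
Local Notation normc := Normc.normc.

(** * Topological fields *)

Section TopologicalFields.
Context {K : topologicalFieldType}.
Implicit Types (a x y : K) (U C : set K).

Lemma mull_continuous a : continuous ( *%R a : K -> K).
Proof.
move=> x; apply: (@continuous_comp K (K * K)%type K (fun x => (a, x))
  (fun z : K * K => z.1 * z.2)); last exact: Defs.mul_continuous.
by apply: cvg_pair => //=; exact: cvg_cst.
Qed.

Lemma addl_continuous a : continuous (+%R a : K -> K).
Proof.
move=> x; apply: (@continuous_comp K (K * K)%type K (fun x => (a, x))
  (fun z : K * K => z.1 + z.2)); last exact: add_continuous.
by apply: cvg_pair => //=; exact: cvg_cst.
Qed.

Lemma image_mull a (U : set K) : a != 0 ->
  [set a * x | x in U] = *%R a^-1 @^-1` U.
Proof.
move=> a0; apply/seteqP; split => [_ [y Uy <-]|x /= Ux].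
  by rewrite /= mulKf.
by exists (a^-1 * x) => //; rewrite mulVKf.
Qed.

Lemma image_addl a (U : set K) : [set a + x | x in U] = +%R (- a) @^-1` U.
Proof.
apply/seteqP; split => [_ [y Uy <-]|x /= Ux].
  by rewrite /= addKr.
by exists (- a + x) => //; rewrite addNKr.
Qed.

Lemma open_mull a U : a != 0 -> open U -> open [set a * x | x in U].
Proof.
by move=> a0 oU; rewrite image_mull//; apply: open_comp => // x _; exact: mull_continuous.
Qed.

Lemma closed_mull a U : a != 0 -> closed U -> closed [set a * x | x in U].
Proof.
by move=> a0 oU; rewrite image_mull//; apply: closed_comp => // x _; exact: mull_continuous.
Qed.

Lemma open_addl a U : open U -> open [set a + x | x in U].
Proof.
by move=> oU; rewrite image_addl//; apply: open_comp => // x _; exact: addl_continuous.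
Qed.

Lemma compact_mull a C : compact C -> compact [set a * x | x in C].
Proof.
by move=> cC; apply: continuous_compact => //; apply: continuous_subspaceT => x; exact: mull_continuous.
Qed.

(** The tube lemma: compactness of C makes the neighbourhood of a uniform in x. *)
Lemma near_mul_compact a C U : compact C -> open U -> (forall x, C x -> U (a * x)) ->
  \forall y \near a, forall x, C x -> U (y * x).
Proof.
move=> /compact_near_coveringP cC oU CU.
have := cC K (nbhs a) (fun y x => U (y * x)) _; apply => x Cx.
have /= := @Defs.mul_continuous K (a, x) U (open_nbhs_nbhs (conj oU (CU _ Cx))).
case=> -[A B] /= [Aa Bx] AB; exists (B, A) => //= -[u w] /= [Bu Aw].
exact: (AB (w, u)).
Qed.

Lemma nbhs_addl a U : nbhs a U <-> nbhs 0 [set x | U (a + x)].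
Proof.
split=> [Ua|H].
  have := @addl_continuous a 0; rewrite /continuous_at addr0; exact.
have /= := @addl_continuous (- a) a.
rewrite /continuous_at addNr => /(_ _ H) /=.
by move=> h; apply: (@filterS _ (nbhs a) _ _ _ _ h) => x /=; rewrite addNKr.
Qed.

Lemma nondiscrete_punctured : @nbhs K K <> principal_filter ->
  forall U, nbhs (0 : K) U -> exists2 x, U x & x != 0.
Proof.
move=> K0 U U0; apply: contrapT => H; apply: K0; apply/funext => a.
apply/seteqP; split => A; first by move=> /nbhs_singleton Aa; rewrite principal_filterP.
rewrite principal_filterP => Aa; apply/nbhs_addl.
apply: filterS U0 => x Ux; have [->|x0] := eqVneq x 0; first by rewrite /= addr0.
by exfalso; apply: H; exists x.
Qed.

Lemma totally_disconnected_closed1 a : totally_disconnected [set: K] -> closed [set a].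
Proof. by move=> /(_ a I) <-; apply: component_closed; exact: closedT. Qed.

(** The nonzero points of a finite set form a closed set, whose complement is a neighbourhood of
0 and therefore contains a nonzero point. *)
Lemma nondiscrete_infinite (s : seq K) : @nbhs K K <> principal_filter ->
  totally_disconnected [set: K] -> exists x, x \notin s.
Proof.
move=> K0 td; have : closed [set x | x \in s /\ x != 0].
  elim: s => [|b s IH]; first by rewrite (_ : mkset _ = set0) ?predeqE//; [exact: closed0|move=> x; split => //= -[]].
  have [b0|b0] := eqVneq b 0.
    rewrite (_ : mkset _ = [set x | x \in s /\ x != 0]) //.
    apply/seteqP; split => x /=; rewrite in_cons => -[]; last by move=> -> ->; rewrite orbT.
    by case/orP => [/eqP ->|-> ->//]; rewrite b0 eqxx.
  rewrite (_ : mkset _ = [set b] `|` [set x | x \in s /\ x != 0]).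
    by apply: closedU => //; exact: totally_disconnected_closed1.
  apply/seteqP; split => x /=; rewrite in_cons.
    by case=> /orP[/eqP ->|? ?]; [left|right].
  by case=> [->|[-> ->]]; rewrite ?eqxx ?orbT.
move=> /closed_openC cs.
have : nbhs (0 : K) (~` [set x | x \in s /\ x != 0]).
  by apply: open_nbhs_nbhs; split => //= -[_]; rewrite eqxx.
move=> /(nondiscrete_punctured K0) [x /= xs x0]; exists x.
by apply/negP => xs'; apply: xs.
Qed.

(** Finitely many of the neighbourhoods on which g is bounded cover C. *)
Lemma compact_ubound {R : realType} (g : K -> R) C : compact C ->
  (forall x, C x -> exists b, \forall y \near x, g y <= b) ->
  exists2 b, 0 < b & forall x, C x -> g x <= b.
Proof.
move=> /compact_near_coveringP cC H.
have := cC R (+oo%R) (fun b x => g x <= b) _.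
have : forall x : K, C x -> \forall x' \near x & i \near +oo%R, g x' <= i.
  move=> x /H [b nb]; exists ([set y | g y <= b], [set c | b <= c]) => /=.
    by split => //; apply: nbhs_pinfty_ge; exact: num_real.
  by move=> [y c] /= [yb bc]; exact: le_trans bc.
move=> /[swap] /[apply] HH.
have [b [b0 Hb]] := @filter_ex R (pinfty_nbhs R) _ _ (filterI (nbhs_pinfty_gt (num_real (0 : R))) HH).
by exists b.
Qed.

(** The complements of the F n increase with n and cover, together with U, the compact set C. *)
Lemma compact_nested C (F : nat -> set K) U : compact C -> open U ->
  (forall n, closed (F n)) -> (forall n, F n.+1 `<=` F n) ->
  (forall x, C x -> (forall n, F n x) -> U x) ->
  exists n, forall x, C x -> F n x -> U x.
Proof.
move=> /compact_near_coveringP cC oU clF dF H.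
have Fm m n : (m <= n)%N -> F n `<=` F m.
  move=> mn; rewrite -(subnKC mn); elim: (n - m)%N => [|k IH]; first by rewrite addn0.
  by rewrite addnS => x /dF /IH.
have := cC nat \oo (fun n x => F n x -> U x) _.
have : forall x, C x -> \forall x' \near x & i \near \oo, F i x' -> U x'.
  move=> x Cx; have [Ux|nUx] := pselect (U x).
    exists (U, setT) => /=; last by move=> [y n] /= [].
    by split; [exact: open_nbhs_nbhs|exact: filterT].
  have [n nFn] : exists n, ~ F n x.
    by apply: contrapT => /forallNP h; apply: nUx; apply: H => // n; apply: contrapT.
  exists (~` F n, [set m | (n <= m)%N]) => /=.
    split; last by exists n.
    by apply: open_nbhs_nbhs; split => //; exact: closed_openC.
  by move=> [y m] /= [nF nm] Fm'; exfalso; apply: nF; exact: (Fm _ _ nm).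
move=> /[swap] /[apply] -[n _ Hn]; exists n => x Cx Fx.
exact: (Hn n (leqnn n) x Cx Fx).
Qed.

End TopologicalFields.

(** * Complex numbers *)

Section ComplexModulus.
Context {R : realType}.
Implicit Types z w : R[i].

Lemma ReD z w : Re (z + w) = Re z + Re w. Proof. by case: z w => ? ? []. Qed.
Lemma ImD z w : Im (z + w) = Im z + Im w. Proof. by case: z w => ? ? []. Qed.
Lemma ReN z : Re (- z) = - Re z. Proof. by case: z. Qed.
Lemma ImN z : Im (- z) = - Im z. Proof. by case: z. Qed.
Lemma ReM z w : Re (z * w) = Re z * Re w - Im z * Im w.
Proof. by case: z w => ? ? []. Qed.
Lemma ImM z w : Im (z * w) = Re z * Im w + Im z * Re w.
Proof. by case: z w => ? ? []. Qed.
Lemma ReJ z : Re (conjc z) = Re z. Proof. by case: z. Qed.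
Lemma ImJ z : Im (conjc z) = - Im z. Proof. by case: z. Qed.

Lemma conjcB z w : conjc (z - w) = conjc z - conjc w. Proof. exact: rmorphB. Qed.
Lemma conjcM z w : conjc (z * w) = conjc z * conjc w. Proof. exact: rmorphM. Qed.

Lemma complex_ext z w : Re z = Re w -> Im z = Im w -> z = w.
Proof. by case: z w => ? ? [? ?] /= -> ->. Qed.

Lemma normc_ge0 z : 0 <= normc z.
Proof. by case: z => a b; rewrite /= sqrtr_ge0. Qed.

Lemma normc_sq z : normc z ^+ 2 = Re z ^+ 2 + Im z ^+ 2.
Proof. by case: z => a b; rewrite /= sqr_sqrtr// addr_ge0 ?sqr_ge0. Qed.

Lemma normc_conj z : normc (conjc z) = normc z.
Proof. by case: z => a b; rewrite /= sqrrN. Qed.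

Lemma normcD z w : normc (z + w) <= normc z + normc w.
Proof. exact: le_normcD. Qed.

Lemma normc_oppr z : normc (- z) = normc z.
Proof. by case: z => a b; rewrite /= !sqrrN. Qed.

Lemma mulcJ z : z * conjc z = (normc z ^+ 2)%:C%C.
Proof. by rewrite normc_sq; case: z => a b; apply: complex_ext => /=; ring. Qed.

Lemma Re_le_normc z : `|Re z| <= normc z.
Proof.
by rewrite -(ler_pXn2r (n:=2))// ?nnegrE ?normc_ge0// normc_sq (@real_normK _ _ (num_real _)) lerDl sqr_ge0.
Qed.

Lemma Im_le_normc z : `|Im z| <= normc z.
Proof.
by rewrite -(ler_pXn2r (n:=2))// ?nnegrE ?normc_ge0// normc_sq (@real_normK _ _ (num_real _)) lerDr sqr_ge0.
Qed.

Lemma normc_le_ReIm z : normc z <= `|Re z| + `|Im z|.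
Proof.
rewrite -(ler_pXn2r (n:=2))// ?nnegrE ?normc_ge0// ?addr_ge0//.
rewrite normc_sq sqrrD !(@real_normK _ _ (num_real _)) -addrA lerD2l addrC lerDl.
by rewrite mulrn_wge0// mulr_ge0.
Qed.

Lemma normc_real (a : R) : normc (a%:C%C) = `|a|.
Proof. by rewrite /= expr0n addr0 sqrtr_sqr. Qed.

Lemma normc_sqD z w : normc (z + w) ^+ 2 <= 2 * normc z ^+ 2 + 2 * normc w ^+ 2.
Proof.
rewrite !normc_sq ReD ImD.
have : 0 <= (Re z - Re w) ^+ 2 + (Im z - Im w) ^+ 2 by rewrite addr_ge0 ?sqr_ge0.
by nra.
Qed.

(** Expand |t z - w|^2 >= 0. For small t the constant in front of |z|^2 is close to 1, which
lets identities pass to limits. *)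
Lemma normc_sqD_weighted z w (t : R) : 0 < t ->
  normc (z + w) ^+ 2 <= (1 + t) * normc z ^+ 2 + (1 + t^-1) * normc w ^+ 2.
Proof.
move=> t0; rewrite !normc_sq ReD ImD.
set a := Re _; set b := Re _; set c := Im _; set d := Im _.
have : 0 <= t^-1 * ((t * a - b) ^+ 2 + (t * c - d) ^+ 2).
  by rewrite mulr_ge0 ?addr_ge0 ?sqr_ge0// invr_ge0 ltW.
rewrite -subr_ge0; congr (_ <= _); field.
by rewrite gt_eqF.
Qed.

Lemma normcM_le z w : normc (z * w) <= (normc z ^+ 2 + normc w ^+ 2) / 2.
Proof.
rewrite Normc.normcM; have := sqr_ge0 (normc z - normc w).
by rewrite sqrrB; nra.
Qed.

Lemma eq_normc_small z w : (forall e : R, 0 < e -> normc (z - w) ^+ 2 <= e) -> z = w.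
Proof.
move=> H; apply/eqP; rewrite -subr_eq0; apply/eqP/Normc.eq0_normc/eqP.
have : normc (z - w) ^+ 2 <= 0 by apply/ler_addgt0Pr => e /H; rewrite add0r.
by rewrite le_eqVlt ltNge sqr_ge0 orbF expf_eq0.
Qed.

End ComplexModulus.

(** * Complex integrals *)

Section ComplexIntegral.
Context {R : realType} {K : topologicalFieldType}.
Variable mu : {measure set (borel K) -> \bar R}.
Implicit Types f g h : K -> R[i].

Lemma cmeasurable_cst (c : R[i]) : cmeasurable (fun _ : K => c).
Proof. by split; exact: measurable_cst. Qed.

Lemma cmeasurableD f g : cmeasurable f -> cmeasurable g ->
  cmeasurable (fun x => f x + g x).
Proof.
move=> [f1 f2] [g1 g2]; split.
  by under eq_fun do rewrite ReD; exact: measurable_funD.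
by under eq_fun do rewrite ImD; exact: measurable_funD.
Qed.

Lemma cmeasurableM f g : cmeasurable f -> cmeasurable g ->
  cmeasurable (fun x => f x * g x).
Proof.
move=> [f1 f2] [g1 g2]; split.
  by under eq_fun do rewrite ReM; apply: measurable_funB; exact: measurable_funM.
by under eq_fun do rewrite ImM; apply: measurable_funD; exact: measurable_funM.
Qed.

Lemma cmeasurableZ (c : R[i]) f : cmeasurable f -> cmeasurable (fun x => c * f x).
Proof. by apply: cmeasurableM; exact: cmeasurable_cst. Qed.

Lemma cmeasurableJ f : cmeasurable f -> cmeasurable (fun x => conjc (f x)).
Proof.
move=> [f1 f2]; split; first by under eq_fun do rewrite ReJ.
by under eq_fun do rewrite ImJ; exact: measurable_funN.
Qed.

Lemma cmeasurableB f g : cmeasurable f -> cmeasurable g ->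
  cmeasurable (fun x => f x - g x).
Proof.
move=> mf mg; have := cmeasurableD mf (cmeasurableZ (-1) mg).
by under eq_fun do rewrite mulN1r.
Qed.

Lemma cmeasurable_sum (I : Type) (s : seq I) (P : pred I) (F : I -> K -> R[i]) :
  (forall i, cmeasurable (F i)) -> cmeasurable (fun x => \sum_(i <- s | P i) F i x).
Proof.
move=> mF; elim: s => [|i s IH].
  by under eq_fun do rewrite big_nil; exact: cmeasurable_cst.
under eq_fun do rewrite big_cons.
by case: (P i) => //; exact: cmeasurableD.
Qed.

Lemma cmeasurable_comp f (phi : borel K -> borel K) :
  measurable_fun setT phi -> cmeasurable f -> cmeasurable (fun x => f (phi x)).
Proof. move=> mphi [f1 f2]; split.
  exact: (measurableT_comp (f := fun y : borel K => Re (f y)) f1 mphi).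
exact: (measurableT_comp (f := fun y : borel K => Im (f y)) f2 mphi). Qed.

Lemma cmeasurable_normc f : cmeasurable f ->
  measurable_fun [set: borel K] (fun x : borel K => normc (f x)).
Proof.
move=> [f1 f2]; have -> : (fun x : borel K => normc (f x)) =
    (fun x : borel K => (Re (f x) ^+ 2 + Im (f x) ^+ 2) `^ (2^-1)).
  apply/funext => x; rewrite -normc_sq -powR_mulrn ?normc_ge0// -powRrM mulfV ?pnatr_eq0//.
  by rewrite powRr1 ?normc_ge0.
apply: (measurableT_comp (measurable_powR 2^-1)).
by apply: measurable_funD; exact: measurable_funX.
Qed.

Lemma cmeasurable_normc2 f : cmeasurable f ->
  measurable_fun [set: borel K] (fun x : borel K => normc (f x) ^+ 2).
Proof. by move=> mf; apply: measurable_funX; exact: cmeasurable_normc. Qed.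

Lemma cmeasurable_real (r : borel K -> R) : measurable_fun setT r ->
  cmeasurable (fun x => (r x)%:C%C).
Proof. by move=> mr; split => //=; exact: measurable_cst. Qed.

Definition cindic (A : set K) (x : K) : R[i] := (\1_A x)%:C%C.

Lemma cindicE A x : cindic A x = if x \in A then 1 else 0.
Proof. by rewrite /cindic indicE; case: (x \in A). Qed.

Lemma cmeasurable_indic (A : set (borel K)) : measurable A -> cmeasurable (cindic A).
Proof. by move=> mA; apply: cmeasurable_real; exact: measurable_indic. Qed.

Definition cintegrable f :=
  mu.-integrable [set: borel K] (fun x : borel K => (Re (f x))%:E) /\
  mu.-integrable [set: borel K] (fun x : borel K => (Im (f x))%:E).

Lemma cintegrable_measurable f : cintegrable f -> cmeasurable f.
Proof. by move=> [/integrableP[/measurable_EFinP ? _] /integrableP[/measurable_EFinP ? _]]. Qed.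

Lemma cintegrable_dom f (g : borel K -> R) : cmeasurable f ->
  (forall x, normc (f x) <= g x) ->
  mu.-integrable [set: borel K] (EFin \o g) -> cintegrable f.
Proof.
move=> [f1 f2] fg ig; split.
  apply: le_integrable ig => //; first exact/measurable_EFinP.
  move=> x _ /=; rewrite lee_fin (le_trans (Re_le_normc _))//.
  by rewrite (le_trans (fg x))// ler_norm.
apply: le_integrable ig => //; first exact/measurable_EFinP.
move=> x _ /=; rewrite lee_fin (le_trans (Im_le_normc _))//.
by rewrite (le_trans (fg x))// ler_norm.
Qed.

Lemma integrable_ge0 (g : borel K -> R) : measurable_fun setT g ->
  (forall x, 0 <= g x) -> (\int[mu]_x (g x)%:E < +oo)%E ->
  mu.-integrable [set: borel K] (EFin \o g).
Proof.
move=> mg g0 gi; apply/integrableP; split; first exact/measurable_EFinP.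
by under eq_integral => x _ do rewrite /= ger0_norm//.
Qed.

Lemma cintegrableP f : cmeasurable f -> (\int[mu]_x (normc (f x))%:E < +oo)%E ->
  cintegrable f.
Proof.
move=> mf fi; apply: (cintegrable_dom (g := fun x => normc (f x))) => //.
apply: integrable_ge0 => //; [exact: cmeasurable_normc|by move=> x; exact: normc_ge0].
Qed.

Lemma cintegrable_normc f : cintegrable f ->
  mu.-integrable [set: borel K] (fun x : borel K => (normc (f x))%:E).
Proof.
move=> cf; have [f1 f2] := cf; have mf := cintegrable_measurable cf.
apply: (le_integrable _ _ _ (integrableD measurableT (integrable_abse f1) (integrable_abse f2))) => //.
  by apply/measurable_EFinP; exact: cmeasurable_normc.
move=> x _ /=; rewrite ger0_norm ?normc_ge0// lee_fin.
by rewrite ger0_norm ?addr_ge0// normc_le_ReIm.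
Qed.

Lemma cintegrableD f g : cintegrable f -> cintegrable g -> cintegrable (fun x => f x + g x).
Proof.
move=> [f1 f2] [g1 g2]; split.
  by under eq_fun do rewrite ReD EFinD; exact: integrableD.
by under eq_fun do rewrite ImD EFinD; exact: integrableD.
Qed.

Lemma cintegrableZ c f : cintegrable f -> cintegrable (fun x => c * f x).
Proof.
move=> [f1 f2]; split.
  by under eq_fun do rewrite ReM EFinB !EFinM; apply: integrableB => //; exact: integrableZl.
by under eq_fun do rewrite ImM EFinD !EFinM; apply: integrableD => //; exact: integrableZl.
Qed.

Lemma cintegrableJ f : cintegrable f -> cintegrable (fun x => conjc (f x)).
Proof.
move=> [f1 f2]; split; first by under eq_fun do rewrite ReJ.
by under eq_fun do rewrite ImJ EFinN; exact: integrableN.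
Qed.

Lemma cintegrable0 : cintegrable (fun=> 0).
Proof. by split; exact: integrable0. Qed.

Lemma cintegrable_sum (I : Type) (s : seq I) (P : pred I) (F : I -> K -> R[i]) :
  (forall i, cintegrable (F i)) -> cintegrable (fun x => \sum_(i <- s | P i) F i x).
Proof.
move=> mF; elim: s => [|i s IH].
  by under eq_fun do rewrite big_nil; exact: cintegrable0.
under eq_fun do rewrite big_cons.
by case: (P i) => //; exact: cintegrableD.
Qed.

Lemma eq_cintegral f g : f =1 g -> cintegral mu f = cintegral mu g.
Proof. by move=> /funext ->. Qed.

Lemma cintegralD f g : cintegrable f -> cintegrable g ->
  cintegral mu (fun x => f x + g x) = cintegral mu f + cintegral mu g.
Proof.
move=> [f1 f2] [g1 g2]; rewrite /cintegral; apply: complex_ext => /=.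
  by under eq_Rintegral do rewrite ReD; rewrite RintegralD.
by under eq_Rintegral do rewrite ImD; rewrite RintegralD.
Qed.

Lemma cintegralZ c f : cintegrable f ->
  cintegral mu (fun x => c * f x) = c * cintegral mu f.
Proof.
move=> [f1 f2]; rewrite /cintegral; apply: complex_ext; rewrite ?ReM ?ImM /=.
  under eq_Rintegral do rewrite ReM.
  by rewrite RintegralB ?RintegralZl//; first [exact: (integrableZl measurableT _ f1) | exact: (integrableZl measurableT _ f2)].
under eq_Rintegral do rewrite ImM.
by rewrite RintegralD ?RintegralZl//; first [exact: (integrableZl measurableT _ f1) | exact: (integrableZl measurableT _ f2)].
Qed.

Lemma cintegralB f g : cintegrable f -> cintegrable g ->
  cintegral mu (fun x => f x - g x) = cintegral mu f - cintegral mu g.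
Proof.
move=> cf cg; rewrite -mulN1r -cintegralZ// -cintegralD//; last exact: cintegrableZ.
by apply: eq_cintegral => x; rewrite mulN1r.
Qed.

Lemma cintegralJ f : cintegrable f ->
  cintegral mu (fun x => conjc (f x)) = conjc (cintegral mu f).
Proof.
move=> [f1 f2]; rewrite /cintegral; apply: complex_ext => /=.
  by under eq_Rintegral do rewrite ReJ.
under eq_Rintegral do rewrite ImJ -mulN1r.
by rewrite RintegralZl// mulN1r.
Qed.

Lemma cintegral0 : cintegral mu (fun=> 0) = 0.
Proof.
rewrite -[RHS](mul0r (cintegral mu (fun=> 0))) -cintegralZ; last exact: cintegrable0.
by apply: eq_cintegral => x; rewrite mul0r.
Qed.

Lemma cintegral_sum (I : Type) (s : seq I) (P : pred I) (F : I -> K -> R[i]) :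
  (forall i, cintegrable (F i)) ->
  cintegral mu (fun x => \sum_(i <- s | P i) F i x) = \sum_(i <- s | P i) cintegral mu (F i).
Proof.
move=> mF; elim: s => [|i s IH].
  by rewrite big_nil; under eq_cintegral do rewrite big_nil; exact: cintegral0.
rewrite big_cons; under eq_cintegral do rewrite big_cons.
by case: (P i) => //; rewrite cintegralD ?IH//; exact: cintegrable_sum.
Qed.

Lemma cintegral_real (r : borel K -> R) :
  cintegral mu (fun x => (r x)%:C%C) = (Rintegral mu setT r)%:C%C.
Proof.
rewrite /cintegral; apply: complex_ext => //=.
by rewrite /Rintegral integral0.
Qed.

(** A unimodular constant rotates the integral to the positive axis, where it is the integral of
a real part. *)
Lemma normc_cintegral_le f : cintegrable f ->
  ((normc (cintegral mu f))%:E <= \int[mu]_x (normc (f x))%:E)%E.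
Proof.
move=> cf; set I := cintegral mu f.
have [I0|I0] := eqVneq (normc I) 0.
  by rewrite I0; apply: integral_ge0 => x _; rewrite lee_fin normc_ge0.
pose w := conjc I / (normc I)%:C%C.
have nI : 0 < normc I by rewrite lt_neqAle eq_sym I0 normc_ge0.
have wI : w * I = (normc I)%:C%C.
  rewrite /w mulrAC [_ * I]mulrC mulcJ expr2 rmorphM /= mulfK//.
  by apply/eqP => -[]; apply/eqP.
have nw : normc w = 1.
  by rewrite /w Normc.normcM Normc.normcV normc_conj normc_real ger0_norm ?normc_ge0// mulfV.
have cwf := cintegrableZ w cf.
have : Re (cintegral mu (fun x => w * f x)) = normc I by rewrite cintegralZ// wI.
rewrite /cintegral /= => <-; have [cw1 _] := cwf.
rewrite /Rintegral fineK; last exact: integrable_fin_num.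
apply: le_integral => //; first exact: cintegrable_normc.
move=> x _; rewrite lee_fin (le_trans (ler_norm _))// (le_trans (Re_le_normc _))//.
by rewrite Normc.normcM nw mul1r.
Qed.

Lemma cintegral_ae_eq f g : cmeasurable f -> cmeasurable g ->
  {ae mu, forall x : borel K, f x = g x} -> cintegral mu f = cintegral mu g.
Proof.
move=> [f1 f2] [g1 g2] fg; rewrite /cintegral /Rintegral; apply: complex_ext => /=.
  congr fine; apply: ae_eq_integral => //; try exact/measurable_EFinP.
  by apply: filterS fg => x /= ->.
congr fine; apply: ae_eq_integral => //; try exact/measurable_EFinP.
by apply: filterS fg => x /= ->.
Qed.

(** * Square integrable functions *)

Definition sqI f : \bar R := \int[mu]_x (normc (f x) ^+ 2)%:E.
(** The square of the L2 norm: in this form the frame identity and the changes of variables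
involve no roots. *)
Definition nrm f : R := fine (sqI f).
Definition L2 f := cmeasurable f /\ (sqI f < +oo)%E.

Lemma sqI_ge0 f : (0 <= sqI f)%E.
Proof. by apply: integral_ge0 => x _; rewrite lee_fin sqr_ge0. Qed.

Lemma poweR2 (x : \bar R) : (0 <= x)%E -> (x `^ 2 = x ^+ 2)%E.
Proof.
case: x => [r r0| _|//]; first by rewrite poweR_EFin powR_mulrn// EFin_expe.
by rewrite poweRyr ?pnatr_eq0// expe2 mulyy.
Qed.

Lemma cLnorm2_pow f : (cLnorm mu 2 f `^ 2 = sqI f)%E.
Proof.
rewrite /cLnorm poweR_Lnorm ?pnatr_eq0//; apply: eq_integral => x _ /=.
by rewrite ger0_norm ?normc_ge0// powR_mulrn ?normc_ge0.
Qed.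

Lemma cLnorm2_sq f : (cLnorm mu 2 f ^+ 2 = sqI f)%E.
Proof. by rewrite -poweR2 ?cLnorm2_pow//; exact: Lnorm_ge0. Qed.

Lemma cLfun2P f : cLfun mu 2 f <-> L2 f.
Proof.
rewrite /cLfun /L2 -cLnorm2_pow; split => -[? H]; split => //.
  exact: poweR_lty.
by apply: lty_poweRy H; rewrite pnatr_eq0.
Qed.

Lemma cLnorm2_lt f (d : R) : 0 < d ->
  (cLnorm mu 2 f < d%:E)%E = (sqI f < (d ^+ 2)%:E)%E.
Proof.
move=> d0; rewrite -cLnorm2_pow; have : (0 <= cLnorm mu 2 f)%E by exact: Lnorm_ge0.
case: (cLnorm mu 2 f) => [r r0|_|//]; last by rewrite poweRyr ?pnatr_eq0.
rewrite poweR_EFin powR_mulrn// !lte_fin.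
by rewrite ltr_pXn2r// nnegrE// ltW.
Qed.

Lemma L2_fin f : L2 f -> sqI f = (nrm f)%:E.
Proof. by move=> [_ h]; rewrite /nrm fineK// ge0_fin_numE// sqI_ge0. Qed.

Lemma nrm_ge0 f : 0 <= nrm f.
Proof. by rewrite /nrm fine_ge0// sqI_ge0. Qed.

Lemma L2_meas f : L2 f -> cmeasurable f. Proof. by case. Qed.

Lemma L2_integrable f : L2 f ->
  mu.-integrable [set: borel K] (fun x : borel K => (normc (f x) ^+ 2)%:E).
Proof.
move=> [mf fi]; apply: integrable_ge0 => //; first exact: cmeasurable_normc2.
by move=> x; exact: sqr_ge0.
Qed.

Lemma sqI_le f g : cmeasurable f -> cmeasurable g ->
  (forall x, normc (f x) <= normc (g x)) -> (sqI f <= sqI g)%E.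
Proof.
move=> mf mg fg; apply: ge0_le_integral => //.
- by move=> x _; rewrite lee_fin sqr_ge0.
- by apply/measurable_EFinP; exact: cmeasurable_normc2.
- by apply/measurable_EFinP; exact: cmeasurable_normc2.
by move=> x _; rewrite lee_fin ler_pXn2r// nnegrE normc_ge0.
Qed.

Lemma sqI_ae_eq f g : cmeasurable f -> cmeasurable g ->
  {ae mu, forall x : borel K, f x = g x} -> sqI f = sqI g.
Proof.
move=> mf mg fg; apply: ae_eq_integral => //.
- by apply/measurable_EFinP; exact: cmeasurable_normc2.
- by apply/measurable_EFinP; exact: cmeasurable_normc2.
by apply: filterS fg => x /= ->.
Qed.

Lemma L2_le f g : cmeasurable f -> L2 g ->
  (forall x, normc (f x) <= normc (g x)) -> L2 f.
Proof. by move=> mf [mg gi] fg; split => //; apply: le_lt_trans gi; exact: sqI_le. Qed.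

Lemma sqID_le f g (t : R) : cmeasurable f -> cmeasurable g -> 0 < t ->
  (sqI (fun x => f x + g x)%R <= (1 + t)%:E * sqI f + (1 + t^-1)%:E * sqI g)%E.
Proof.
move=> mf mg t0; have t1 : 0 <= 1 + t by rewrite addr_ge0// ltW.
have t2 : 0 <= 1 + t^-1 by rewrite addr_ge0// invr_ge0 ltW.
have mf2 : measurable_fun setT (fun x : borel K => (normc (f x) ^+ 2)%:E).
  by apply/measurable_EFinP; exact: cmeasurable_normc2.
have mg2 : measurable_fun setT (fun x : borel K => (normc (g x) ^+ 2)%:E).
  by apply/measurable_EFinP; exact: cmeasurable_normc2.
rewrite /sqI -!ge0_integralZl_EFin//; try by move=> x _; rewrite lee_fin sqr_ge0.
rewrite -ge0_integralD//; last 4 first.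
- by move=> x _; rewrite -EFinM lee_fin mulr_ge0// sqr_ge0.
- exact: measurable_funeM.
- by move=> x _; rewrite -EFinM lee_fin mulr_ge0// sqr_ge0.
- exact: measurable_funeM.
apply: ge0_le_integral => //.
- by move=> x _; rewrite lee_fin sqr_ge0.
- by apply/measurable_EFinP; apply: cmeasurable_normc2; exact: cmeasurableD.
- by apply: emeasurable_funD; exact: measurable_funeM.
move=> x _; rewrite -!EFinM -EFinD lee_fin; exact: normc_sqD_weighted.
Qed.

Lemma sqIZ (c : R[i]) f : cmeasurable f ->
  sqI (fun x => c * f x)%R = ((normc c ^+ 2)%:E * sqI f)%E.
Proof.
move=> mf; rewrite /sqI -ge0_integralZl_EFin//.
- by apply: eq_integral => x _; rewrite -EFinM Normc.normcM exprMn.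
- by move=> x _; rewrite lee_fin sqr_ge0.
- by apply/measurable_EFinP; exact: cmeasurable_normc2.
- exact: sqr_ge0.
Qed.

Lemma L2D f g : L2 f -> L2 g -> L2 (fun x => f x + g x).
Proof.
move=> L2f L2g; split; first exact: cmeasurableD (L2_meas L2f) (L2_meas L2g).
apply: le_lt_trans (sqID_le (L2_meas L2f) (L2_meas L2g) (ltr01)) _.
by rewrite (L2_fin L2f) (L2_fin L2g) -!EFinM -EFinD ltry.
Qed.

Lemma L2Z (c : R[i]) f : L2 f -> L2 (fun x => c * f x).
Proof.
move=> L2f; split; first exact: cmeasurableZ (L2_meas L2f).
by rewrite sqIZ ?(L2_fin L2f) -?EFinM ?ltry//; exact: L2_meas.
Qed.

Lemma L2B f g : L2 f -> L2 g -> L2 (fun x => f x - g x).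
Proof.
move=> L2f L2g; have := L2D L2f (L2Z (-1) L2g).
by under eq_fun do rewrite mulN1r.
Qed.

Lemma L20 : L2 (fun=> 0).
Proof.
split; first exact: cmeasurable_cst.
by rewrite /sqI; under eq_integral do rewrite Normc.normc0 expr0n; rewrite integral0 ltry.
Qed.

Lemma L2_sum (I : Type) (s : seq I) (P : pred I) (F : I -> K -> R[i]) :
  (forall i, L2 (F i)) -> L2 (fun x => \sum_(i <- s | P i) F i x).
Proof.
move=> mF; elim: s => [|i s IH].
  by under eq_fun do rewrite big_nil; exact: L20.
under eq_fun do rewrite big_cons.
by case: (P i) => //; exact: L2D.
Qed.

Lemma L2_mul_bounded h f (C : R) : cmeasurable h -> (forall x, normc (h x) <= C) ->
  L2 f -> L2 (fun x => h x * f x).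
Proof.
move=> mh hC L2f; have C0 : 0 <= C by apply: le_trans (hC 0); exact: normc_ge0.
apply: (L2_le (g := fun x => C%:C%C * f x)).
- by apply: cmeasurableM => //; exact: L2_meas.
- exact: L2Z.
by move=> x; rewrite !Normc.normcM normc_real ger0_norm// ler_wpM2r ?normc_ge0.
Qed.

Lemma L2_mulJ f g : L2 f -> L2 g -> cintegrable (fun x => f x * conjc (g x)).
Proof.
move=> L2f L2g.
have ig := integrableD measurableT (L2_integrable L2f) (L2_integrable L2g).
apply: (cintegrable_dom (g := fun x : borel K => normc (f x) ^+ 2 + normc (g x) ^+ 2)).
- by apply: cmeasurableM; [|apply: cmeasurableJ]; exact: L2_meas.
- move=> x; apply: le_trans (normcM_le _ _) _; rewrite normc_conj.
  by have := sqr_ge0 (normc (f x)); have := sqr_ge0 (normc (g x)); lra.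
by [].
Qed.

Lemma innerDl f g h : L2 f -> L2 g -> L2 h ->
  inner mu (fun x => f x + g x) h = inner mu f h + inner mu g h.
Proof.
move=> ? ? ?; rewrite /inner -cintegralD; try exact: L2_mulJ.
by apply: eq_cintegral => x; rewrite mulrDl.
Qed.

Lemma innerZl c f g : L2 f -> L2 g -> inner mu (fun x => c * f x) g = c * inner mu f g.
Proof.
move=> ? ?; rewrite /inner -cintegralZ; last exact: L2_mulJ.
by apply: eq_cintegral => x; rewrite mulrA.
Qed.

Lemma innerJ f g : L2 f -> L2 g -> inner mu g f = conjc (inner mu f g).
Proof.
move=> ? ?; rewrite /inner -cintegralJ; last exact: L2_mulJ.
by apply: eq_cintegral => x; rewrite rmorphM /= conjcK mulrC.
Qed.

Lemma inner_suml (I : Type) (s : seq I) (P : pred I) (F : I -> K -> R[i]) g :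
  (forall i, L2 (F i)) -> L2 g ->
  inner mu (fun x => \sum_(i <- s | P i) F i x) g = \sum_(i <- s | P i) inner mu (F i) g.
Proof.
move=> LF Lg; rewrite /inner -cintegral_sum; last by move=> i; exact: L2_mulJ.
by apply: eq_cintegral => x; rewrite mulr_suml.
Qed.

Lemma innerBl f g h : L2 f -> L2 g -> L2 h ->
  inner mu (fun x => f x - g x) h = inner mu f h - inner mu g h.
Proof.
move=> Lf Lg Lh; rewrite -mulN1r -innerZl// -innerDl//; last exact: L2Z.
by apply: eq_cintegral => x; rewrite mulN1r.
Qed.

Lemma innerBr f g h : L2 f -> L2 g -> L2 h ->
  inner mu h (fun x => f x - g x) = inner mu h f - inner mu h g.
Proof.
move=> Lf Lg Lh; rewrite innerJ//; last exact: L2B.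
by rewrite innerBl// conjcB (innerJ Lf Lh) (innerJ Lg Lh).
Qed.

Lemma innerZr c f g : L2 f -> L2 g -> inner mu f (fun x => c * g x) = conjc c * inner mu f g.
Proof.
move=> Lf Lg; rewrite innerJ//; last exact: L2Z.
by rewrite innerZl// conjcM (innerJ Lg Lf).
Qed.

Lemma inner_nrm f : L2 f -> inner mu f f = (nrm f)%:C%C.
Proof.
move=> Lf; rewrite /inner; under eq_cintegral do rewrite mulcJ.
by rewrite cintegral_real.
Qed.

Lemma nrmB f g : L2 f -> L2 g ->
  nrm (fun x => f x - g x) = nrm f - 2 * Re (inner mu f g) + nrm g.
Proof.
move=> Lf Lg; have LB := L2B Lf Lg.
have := inner_nrm LB; rewrite innerBl// !innerBr// !inner_nrm// (innerJ Lf Lg).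
move=> /(congr1 (fun z : R[i] => Re z)) /= <-; case: (inner mu f g) => a b /=; ring.
Qed.

Lemma nrmZ c f : L2 f -> nrm (fun x => c * f x) = normc c ^+ 2 * nrm f.
Proof. by move=> Lf; rewrite /nrm sqIZ ?(L2_fin Lf)//; exact: L2_meas. Qed.

Lemma nrmD_le f g (t : R) : L2 f -> L2 g -> 0 < t ->
  nrm (fun x => f x + g x) <= (1 + t) * nrm f + (1 + t^-1) * nrm g.
Proof.
move=> Lf Lg t0; have := sqID_le (L2_meas Lf) (L2_meas Lg) t0.
by rewrite (L2_fin Lf) (L2_fin Lg) (L2_fin (L2D Lf Lg)) -!EFinM -EFinD lee_fin.
Qed.

(** The polynomial in t obtained from nrm (f - t z g) >= 0, with z the inner product, is
evaluated at its minimum, or at a large t if nrm g = 0. *)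
Lemma inner_CS f g : L2 f -> L2 g -> normc (inner mu f g) ^+ 2 <= nrm f * nrm g.
Proof.
move=> Lf Lg; set z := inner mu f g.
have H (t : R) : 0 <= nrm f - 2 * (t * normc z ^+ 2) + t ^+ 2 * normc z ^+ 2 * nrm g.
  have := nrm_ge0 (fun x => f x - (t%:C%C * z) * g x).
  rewrite nrmB//; last exact: L2Z.
  rewrite innerZr// nrmZ// Normc.normcM normc_real exprMn (@real_normK _ _ (num_real _)).
  rewrite -/z conjcM conjc_real -mulrA [conjc z * z]mulrC mulcJ -rmorphM /=.
  by [].
have [g0|g0] := eqVneq (nrm g) 0.
  have [z0|z0] := eqVneq (normc z ^+ 2) 0; first by rewrite z0 g0 mulr0.
  have := H ((nrm f + 1) / (2 * normc z ^+ 2)); rewrite g0 !mulr0 addr0.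
  have -> : 2 * ((nrm f + 1) / (2 * normc z ^+ 2) * normc z ^+ 2) = nrm f + 1.
    by field; move: z0; rewrite expf_eq0.
  lra.
have g0' : 0 < nrm g by rewrite lt_neqAle eq_sym g0 nrm_ge0.
have := H (nrm g)^-1.
have -> : nrm f - 2 * ((nrm g)^-1 * normc z ^+ 2) + (nrm g)^-1 ^+ 2 * normc z ^+ 2 * nrm g
  = (nrm f * nrm g - normc z ^+ 2) / nrm g by field.
by rewrite pmulr_lge0 ?invr_gt0// subr_ge0.
Qed.

End ComplexIntegral.

(** * Sums in the extended reals *)

#[local] Arguments Normc.normc : simpl never.

Section ExtendedReals.
Context {R : realType}.
Local Open Scope ereal_scope.

Lemma ecvg0P (u : nat -> \bar R) : (forall n, 0 <= u n) ->
  (u @ \oo --> 0%E) <->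
  forall e : R, (0 < e)%R -> exists N, forall n, (N <= n)%N -> u n < e%:E.
Proof.
move=> u0; split => [h e e0|H].
  have e0' : (0 : \bar R) < e%:E by rewrite lte_fin.
  have [N _ HN] := h _ (open_ereal_lt' e0').
  by exists N => n Nn; exact: HN.
apply/fine_cvgP; split.
  have [N HN] := H 1%R ltr01; exists N => // n /= Nn.
  rewrite ge0_fin_numE//; apply: lt_trans (HN n Nn) _; exact: ltry.
apply/cvgrPdist_lt => e e0; have [N HN] := H e e0; exists N => // n /= Nn.
rewrite sub0r normrN ger0_norm ?fine_ge0// -lte_fin fineK; first exact: HN.
by rewrite ge0_fin_numE//; apply: lt_trans (HN n Nn) _; exact: ltry.
Qed.

Lemma esum_ub (I : choiceType) (a : I -> \bar R) (M : \bar R) :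
  (forall s : seq I, uniq s -> \sum_(i <- s) a i <= M) ->
  \esum_(i in [set: I]) a i <= M.
Proof.
move=> H; apply: ge_ereal_sup => _ [X [finX _] <-].
by rewrite fsbig_finite//; apply: H; exact: fset_uniq.
Qed.

Lemma esum_lb (I : choiceType) (a : I -> \bar R) (s : seq I) : uniq s ->
  \sum_(i <- s) a i <= \esum_(i in [set: I]) a i.
Proof.
move=> us; apply: esum_ge; exists [set` s]; last by rewrite fsbig_seq.
by split => //; exact: finite_seq.
Qed.

Lemma esum_pair (I J : choiceType) (a : I -> J -> \bar R) : (forall i j, 0 <= a i j) ->
  \esum_(i in [set: I]) \esum_(j in [set: J]) a i j =
  \esum_(k in [set: (I * J)%type]) a k.1 k.2.
Proof.
move=> a0; rewrite esum_esum//; congr esum.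
by apply/seteqP; split.
Qed.

Lemma esum_ord (n : nat) (a : 'I_n -> \bar R) : (forall i, 0 <= a i) ->
  \esum_(i in [set: 'I_n]) a i = \sum_(i < n) a i.
Proof.
move=> a0; apply/eqP; rewrite eq_le; apply/andP; split; last first.
  exact: (esum_lb a (index_enum_uniq _)).
apply: esum_ub => s us; rewrite big_uniq// big_mkcond.
by apply: lee_sum => i _; case: ifP.
Qed.

Lemma esum_le_adherent (I : choiceType) (a : I -> \bar R) (M d : R) : (0 < d)%R ->
  \esum_(i in [set: I]) a i = M%:E ->
  exists2 s : seq I, uniq s & (M - d)%:E < \sum_(i <- s) a i.
Proof.
move=> d0 aM; apply: contrapT => H.
have : \esum_(i in [set: I]) a i <= (M - d)%:E.
  apply: esum_ub => s us; rewrite leNgt; apply/negP => h; apply: H; by exists s.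
by rewrite aM lee_fin; lra.
Qed.

End ExtendedReals.

(** Let d tend to 0 for fixed t, and then t to 0. *)
Lemma le_small_errors {R : realType} (X A : R) (C : R -> R) : 0 <= A ->
  (forall t d, 0 < t -> 0 < d -> X <= (1 + t) * (1 + t) * A + C t * d) -> X <= A.
Proof.
move=> A0 H.
have H1 t : 0 < t -> X <= (1 + t) * (1 + t) * A.
  move=> t0; apply/ler_addgt0Pr => e e0.
  have C0 : 0 < `|C t| + 1 by rewrite ltr_wpDl.
  apply: le_trans (H t (e / (`|C t| + 1)) t0 (divr_gt0 e0 C0)) _.
  rewrite lerD2l mulrA ler_pdivrMr// [e * _]mulrC ler_pM2r//.
  by rewrite (le_trans (ler_norm _))// lerDl.
apply/ler_addgt0Pr => e e0.
pose t := Num.min 1 (e / (3 * A + 1)).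
have A1 : 0 < 3 * A + 1 by lra.
have t0 : 0 < t by rewrite lt_min ltr01 divr_gt0.
have t1 : t <= 1 by rewrite ge_min lexx.
have te : t * (3 * A + 1) <= e by rewrite -ler_pdivlMr// ge_min lexx orbT.
apply: le_trans (H1 t t0) _; nra.
Qed.

(** * Frames and orthonormal bases *)

Section HilbertSpace.
Context {R : realType} {K : topologicalFieldType}.
Variable mu : {measure set (borel K) -> \bar R}.
Implicit Types f g h : K -> R[i].
Local Notation L2 := (L2 mu).
Local Notation nrm := (nrm mu).
Local Notation inner := (inner mu).
Local Notation sqI := (sqI mu).

Lemma cLnorm2_cvg0 (F : nat -> K -> R[i]) :
  ((fun n => cLnorm mu 2 (F n)) @ \oo --> 0%E) <->
  forall e : R, 0 < e -> exists N, forall n, (N <= n)%N -> (sqI (F n) < e%:E)%E.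
Proof.
rewrite ecvg0P; last by move=> n; exact: Lnorm_ge0.
split => H e e0.
  have se0 : 0 < Num.sqrt e by rewrite sqrtr_gt0.
  have [N HN] := H _ se0; exists N => n Nn.
  by have := HN n Nn; rewrite cLnorm2_lt// sqr_sqrtr// ltW.
have [N HN] := H (e ^+ 2) (exprn_gt0 _ e0); exists N => n Nn.
by rewrite cLnorm2_lt//; exact: HN.
Qed.

Lemma inner_sumr (I : Type) (s : seq I) (P : pred I) (F : I -> K -> R[i]) g :
  (forall i, L2 (F i)) -> L2 g ->
  inner g (fun x => \sum_(i <- s | P i) F i x) = \sum_(i <- s | P i) inner g (F i).
Proof.
move=> LF Lg; rewrite innerJ//; last exact: L2_sum.
rewrite inner_suml// rmorph_sum; apply: eq_bigr => i _.
by rewrite /= (innerJ (LF i) Lg).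
Qed.

Section Orthonormal.
Context {I : choiceType}.
Variable e : I -> K -> R[i].
Hypothesis Le : forall i, L2 (e i).

Section OrthonormalFamily.
Hypothesis one : forall i j, inner (e i) (e j) = (i == j)%:R.

Lemma nrm_orthonormal (s : seq I) (a : I -> R[i]) : uniq s ->
  nrm (fun x => \sum_(i <- s) a i * e i x) = \sum_(i <- s) normc (a i) ^+ 2.
Proof.
move=> us; have LF i : L2 (fun x => a i * e i x) by exact: L2Z.
apply: (@complexI R); rewrite -inner_nrm; last exact: L2_sum.
rewrite inner_suml//; last exact: L2_sum.
rewrite rmorph_sum /= big_seq [RHS]big_seq; apply: eq_bigr => i si.
rewrite inner_sumr// (bigD1_seq i)//= big1; last first.
  by move=> j ji; rewrite innerZl ?innerZr// one eq_sym (negbTE ji) !mulr0.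
by rewrite innerZl ?innerZr// one eqxx mulr1 addr0 mulcJ.
Qed.

(** Completing the square; Bessel's inequality and the best approximation property are both read
off from it. *)
Lemma nrm_sub_orthonormal f (s : seq I) (a : I -> R[i]) : uniq s -> L2 f ->
  nrm (fun x => f x - \sum_(i <- s) a i * e i x) =
  nrm f - \sum_(i <- s) normc (inner f (e i)) ^+ 2 +
  \sum_(i <- s) normc (a i - inner f (e i)) ^+ 2.
Proof.
move=> us Lf; have LF i : L2 (fun x => a i * e i x) by exact: L2Z.
rewrite nrmB//; last exact: L2_sum.
rewrite nrm_orthonormal// inner_sumr//.
have -> : Re (\sum_(i <- s) inner f (fun x => a i * e i x)) =
    \sum_(i <- s) Re (conjc (a i) * inner f (e i)).
  elim: (s) => [|i s' IH]; first by rewrite !big_nil.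
  by rewrite !big_cons ReD IH innerZr.
have -> : \sum_(i <- s) normc (a i - inner f (e i)) ^+ 2 =
    \sum_(i <- s) normc (inner f (e i)) ^+ 2 -
    2 * \sum_(i <- s) Re (conjc (a i) * inner f (e i)) + \sum_(i <- s) normc (a i) ^+ 2.
  rewrite mulr_sumr -sumrB -big_split; apply: eq_bigr => i _ /=.
  by case: (a i) (inner f (e i)) => [a1 a2] [b1 b2]; rewrite !normc_sq /=; ring.
ring.
Qed.

Lemma bessel f (s : seq I) : uniq s -> L2 f ->
  \sum_(i <- s) normc (inner f (e i)) ^+ 2 <= nrm f.
Proof.
move=> us Lf; have := nrm_ge0 mu (fun x => f x - \sum_(i <- s) inner f (e i) * e i x).
rewrite nrm_sub_orthonormal// [X in _ + X]big1 ?addr0 ?subr_ge0//.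
by move=> i _; rewrite subrr Normc.normc0 expr0n.
Qed.

(** A combination may list an index repeatedly; its coefficients are added up. *)
Lemma sum_undup (s : seq I) (a : I -> R[i]) : exists b : I -> R[i],
  forall x, \sum_(i <- s) a i * e i x = \sum_(i <- undup s) b i * e i x.
Proof.
exists (fun i => a i *+ count_mem i s) => x.
rewrite -big_undup_iterop_count; apply: eq_bigr => i _.
by transitivity ((a i * e i x) *+ count_mem i s) => //; rewrite mulrnAl.
Qed.

(** Bessel's inequality gives one direction. For the other, a combination close to f is no
closer than the partial sum of the expansion over the same indices. *)
Lemma parseval f : L2 f ->
  (forall d : R, 0 < d -> exists (s : seq I) (a : I -> R[i]),
    nrm (fun x => f x - \sum_(i <- s) a i * e i x) < d) ->
  \esum_(i in [set: I]) (normc (inner f (e i)) ^+ 2)%:E = (nrm f)%:E.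
Proof.
move=> Lf dense; apply/eqP; rewrite eq_le; apply/andP; split.
  by apply: esum_ub => s us; rewrite sumEFin lee_fin; exact: bessel.
apply/lee_addgt0Pr => d d0; have [s [a Hs]] := dense d d0.
have [b Hb] := sum_undup s a; have us := undup_uniq s.
have Hs' : nrm (fun x => f x - \sum_(i <- undup s) b i * e i x) < d.
  rewrite (_ : (fun x => f x - \sum_(i <- undup s) b i * e i x) =
    (fun x => f x - \sum_(i <- s) a i * e i x))//.
  by apply/funext => x; rewrite Hb.
rewrite nrm_sub_orthonormal// in Hs'.
have h0 : 0 <= \sum_(i <- undup s) normc (b i - inner f (e i)) ^+ 2.
  by apply: sumr_ge0 => i _; exact: sqr_ge0.
apply: (@le_trans _ _ (\sum_(i <- undup s) (normc (inner f (e i)) ^+ 2)%:E + d%:E)%E).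
  by rewrite sumEFin -EFinD lee_fin; lra.
by apply: leeD => //; exact: esum_lb.
Qed.

End OrthonormalFamily.

Lemma sum_inner_weighted (s : seq I) f g (t : R) : L2 f -> L2 g -> 0 < t ->
  \sum_(i <- s) normc (inner f (e i)) ^+ 2 <=
  (1 + t) * (\sum_(i <- s) normc (inner g (e i)) ^+ 2) +
  (1 + t^-1) * (\sum_(i <- s) normc (inner (fun x => f x - g x) (e i)) ^+ 2).
Proof.
move=> Lf Lg t0; rewrite !mulr_sumr -big_split; apply: ler_sum => i _ /=.
apply: le_trans (normc_sqD_weighted _ _ t0); rewrite innerBl//.
by rewrite addrC subrK.
Qed.

Lemma nrm_weighted f g (t : R) : L2 f -> L2 g -> 0 < t ->
  nrm f <= (1 + t) * nrm g + (1 + t^-1) * nrm (fun x => f x - g x).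
Proof.
move=> Lf Lg t0; apply: le_trans (nrmD_le Lg (L2B Lf Lg) t0).
by rewrite le_eqVlt; apply/orP; left; apply/eqP; congr nrm; apply/funext => x; rewrite addrC subrK.
Qed.

Lemma nrm_subC f g : nrm (fun x => f x - g x) = nrm (fun x => g x - f x).
Proof.
apply: (congr1 fine); apply: eq_integral => x _.
by rewrite -normc_oppr opprB.
Qed.

Section TightFrame.
Variable V : (K -> R[i]) -> Prop.
Hypothesis V_L2 : forall g, V g -> L2 g.
Hypothesis V_frame : forall g, V g ->
  \esum_(i in [set: I]) (normc (inner g (e i)) ^+ 2)%:E = (nrm g)%:E.
Hypothesis V_dense : forall f, L2 f -> forall d : R, 0 < d ->
  exists2 g, V g & nrm (fun x => f x - g x) < d.

(** A finite sum of squared coefficients depends continuously on f, so the bound extends from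
the dense set V. *)
Lemma frame_bessel f (s : seq I) : L2 f -> uniq s ->
  \sum_(i <- s) normc (inner f (e i)) ^+ 2 <= nrm f.
Proof.
move=> Lf us; pose B := \sum_(i <- s) nrm (e i).
have B0 : 0 <= B by apply: sumr_ge0 => i _; exact: nrm_ge0.
apply: (@le_small_errors _ _ _ (fun t => (1 + t) * (1 + t^-1) + (1 + t^-1) * B)).
  exact: nrm_ge0.
move=> t d t0 d0; have [g Vg gd] := V_dense Lf d0; have Lg := V_L2 Vg.
have ti0 : 0 < t^-1 by rewrite invr_gt0.
have LB := L2B Lf Lg.
apply: le_trans (sum_inner_weighted s Lf Lg t0) _.
have h1 : \sum_(i <- s) normc (inner g (e i)) ^+ 2 <= nrm g.
  by rewrite -lee_fin -V_frame// -sumEFin; exact: esum_lb.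
have h2 : \sum_(i <- s) normc (inner (fun x => f x - g x) (e i)) ^+ 2 <= d * B.
  rewrite mulr_sumr; apply: ler_sum => i _; apply: le_trans (inner_CS LB (Le i)) _.
  by rewrite ler_wpM2r ?nrm_ge0// ltW.
have h3 := nrm_weighted Lg Lf t0; rewrite nrm_subC in h3.
have h4 : (1 + t) * \sum_(i <- s) normc (inner g (e i)) ^+ 2 <=
   (1 + t) * ((1 + t) * nrm f + (1 + t^-1) * d).
  rewrite ler_pM2l ?addr_gt0//; apply: le_trans h1 (le_trans h3 _).
  by rewrite lerD2l ler_pM2l ?addr_gt0// ltW.
have h5 : (1 + t^-1) * \sum_(i <- s) normc (inner (fun x => f x - g x) (e i)) ^+ 2
   <= (1 + t^-1) * (d * B) by rewrite ler_pM2l ?addr_gt0.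
apply: le_trans (lerD h4 h5) _.
by rewrite le_eqVlt; apply/orP; left; apply/eqP; ring.
Qed.

(** The reverse of frame_bessel needs the coefficients of f - g to be small for g in V close to
f, which is frame_bessel again. *)
Lemma frame_dense f : L2 f ->
  \esum_(i in [set: I]) (normc (inner f (e i)) ^+ 2)%:E = (nrm f)%:E.
Proof.
move=> Lf; have le : (\esum_(i in [set: I]) (normc (inner f (e i)) ^+ 2)%:E <= (nrm f)%:E)%E.
  by apply: esum_ub => s us; rewrite sumEFin lee_fin; exact: frame_bessel.
apply/eqP; rewrite eq_le le /=.
have : (0 <= \esum_(i in [set: I]) (normc (inner f (e i)) ^+ 2)%:E)%E.
  by apply: esum_ge0 => i _; rewrite lee_fin sqr_ge0.
have lb s : uniq s -> ((\sum_(i <- s) normc (inner f (e i)) ^+ 2)%:E <=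
    \esum_(i in [set: I]) (normc (inner f (e i)) ^+ 2)%:E)%E.
  by move=> us; rewrite -sumEFin; exact: esum_lb.
move: le lb; case: (\esum_(i in _) _)%E => // E _ lb; rewrite !lee_fin => E0.
apply: (@le_small_errors _ _ _ (fun t => (1 + t) * (1 + t^-1) + (1 + t^-1))) => //.
move=> t d t0 d0; have [g Vg gd] := V_dense Lf d0; have Lg := V_L2 Vg.
have ti0 : 0 < t^-1 by rewrite invr_gt0.
have LB := L2B Lf Lg.
apply: le_trans (nrm_weighted Lf Lg t0) _.
have h : nrm g <= (1 + t) * E + (1 + t^-1) * d.
  rewrite -lee_fin -V_frame//; apply: esum_ub => s us; rewrite sumEFin lee_fin.
  apply: le_trans (sum_inner_weighted s Lg Lf t0) _; apply: lerD.
    by rewrite ler_pM2l ?addr_gt0// -lee_fin; exact: lb.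
  rewrite ler_pM2l ?addr_gt0//; apply: le_trans (frame_bessel (L2B Lg Lf) us) _.
  by rewrite nrm_subC ltW.
have h4 : (1 + t) * nrm g <= (1 + t) * ((1 + t) * E + (1 + t^-1) * d).
  by rewrite ler_pM2l ?addr_gt0.
have h5 : (1 + t^-1) * nrm (fun x => f x - g x) <= (1 + t^-1) * d.
  by rewrite ler_pM2l ?addr_gt0// ltW.
apply: le_trans (lerD h4 h5) _.
by rewrite le_eqVlt; apply/orP; left; apply/eqP; ring.
Qed.

End TightFrame.

(** For f = e i the identity reads 1 = 1 + (squares of the inner products with the other
vectors), so these vanish. Partial sums of the expansion then approximate f, by the identity
for f itself. *)
Lemma tight_frame_orthonormal_basis :
  (forall f, L2 f ->
    \esum_(i in [set: I]) (normc (inner f (e i)) ^+ 2)%:E = (nrm f)%:E) ->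
  (forall i, nrm (e i) = 1) -> orthonormal_basis mu e.
Proof.
move=> tf e1.
have one i j : inner (e i) (e j) = (i == j)%:R.
  have [<-|ij] := eqVneq i j; first by rewrite inner_nrm// e1.
  have us : uniq [:: i; j] by rewrite /= inE ij.
  have := @esum_lb _ _ (fun k => (normc (inner (e i) (e k)) ^+ 2)%:E) _ us.
  rewrite tf// sumEFin lee_fin !big_cons big_nil addr0 inner_nrm// e1.
  rewrite Normc.normc1 expr1n gerDl => h.
  have : normc (inner (e i) (e j)) ^+ 2 == 0 by rewrite eq_le h sqr_ge0.
  by rewrite expf_eq0 /= => /eqP /Normc.eq0_normc.
split => //; first by move=> i; exact/cLfun2P.
move=> f /cLfun2P Lf d d0.
have [s us] := esum_le_adherent (exprn_gt0 2 d0) (tf _ Lf).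
rewrite sumEFin lte_fin => Hs; exists s, (fun i => inner f (e i)).
have Lsum : L2 (fun x => \sum_(i <- s) inner f (e i) * e i x).
  by apply: L2_sum => i; exact: L2Z.
rewrite cLnorm2_lt// (L2_fin (L2B Lf Lsum)) lte_fin nrm_sub_orthonormal//.
rewrite [X in _ + X]big1 ?addr0; first by lra.
by move=> i _; rewrite subrr Normc.normc0 expr0n.
Qed.

Lemma orthonormal_basis_tight_frame : orthonormal_basis mu e -> forall f, L2 f ->
  \esum_(i in [set: I]) (normc (inner f (e i)) ^+ 2)%:E = (nrm f)%:E.
Proof.
move=> [_ one dense] f Lf; apply: parseval => // d d0.
have sd0 : 0 < Num.sqrt d by rewrite sqrtr_gt0.
have [s [a]] := dense f ((cLfun2P mu f).2 Lf) _ sd0.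
exists s, a; rewrite -lte_fin -L2_fin; last by apply: L2B => //; apply: L2_sum => i; exact: L2Z.
by rewrite -[X in (_ < X%:E)%E](@sqr_sqrtr _ d) ?ltW// -cLnorm2_lt.
Qed.

End Orthonormal.

(** * Completeness of L2 *)

Section Completeness.
Variable G : nat -> K -> R[i].
Hypothesis LG : forall n, L2 (G n).
Hypothesis Gfast : forall k m n, (k <= m)%N -> (k <= n)%N ->
  (sqI (fun x => G m x - G n x)%R <= ((8^-1) ^+ k)%:E)%E.

Let mG n : cmeasurable (G n). Proof. exact: L2_meas (LG n). Qed.

(** The weights 4^k are chosen so that the integral of S is finite, while finiteness of S at a point
makes the increments there of order 2^(-k). *)
Let D k (x : borel K) : \bar R := (4 ^+ k * normc (G k.+1 x - G k x) ^+ 2)%:E.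

Let mD k : measurable_fun setT (D k).
Proof.
apply/measurable_EFinP; apply: measurable_funM; first exact: measurable_cst.
by apply: cmeasurable_normc2; apply: cmeasurableB; exact: mG.
Qed.

Let D_ge0 k x : (0 <= D k x)%E.
Proof. by rewrite /D lee_fin mulr_ge0 ?exprn_ge0 ?normc_ge0. Qed.

Let S x : \bar R := (\sum_(0 <= k <oo) D k x)%E.

Let mS : measurable_fun setT S.
Proof. by apply: ge0_emeasurable_sum => // k x _ _; exact: D_ge0. Qed.

Let intD k : (\int[mu]_x D k x <= (2^-1 ^+ k)%:E)%E.
Proof.
have -> : (\int[mu]_x D k x = (4 ^+ k)%:E * sqI (fun x => G k.+1 x - G k x)%R)%E.
  rewrite -ge0_integralZl_EFin ?exprn_ge0//.
  - by move=> x _; rewrite lee_fin sqr_ge0.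
  - by apply/measurable_EFinP; apply: cmeasurable_normc2; exact: cmeasurableB.
have -> : 2^-1 ^+ k = 4 ^+ k * 8^-1 ^+ k :> R.
  by rewrite -exprMn; congr (_ ^+ _); field.
by rewrite EFinM lee_wpmul2l ?lee_fin ?exprn_ge0// Gfast.
Qed.

Let geo_half n : \sum_(0 <= k < n) (2^-1 ^+ k : R) <= 2.
Proof.
have -> : \sum_(0 <= k < n) (2^-1 ^+ k : R) = 2 - 2 * 2^-1 ^+ n.
  elim: n => [|n IH]; first by rewrite big_nil expr0; ring.
  by rewrite big_nat_recr//= IH exprS; field.
by rewrite gerBl mulr_ge0// exprn_ge0// invr_ge0.
Qed.

Let intS : (\int[mu]_x S x < +oo)%E.
Proof.
rewrite integral_nneseries//.
apply: (@le_lt_trans _ _ 2%:E); last exact: ltry.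
apply: lime_le; first by apply: is_cvg_nneseries => k _ _; apply: integral_ge0 => x _; exact: D_ge0.
apply: nearW => n; apply: (@le_trans _ _ (\sum_(0 <= k < n) (2^-1 ^+ k)%:E)%E).
  by apply: lee_sum => k _; exact: intD.
by rewrite sumEFin lee_fin; exact: geo_half.
Qed.

Let E : set (borel K) := [set x | (S x < +oo)%E].

Let mE : measurable E.
Proof.
by have := emeasurable_fun_infty_o measurableT mS +oo%E; rewrite setTI.
Qed.

Let S_ge0 x : (0 <= S x)%E.
Proof. by apply: nneseries_ge0 => k _ _; exact: D_ge0. Qed.

Let aeE : {ae mu, forall x : borel K, E x}.
Proof.
have iS : mu.-integrable setT S.
  apply/integrableP; split => //.
  by rewrite (eq_integral S) ?intS// => x _; rewrite gee0_abs ?S_ge0.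
apply: filterS (integrable_ae measurableT iS) => x /(_ I).
by rewrite /E /= ge0_fin_numE// S_ge0.
Qed.

Let diff_le x : E x -> exists2 c : R, 0 <= c &
  forall k, normc (G k.+1 x - G k x) <= c * 2^-1 ^+ k.
Proof.
move=> Ex; exists (Num.sqrt (fine (S x))); first exact: sqrtr_ge0.
move=> k; have h : normc (G k.+1 x - G k x) ^+ 2 <= (Num.sqrt (fine (S x)) * 2^-1 ^+ k) ^+ 2.
  rewrite exprMn sqr_sqrtr ?fine_ge0 ?S_ge0// exprAC.
  have -> : (2^-1 : R) ^+ 2 = 4^-1 by field.
  rewrite exprVn ler_pdivlMr ?exprn_gt0// mulrC -lee_fin fineK; last by rewrite ge0_fin_numE ?S_ge0.
  apply: le_trans (nneseries_lim_ge (u_ := D^~ x) (P := xpredT) k.+1 _).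
    by rewrite big_nat_recr//= leeDr// sume_ge0// => i _; exact: D_ge0.
  by move=> n _ _; exact: D_ge0.
by rewrite -(ler_pXn2r (n:=2))// nnegrE ?normc_ge0// mulr_ge0 ?sqrtr_ge0 ?exprn_ge0 ?invr_ge0.
Qed.

Let cvg_geo (a : nat -> R) (c : R) : 0 <= c ->
  (forall k, `|a k.+1 - a k| <= c * 2^-1 ^+ k) -> cvgn a.
Proof.
move=> c0 H; have -> : a = (fun n => a 0%N + series (telescope a) n).
  by apply/funext => n; exact: eq_sum_telescope.
apply: is_cvgD; first exact: is_cvg_cst.
apply: normed_cvg; apply: (@series_le_cvg _ _ (geometric c 2^-1)).
- by move=> n; exact: normr_ge0.
- by move=> n; rewrite /geometric /= mulr_ge0// exprn_ge0// invr_ge0.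
- by move=> n; exact: H.
by apply: is_cvg_geometric_series; rewrite ger0_norm ?invr_ge0// invf_lt1// ltr1n.
Qed.

(** Off the null set where S is infinite the sequence is replaced by 0, so that it converges
everywhere. *)
Let H n (x : K) : R[i] := cindic E x * G n x.

Let mH n : cmeasurable (H n).
Proof. by apply: cmeasurableM; [exact: cmeasurable_indic|exact: mG]. Qed.

Let HE n x : E x -> H n x = G n x.
Proof. by move=> Ex; rewrite /H cindicE mem_set// mul1r. Qed.

Let HNE n x : ~ E x -> H n x = 0.
Proof. by move=> Ex; rewrite /H cindicE memNset// mul0r. Qed.

Let cvgRe x : cvgn (fun n => Re (H n x)).
Proof.
have [Ex|NE] := pselect (E x); last first.
  rewrite (_ : (fun n => _) = (fun=> Re 0)); first exact: is_cvg_cst.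
  by apply/funext => n; rewrite HNE.
have [c c0 Hc] := diff_le Ex; apply: (cvg_geo c0) => k.
rewrite !HE//; apply: le_trans (Hc k); rewrite -ReN -ReD; exact: Re_le_normc.
Qed.

Let cvgIm x : cvgn (fun n => Im (H n x)).
Proof.
have [Ex|NE] := pselect (E x); last first.
  rewrite (_ : (fun n => _) = (fun=> Im 0)); first exact: is_cvg_cst.
  by apply/funext => n; rewrite HNE.
have [c c0 Hc] := diff_le Ex; apply: (cvg_geo c0) => k.
rewrite !HE//; apply: le_trans (Hc k); rewrite -ImN -ImD; exact: Im_le_normc.
Qed.

Let g (x : K) : R[i] := (limn (fun n => Re (H n x)) +i* limn (fun n => Im (H n x)))%C.

Let mg : cmeasurable g.
Proof.
split => /=.
  apply: (@measurable_fun_cvg _ (borel K) _ _ (fun n (x : borel K) => Re (H n x))).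
    by move=> n; case: (mH n).
  by move=> x _; exact: cvgRe.
apply: (@measurable_fun_cvg _ (borel K) _ _ (fun n (x : borel K) => Im (H n x))).
  by move=> n; case: (mH n).
by move=> x _; exact: cvgIm.
Qed.

(** Fatou's lemma for |G k - H m|^2 as m tends to infinity. *)
Lemma L2_fast_limit : exists2 g, L2 g &
  forall k, (sqI (fun x => G k x - g x)%R <= ((8^-1) ^+ k)%:E)%E.
Proof.
have bound k : (sqI (fun x => G k x - g x)%R <= ((8^-1) ^+ k)%:E)%E.
  pose f m (x : borel K) := (normc (G k x - H m x) ^+ 2)%:E.
  have mf m : measurable_fun setT (f m).
    by apply/measurable_EFinP; apply: cmeasurable_normc2; exact: cmeasurableB.
  have f0 m x : (0 <= f m x)%E by rewrite lee_fin sqr_ge0.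
  have fcvg x : f^~ x @ \oo --> (normc (G k x - g x) ^+ 2)%:E.
    apply: cvg_EFin; first exact: nearW.
    rewrite /f /=.
    rewrite (_ : _ \o _ = (fun m => (Re (G k x) - Re (H m x)) ^+ 2 + (Im (G k x) - Im (H m x)) ^+ 2)).
      rewrite normc_sq ReD ImD ReN ImN /g /=.
      apply: cvgD; rewrite expr2; under eq_fun do rewrite expr2.
        by apply: cvgM; apply: cvgB => //; first [exact: cvg_cst|exact: cvgRe].
      by apply: cvgM; apply: cvgB => //; first [exact: cvg_cst|exact: cvgIm].
    by apply/funext => m /=; rewrite normc_sq ReD ImD ReN ImN.
  have := fatou mu measurableT mf (fun m x _ => f0 m x).
  have -> : (\int[mu]_x limn_einf (f^~ x) = sqI (fun x => G k x - g x)%R)%E.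
    apply: eq_integral => x _; rewrite is_cvg_limn_einfE; last by apply/cvg_ex; eexists; exact: fcvg.
    by apply/cvg_lim => //; exact: fcvg.
  move=> /le_trans; apply.
  rewrite limn_einf_lim; apply: lime_le; first exact: is_cvg_einfs.
  exists k => // m /= km.
  apply: (@le_trans _ _ (\int[mu]_x f m x)%E).
    by apply: ereal_inf_lbound; exists m => /=.
  rewrite (_ : (\int[mu]_x f m x)%E = sqI (fun x => G k x - G m x)%R); first exact: Gfast.
  apply: sqI_ae_eq; first exact: cmeasurableB.
    by apply: cmeasurableB; exact: mG.
  by apply: filterS aeE => x Ex; rewrite HE.
exists g => //.
have LB : L2 (fun x => G 0%N x - g x).
  split; first exact: cmeasurableB.
  by apply: le_lt_trans (bound 0%N) _; exact: ltry.
have := L2B (LG 0%N) LB; congr L2; apply/funext => x; ring.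
Qed.

End Completeness.

(** A subsequence with increments of order 8^(-k) converges, and a Cauchy sequence converges
together with a subsequence. *)
Lemma L2_complete (F : nat -> K -> R[i]) : (forall n, L2 (F n)) ->
  (forall d : R, 0 < d -> exists N, forall m n, (N <= m)%N -> (N <= n)%N ->
     (sqI (fun x => F m x - F n x)%R < d%:E)%E) ->
  exists2 g, L2 g & forall d : R, 0 < d -> exists N, forall n, (N <= n)%N ->
     (sqI (fun x => F n x - g x)%R < d%:E)%E.
Proof.
move=> LF cauchy.
have d8 k : 0 < (8^-1 : R) ^+ k by rewrite exprn_gt0// invr_gt0.
have /boolp.choice[N HN] : forall k, exists N, forall m n, (N <= m)%N -> (N <= n)%N ->
     (sqI (fun x => F m x - F n x)%R < ((8^-1) ^+ k)%:E)%E.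
  by move=> k; exact: cauchy.
pose M k := (\sum_(i < k.+1) N i)%N.
have NM k m : (k <= m)%N -> (N k <= M m)%N.
  move=> km; have km' : (k < m.+1)%N by [].
  by rewrite /M (bigD1 (Ordinal km'))//= leq_addr.
have [||g Lg Hg] := @L2_fast_limit (fun k => F (M k)).
- by move=> k; exact: LF.
- by move=> k m n km kn; apply/ltW/HN; exact: NM.
exists g => // d d0.
(* The two errors 8^(-k) enter with the factor 2 of the weighted triangle inequality. *)
have [k Hk] : exists k, 8 * (8^-1 : R) ^+ k < d.
  have := @cvg_expr R 8^-1; rewrite ger0_norm ?invr_ge0// invf_lt1// ltr1n => /(_ isT) h.
  have h2 : ((8^-1 : R) ^+ n @[n --> \oo] --> (0:R)) by [].
  have d80 : 0 < d / 8 by rewrite divr_gt0.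
  have [n _ /(_ n (leqnn n)) Hn] := cvgr_lt _ h2 _ d80.
  by exists n; move: Hn; rewrite ltr_pdivlMr// mulrC.
exists (M k) => n Mn.
have LB := L2B (LF (M k)) Lg; have LB2 := L2B (LF n) (LF (M k)).
have -> : (fun x => F n x - g x) = (fun x => (F n x - F (M k) x) + (F (M k) x - g x)).
  by apply/funext => x; ring.
have := sqID_le mu (L2_meas LB2) (L2_meas LB) (ltr01 : 0 < 1 :> R); move=> /le_lt_trans; apply.
have h1 : (sqI (fun x => F n x - F (M k) x)%R <= ((8^-1) ^+ k)%:E)%E.
  by apply/ltW/HN; [exact: leq_trans (NM _ _ (leqnn k)) Mn|exact: NM].
have h2 := Hg k.
move: h1 h2; rewrite (L2_fin LB) (L2_fin LB2) !lee_fin => h1 h2.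
by rewrite -!EFinM -EFinD lte_fin invr1; lra.
Qed.

Lemma L2_dominated (F : nat -> K -> R[i]) f G : L2 f -> L2 G ->
  (forall n, cmeasurable (F n)) -> (forall n x, normc (F n x) <= normc (G x)) ->
  (forall x, (fun n => normc (f x - F n x)) @ \oo --> (0 : R)) ->
  forall d : R, 0 < d -> exists n, nrm (fun x => f x - F n x) < d.
Proof.
move=> Lf LG mF FG cvg d d0.
have LF n : L2 (F n) by apply: (L2_le (mF n) LG).
have mB n : cmeasurable (fun x => f x - F n x) by apply: cmeasurableB => //; exact: L2_meas Lf.
pose h n (x : borel K) := (normc (f x - F n x) ^+ 2)%:E.
pose g (x : borel K) := (2 * normc (f x) ^+ 2 + 2 * normc (G x) ^+ 2)%:E.
have ig : mu.-integrable setT g.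
  have := integrableD measurableT (integrableZl measurableT 2 (L2_integrable Lf))
    (integrableZl measurableT 2 (L2_integrable LG)).
  by apply: eq_integrable => // x _; rewrite /g EFinD !EFinM.
have mh n : measurable_fun setT (h n).
  by apply/measurable_EFinP; exact: cmeasurable_normc2.
have hg n x : (`|h n x| <= g x)%E.
  rewrite /h /g gee0_abs ?lee_fin ?sqr_ge0//.
  apply: le_trans (normc_sqD _ _) _; rewrite normc_oppr lerD2l ler_pM2l//.
  by rewrite ler_pXn2r// nnegrE normc_ge0.
have hc x : h^~ x @ \oo --> (0 : \bar R)%E.
  apply: cvg_EFin; first exact: nearW.
  rewrite /h /= (_ : _ \o _ = (fun n => normc (f x - F n x) * normc (f x - F n x))).
    by rewrite -[X in _ --> X](mulr0 (0 : R)); apply: cvgM; exact: cvg.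
  by apply/funext => n /=; rewrite expr2.
have [||[_ _]] := dominated_convergence measurableT mh (measurable_cst (0 : \bar R)) _ ig _.
- by apply: aeW => x _; exact: hc.
- by apply: aeW => x n _; exact: hg.
rewrite integral0 => /(ecvg0P (fun n => sqI_ge0 mu _)) /(_ d d0) [N /(_ N (leqnn N)) H].
by exists N; rewrite -lte_fin -L2_fin//; exact: L2B.
Qed.

End HilbertSpace.

(** * Sums of complex numbers *)

Lemma Re_sum {R : realType} (I : Type) (s : seq I) (P : pred I) (F : I -> R[i]) :
  Re (\sum_(i <- s | P i) F i) = \sum_(i <- s | P i) Re (F i).
Proof. exact: (big_morph (fun z : R[i] => Re z) (@ReD R) erefl). Qed.

Lemma Im_sum {R : realType} (I : Type) (s : seq I) (P : pred I) (F : I -> R[i]) :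
  Im (\sum_(i <- s | P i) F i) = \sum_(i <- s | P i) Im (F i).
Proof. exact: (big_morph (fun z : R[i] => Im z) (@ImD R) erefl). Qed.

Lemma normc_sum {R : realType} (I : Type) (s : seq I) (P : pred I) (F : I -> R[i]) :
  normc (\sum_(i <- s | P i) F i) <= \sum_(i <- s | P i) normc (F i).
Proof.
elim/big_ind2: _ => [|x1 x2 y1 y2 h1 h2|//]; first by rewrite Normc.normc0.
by apply: le_trans (normcD _ _) _; exact: lerD.
Qed.

(** Cauchy-Schwarz against the indicator b, proved by Lagrange's identity. *)
Lemma normc_sum_sq {R : realType} (m : nat) (b : 'I_m -> bool) (z : 'I_m -> R[i]) :
  (forall s, ~~ b s -> z s = 0) ->
  normc (\sum_s z s) ^+ 2 <= (\sum_s (b s)%:R) * \sum_s normc (z s) ^+ 2.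
Proof.
move=> bz; pose y s := normc (z s).
have y0 s : 0 <= y s by exact: normc_ge0.
have by' s : (b s)%:R * y s = y s.
  by case: (boolP (b s)) => [_|/bz h]; rewrite ?mul1r// mul0r /y h Normc.normc0.
apply: (@le_trans _ _ ((\sum_s y s) ^+ 2)).
  by rewrite ler_pXn2r ?nnegrE ?normc_ge0 ?sumr_ge0//; exact: normc_sum.
have : 0 <= \sum_s \sum_t (b s)%:R * (b t)%:R * (y s - y t) ^+ 2.
  by apply: sumr_ge0 => s _; apply: sumr_ge0 => t _; rewrite mulr_ge0 ?sqr_ge0// mulr_ge0 ?ler0n.
have -> : \sum_s \sum_t (b s)%:R * (b t)%:R * (y s - y t) ^+ 2 =
  2 * ((\sum_s (b s)%:R) * (\sum_s y s ^+ 2)) - 2 * (\sum_s y s) ^+ 2.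
  pose B := \sum_t (b t)%:R : R; pose Y := \sum_t y t; pose Y2 := \sum_t y t ^+ 2.
  transitivity (\sum_s (y s ^+ 2 * B + (b s)%:R * Y2 - 2 * (y s * Y))).
    apply: eq_bigr => s _; rewrite /B /Y /Y2 !mulr_sumr -sumrN -!big_split /=.
    apply: eq_bigr => t _.
    have cases (w : 'I_m) : (b w)%:R = 1 :> R \/ y w = 0.
      by have := by' w; case: (b w); rewrite ?mul0r; [left|right].
    by case: (cases s) => ->; case: (cases t) => ->; ring.
  rewrite !big_split /= -!mulr_suml sumrN -mulr_sumr -mulr_suml -/B -/Y -/Y2; ring.
rewrite subr_ge0 ler_pM2l//.
Qed.

(** * Absolutely convergent series of functions *)

Section AbsoluteSeries.
Context {R : realType} {K : topologicalFieldType}.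
Variable P : nat -> K -> R[i].
Hypothesis mP : forall i, cmeasurable (P i).

Let a (x : borel K) : \bar R := (\sum_(0 <= i <oo) (normc (P i x))%:E)%E.

Let E : set (borel K) := [set x | (a x < +oo)%E].

Let mE : measurable E.
Proof.
have ma : measurable_fun setT a.
  apply: ge0_emeasurable_sum => // [k x _ _|k _]; first by rewrite lee_fin normc_ge0.
  by apply/measurable_EFinP; exact: cmeasurable_normc.
by have := emeasurable_fun_infty_o measurableT ma +oo%E; rewrite setTI.
Qed.

Let cvg_normc x : E x -> cvgn (series (fun i => normc (P i x))).
Proof.
move=> Ex; apply: nondecreasing_is_cvgn.
  by apply: nondecreasing_series => n _ _; exact: normc_ge0.
exists (fine (a x)) => _ [n _ <-].
rewrite -lee_fin fineK; last first.
  by rewrite ge0_fin_numE//; apply: nneseries_ge0 => i _ _; rewrite lee_fin normc_ge0.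
rewrite /series /= -sumEFin; apply: nneseries_lim_ge => i _ _.
by rewrite lee_fin normc_ge0.
Qed.

Let cvgRe x : E x -> cvgn (series (fun i => Re (P i x))).
Proof.
move=> Ex; apply: normed_cvg; apply: (series_le_cvg _ _ _ (cvg_normc Ex)) => n.
- exact: normr_ge0.
- exact: normc_ge0.
- exact: Re_le_normc.
Qed.

Let cvgIm x : E x -> cvgn (series (fun i => Im (P i x))).
Proof.
move=> Ex; apply: normed_cvg; apply: (series_le_cvg _ _ _ (cvg_normc Ex)) => n.
- exact: normr_ge0.
- exact: normc_ge0.
- exact: Im_le_normc.
Qed.

Let H n (x : K) : R[i] := cindic E x * \sum_(0 <= i < n) P i x.

Let HE n x : E x -> H n x = \sum_(0 <= i < n) P i x.
Proof. by move=> Ex; rewrite /H cindicE mem_set// mul1r. Qed.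

Let HNE n x : ~ E x -> H n x = 0.
Proof. by move=> Ex; rewrite /H cindicE memNset// mul0r. Qed.

Let mH n : cmeasurable (H n).
Proof. by apply: cmeasurableM; [exact: cmeasurable_indic|exact: cmeasurable_sum]. Qed.

Let cRe x : cvgn (fun n => Re (H n x)).
Proof.
have [Ex|NE] := pselect (E x); last first.
  rewrite (_ : (fun n => _) = (fun=> Re 0)); first exact: is_cvg_cst.
  by apply/funext => n; rewrite HNE.
rewrite (_ : (fun n => _) = series (fun i => Re (P i x))); first exact: cvgRe.
by apply/funext => n; rewrite (HE n Ex) Re_sum.
Qed.

Let cIm x : cvgn (fun n => Im (H n x)).
Proof.
have [Ex|NE] := pselect (E x); last first.
  rewrite (_ : (fun n => _) = (fun=> Im 0)); first exact: is_cvg_cst.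
  by apply/funext => n; rewrite HNE.
rewrite (_ : (fun n => _) = series (fun i => Im (P i x))); first exact: cvgIm.
by apply/funext => n; rewrite (HE n Ex) Im_sum.
Qed.

Let T (x : K) : R[i] := (limn (fun n => Re (H n x)) +i* limn (fun n => Im (H n x)))%C.

Let mT : cmeasurable T.
Proof.
split => /=.
  apply: (@measurable_fun_cvg _ (borel K) _ _ (fun n (x : borel K) => Re (H n x))).
    by move=> n; case: (mH n).
  by move=> x _; exact: cRe.
apply: (@measurable_fun_cvg _ (borel K) _ _ (fun n (x : borel K) => Im (H n x))).
  by move=> n; case: (mH n).
by move=> x _; exact: cIm.
Qed.

Let near_T x (e : R) : E x -> 0 < e ->
  \forall n \near \oo, normc (T x - \sum_(0 <= i < n) P i x) < e.
Proof.
move=> Ex e0; have e2 : 0 < e / 2 by rewrite divr_gt0.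
have h1 := @cRe x; have h2 := @cIm x.
move/cvgrPdist_lt : h1 => /(_ _ e2) h1; move/cvgrPdist_lt : h2 => /(_ _ e2) h2.
apply: filterS2 h1 h2 => n; rewrite HE// => h1 h2.
apply: le_lt_trans (normc_le_ReIm _) _; rewrite ReD ReN ImD ImN /T /=.
by rewrite (splitr e); exact: ltrD.
Qed.

(** T is the sum where the series of moduli converges, and 0 elsewhere. This makes T measurable,
and the tail bound holds everywhere since the tail is infinite at the remaining points. *)
Lemma absolute_series_limit : exists T : K -> R[i], [/\ cmeasurable T,
  forall x, (\sum_(0 <= i <oo) (normc (P i x))%:E < +oo)%E ->
    limn (series (fun i => P i x : R[i]^o)) = T x &
  forall m x, ((normc (T x - \sum_(0 <= i < m) P i x))%:E <=
    \sum_(m <= i <oo) (normc (P i x))%:E)%E].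
Proof.
exists T; split => // [x Ex|m x].
  apply/cvg_lim => //; apply/cvgrPdist_lt => -[e e'].
  rewrite ltcE /= => /andP[/eqP -> e0]; apply: filterS (near_T Ex e0) => n h.
  by rewrite /Num.norm /= ltcR.
have tail0 k : (0 <= \sum_(k <= i <oo) (normc (P i x))%:E)%E.
  by apply: nneseries_ge0 => i _ _; rewrite lee_fin normc_ge0.
have split := @nneseries_split R (fun i => (normc (P i x))%:E) 0 m.
have [Ex|NE] := pselect (E x); last first.
  have a_oo : a x = +oo%E by apply/eqP; rewrite -leye_eq leNgt; apply/negP.
  suff -> : (\sum_(m <= i <oo) (normc (P i x))%:E = +oo)%E by rewrite leey.
  move: a_oo; rewrite /a split; last by move=> k _; rewrite lee_fin normc_ge0.
  by rewrite add0n sumEFin; case: (\sum_(m <= i <oo) _)%E.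
have fin : (\sum_(m <= i <oo) (normc (P i x))%:E)%E \is a fin_num.
  rewrite ge0_fin_numE//; apply: le_lt_trans Ex; rewrite /a split; last by move=> k _; rewrite lee_fin normc_ge0.
  by rewrite add0n leeDr// sumEFin lee_fin sumr_ge0// => i _; exact: normc_ge0.
rewrite -(fineK fin) lee_fin; apply/ler_addgt0Pr => e e0.
have [N _ HN] := near_T Ex e0; pose n := (N + m)%N.
have {}HN : normc (T x - \sum_(0 <= i < n) P i x) < e by apply: HN => /=; exact: leq_addr.
have -> : T x - \sum_(0 <= i < m) P i x =
   (T x - \sum_(0 <= i < n) P i x) + \sum_(m <= i < n) P i x.
  by rewrite [\sum_(0 <= i < n) _](@big_cat_nat _ _ _ m) ?leq_addl//=; ring.
apply: le_trans (normcD _ _) _; rewrite addrC lerD ?(ltW HN)//.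
apply: le_trans (normc_sum _ _ _) _; rewrite -lee_fin fineK// -sumEFin.
by apply: nneseries_lim_ge => i _ _; rewrite lee_fin normc_ge0.
Qed.

End AbsoluteSeries.

Lemma expr_lt_small {R : realType} (v : R) : 0 <= v -> v < 1 -> forall e : R, 0 < e -> exists n, v ^+ n < e.
Proof.
move=> v0 v1 e e0; have := @cvg_expr R v; rewrite ger0_norm// => /(_ v1) h.
have h2 : (v ^+ n @[n --> \oo] --> (0:R)) by [].
by have [N _ /(_ N (leqnn N))] := cvgr_lt _ h2 _ e0; exists N.
Qed.

Lemma cvg_eventually_eq0 {R : realType} (f : nat -> R) (N : nat) :
  (forall n, (N <= n)%N -> f n = 0) -> f @ \oo --> (0 : R).
Proof.
by move=> H; apply: cvg_near_cst; exists N => // n /= Nn; rewrite H.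
Qed.

(** * The absolute value *)

Section LocalField.
Context {R : realType} {p : nat} {K : topologicalFieldType}.
Context {mu : {measure set (borel K) -> \bar R}} {abs : K -> R}.
Hypothesis K_local : local_field p K.
Hypothesis mu_haar : haar_measure mu.
Hypothesis absP : is_absolute_value mu abs.
Implicit Types (a x y z v w : K) (U C : set K).

Lemma open_measurable U : open U -> measurable (U : set (borel K)).
Proof. by move=> oU; apply: sub_sigma_algebra. Qed.

Lemma closed_measurable U : closed U -> measurable (U : set (borel K)).
Proof.
move=> /closed_openC oU; rewrite -(setCK U); apply: measurableC.
exact: open_measurable.
Qed.

Lemma punctured U : nbhs (0 : K) U -> exists2 x, U x & x != 0.
Proof. by case: K_local => _ K0 _ _; exact: nondiscrete_punctured. Qed.

Lemma char0 : p%:R = 0 :> K.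
Proof. by case: K_local => /pcharf0. Qed.

Lemma p_prime : prime p.
Proof. by case: K_local => /pcharf_prime. Qed.

(** Q consists of the x with x C contained in C, for a compact neighbourhood C of 0. *)
Lemma multiplier_set : exists Q : set K,
  [/\ compact Q, closed Q, nbhs 0 Q, Q 1 & forall x y, Q x -> Q y -> Q (x * y)].
Proof.
case: K_local => _ _ _ /(_ 0 I) /=.
rewrite withinET => -[C C0 [cC clC]].
exists [set x | forall y, C y -> C (x * y)].
have clQ : closed [set x | forall y, C y -> C (x * y)].
  rewrite (_ : mkset _ = \bigcap_(y in C) ( *%R y @^-1` C)).
    by apply: closed_bigI => y _; apply: closed_comp => // x _; exact: mull_continuous.
  apply/seteqP; split => x /= H y; first by move=> /H; rewrite /= mulrC.
  by move=> /H /=; rewrite mulrC.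
split => //.
- have [h Ch h0] := punctured C0.
  apply: (subclosed_compact clQ (compact_mull (a := h^-1) cC)).
  move=> x /= Ox; exists (h * x); last by rewrite mulKf.
  by rewrite mulrC; exact: Ox.
- have oC : open (interior C) by exact: open_interior.
  have H := near_mul_compact (a := 0) cC oC.
  have : \forall y \near (0 : K), forall x, C x -> interior C (y * x).
    by apply: H => x _; rewrite mul0r; exact: C0.
  by apply: filterS => y Hy x /Hy /interior_subset.
- by move=> y; rewrite mul1r.
- by move=> x y /= Ox Oy z /Oy /Ox; rewrite mulrA.
Qed.

Lemma nbhs0_mu_gt0 U : nbhs 0 U -> closed U -> (0 < mu U)%E.
Proof.
rewrite nbhsE => -[V [oV V0] VU] cU.
case: mu_haar => _ _ /(_ V oV) /(_ (ex_intro _ 0 V0)) muV.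
apply: lt_le_trans muV _; apply: le_measure; rewrite ?inE//.
  exact: open_measurable.
exact: closed_measurable.
Qed.

Lemma compact_mu_lty C : compact C -> (mu C < +oo)%E.
Proof. by case: mu_haar => _ + _; exact. Qed.

Lemma mu_mull a (E : set (borel K)) : a != 0 -> measurable E ->
  mu [set a * x | x in E] = ((abs a)%:E * mu E)%E.
Proof. by case: absP => _; exact. Qed.

Lemma abs0 : abs 0 = 0. Proof. by case: absP. Qed.

Lemma nbhs_mull a U : a != 0 -> nbhs 0 U -> nbhs 0 [set a * x | x in U].
Proof.
move=> a0; rewrite !nbhsE => -[V [oV V0] VU]; exists [set a * x | x in V].
  by split; [exact: open_mull|exists 0; rewrite ?mulr0].
by move=> _ [y Vy <-]; exists y => //; exact: VU.
Qed.

Lemma abs_gt0 a : a != 0 -> 0 < abs a.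
Proof.
move=> a0; have [Q [cQ clQ Q0 _ _]] := multiplier_set.
have := nbhs0_mu_gt0 (nbhs_mull a0 Q0) (closed_mull a0 clQ).
rewrite mu_mull//; last exact: closed_measurable.
have := nbhs0_mu_gt0 Q0 clQ; have := compact_mu_lty cQ.
have : (0 <= mu Q)%E by [].
case: (mu Q) => // r r0 _; rewrite -EFinM !lte_fin => r0'.
by rewrite pmulr_lgt0.
Qed.

Lemma abs_ge0 a : 0 <= abs a.
Proof. by have [->|/abs_gt0/ltW//] := eqVneq a 0; rewrite abs0. Qed.

Lemma abs_eq0 a : (abs a == 0) = (a == 0).
Proof.
by have [->|a0] := eqVneq a 0; rewrite ?abs0 ?eqxx// gt_eqF// abs_gt0.
Qed.

Lemma absM a b : abs (a * b) = abs a * abs b.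
Proof.
have [->|a0] := eqVneq a 0; first by rewrite !(mul0r,abs0).
have [->|b0] := eqVneq b 0; first by rewrite !(mulr0,abs0).
have [Q [cQ clQ Q0 _ _]] := multiplier_set.
have := nbhs0_mu_gt0 Q0 clQ; have := compact_mu_lty cQ.
have := @mu_mull (a * b) Q (mulf_neq0 a0 b0) (closed_measurable clQ).
rewrite (_ : image _ _ = [set a * x | x in [set b * x | x in Q]]); last first.
  apply/seteqP; split => [_ [x Qx <-]|_ [_ [x Qx <-] <-]].
    by exists (b * x); [exists x|rewrite mulrA].
  by exists x => //; rewrite mulrA.
rewrite mu_mull//; last by apply: closed_measurable; exact: closed_mull.
rewrite mu_mull//; last exact: closed_measurable.
have : (0 <= mu Q)%E by [].
case: (mu Q) => // r r0; rewrite -!EFinM => -[] + _; rewrite lte_fin => + r0'.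
by rewrite mulrA => /mulIf ->//; rewrite gt_eqF.
Qed.

Lemma abs1 : abs 1 = 1.
Proof.
have := absM 1 1; rewrite mulr1 => h.
have a0 : abs 1 != 0 by rewrite abs_eq0 oner_eq0.
by apply: (mulfI a0); rewrite -h mulr1.
Qed.

Lemma absX a n : abs (a ^+ n) = abs a ^+ n.
Proof. by elim: n => [|n IH]; rewrite ?expr0 ?abs1// !exprS absM IH. Qed.

Lemma absV a : abs a^-1 = (abs a)^-1.
Proof.
have [->|a0] := eqVneq a 0; first by rewrite invr0 abs0 invr0.
have a0' : abs a != 0 by rewrite abs_eq0.
by apply: (mulfI a0'); rewrite -absM !mulfV// abs1.
Qed.

(** Multiplication by x maps Q into itself, so it does not increase the measure of Q, which is
positive and finite. *)
Lemma abs_le1 (Q : set K) : compact Q -> closed Q -> nbhs 0 Q ->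
  (forall x y, Q x -> Q y -> Q (x * y)) -> forall x, Q x -> abs x <= 1.
Proof.
move=> cQ clQ Q0 QM x Ox; have [->|x0] := eqVneq x 0; first by rewrite abs0.
have := nbhs0_mu_gt0 Q0 clQ; have := compact_mu_lty cQ.
have : (mu [set (x * y)%R | y in Q] <= mu Q)%E.
  apply: le_measure; rewrite ?inE; [apply: closed_measurable; exact: closed_mull|exact: closed_measurable|].
  by move=> _ [y Oy <-]; exact: QM.
rewrite mu_mull//; last exact: closed_measurable.
have : (0 <= mu Q)%E by [].
case: (mu Q) => // r r0; rewrite -EFinM lee_fin => + _; rewrite lte_fin => + r0'.
by rewrite ger_pMl.
Qed.

(** For a fixed nonzero w close to 0, the products y w with y near x stay in a set on which the
absolute value is at most 1. *)
Lemma abs_locally_bounded x : exists b, \forall y \near x, abs y <= b.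
Proof.
have [Q [cQ clQ Q0 Q1 QM]] := multiplier_set.
have : nbhs (x * 0) Q by rewrite mulr0.
move=> /(@Defs.mul_continuous K (x, 0)) [[A B] /= [Ax B0] AB].
have [w Bw w0] := punctured B0.
exists (abs w)^-1; apply: filterS Ax => y Ay.
have := abs_le1 cQ clQ Q0 QM (AB (y, w) (conj Ay Bw)).
by rewrite absM -ler_pdivlMr ?abs_gt0// mul1r.
Qed.

Context {varpi : K}.
Hypothesis varpiP : prime_element abs varpi.
Context {q : nat}.
Hypothesis residueP : residue_field_card abs q.

Lemma abs_small (x : K) : abs x < 1 -> abs x <= abs varpi.
Proof. by case: varpiP => _; exact. Qed.

(** Otherwise the absolute value is trivial, and K coincides with its residue field, which is
finite. *)
Lemma varpi_neq0 : varpi != 0.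
Proof.
apply/eqP => v0; have abs_1 x : x != 0 -> abs x = 1.
  move=> x0; have H y : y != 0 -> 1 <= abs y.
    move=> y0; rewrite leNgt; apply/negP => /abs_small.
    by rewrite v0 abs0 leNgt abs_gt0.
  apply/eqP; rewrite eq_le H// andbT -[leRHS]invr1 -[leLHS]invrK lef_pV2 ?H// -?absV ?H ?invr_eq0//.
    by rewrite posrE abs_gt0 ?invr_eq0.
  by rewrite posrE.
have [F [r [_ [_ rD rM rs r0]]]] := residueP.
have intT x : integers abs x.
  by rewrite /integers /=; have [->|x0] := eqVneq x 0; rewrite ?abs0 ?ler01// abs_1.
have rN0 x : r x = 0 -> x = 0.
  move=> /(r0 _ (intT x)); rewrite /max_ideal /= => x1.
  by apply/eqP; apply/negP => /negP /abs_1 h; rewrite h ltxx in x1.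
have rinj : injective r.
  move=> x y rxy; apply/eqP; rewrite -subr_eq0; apply/eqP; apply: rN0.
  have h0 : r 0 = 0 by apply/(r0 _ (intT 0)); rewrite /max_ideal /= abs0.
  have ryN : r y + r (- y) = 0 by rewrite -rD ?inE ?subrr.
  by rewrite rD ?inE// rxy ryN.
have /boolp.choice[g gP] : forall z : F, exists x, r x = z.
  by move=> z; have [x _ <-] := rs z; exists x.
case: K_local => _ K0 td _.
have [x] := nondiscrete_infinite (map g (enum F)) K0 td.
apply/negP; rewrite negbK; apply/mapP; exists (r x); first by rewrite mem_enum.
by apply: rinj; rewrite gP.
Qed.

Lemma abs_varpi_gt0 : 0 < abs varpi. Proof. exact: abs_gt0 varpi_neq0. Qed.

Lemma abs_varpi_lt1 : abs varpi < 1. Proof. by case: varpiP. Qed.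

(** Choose v in Q with 0 < |v| < 1. Every x satisfies v^m x in Q for some m; at the least such
m, if positive, the point v^m x lies outside v Q. Now Q without the interior of v Q is
compact and does not contain 0, so the absolute value has a positive lower bound there. For
|x| <= 1 this bounds m. *)
Lemma integers_bounded : exists2 C, compact C & integers abs `<=` C.
Proof.
have [Q [cQ clQ Q0 Q1 QM]] := multiplier_set.
have leO := abs_le1 cQ clQ Q0 QM.
have [v [Ov v0 v1]] : exists v, [/\ Q v, v != 0 & abs v < 1].
  have [v [Ov v0 v1]] : exists v, [/\ Q v, v != 0 & abs v != 1].
    apply: contrapT => H.
    have H1 v : Q v -> v != 0 -> abs v = 1.
      by move=> Ov v0; apply/eqP; apply/negP => /negP vn; apply: H; exists v.
    have : nbhs (varpi * 0) Q by rewrite mulr0.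
    move=> /(mull_continuous (a := varpi)) /(filterI Q0) /punctured [z [Oz Ovz] z0].
    have := abs_varpi_lt1; suff -> : abs varpi = 1 by rewrite ltxx.
    by have := H1 _ Ovz (mulf_neq0 varpi_neq0 z0); rewrite absM (H1 z)// mulr1.
  by exists v; split => //; rewrite lt_neqAle v1 leO.
have vn0 n : v ^+ n != 0 by rewrite expf_neq0.
pose F n := [set v ^+ n * x | x in Q].
have clF n : closed (F n) by exact: closed_mull.
have dF n : F n.+1 `<=` F n.
  by move=> _ [x Ox <-]; exists (v * x); [exact: QM|rewrite exprSr mulrA].
have capF x : (forall n, F n x) -> x = 0.
  move=> Fx; apply/eqP; apply/negP => /negP x0.
  have Hn n : abs x <= abs v ^+ n.
    have [y Oy <-] := Fx n; rewrite absM absX.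
    by rewrite ger_pMr ?leO// exprn_gt0// abs_gt0.
  have [n] := expr_lt_small (abs_ge0 v) v1 (abs_gt0 x0).
  by rewrite ltNge Hn.
have toO x : exists n, Q (v ^+ n * x).
  have : nbhs (x * 0) Q by rewrite mulr0.
  move=> /(mull_continuous (a := x)); rewrite nbhsE /= => -[U [oU U0] UO].
  have [n Hn] := compact_nested cQ oU clF dF (fun x _ Fx => eq_rect_r U U0 (capF x Fx)).
  exists n; rewrite mulrC; apply: UO; apply: Hn.
    by elim: (n) => [|k IH]; rewrite ?expr0// exprS; exact: QM.
  by exists 1; rewrite ?mulr1.
pose E := Q `\` interior (F 1%N).
have cE : compact E.
  apply: (subclosed_compact _ cQ); last by move=> x [].
  by rewrite /E setDE; apply: closedI => //; apply: open_closedC; exact: open_interior.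
have E0 x : E x -> x != 0.
  move=> [_ nF]; apply/eqP => x0; apply: nF; rewrite x0 /interior.
  by apply: nbhs_mull.
have [b b0 Hb] : exists2 b, 0 < b & forall x, E x -> abs x^-1 <= b.
  apply: (compact_ubound (g := fun x => abs x^-1)) => // x Ex.
  have [b nb] := abs_locally_bounded x^-1; exists b.
  exact: (@Defs.inv_continuous K x (E0 _ Ex) _ nb).
have [N HN] : exists N, abs v ^+ N < b^-1.
  by apply: expr_lt_small; rewrite ?abs_ge0 ?invr_gt0.
exists [set v ^- N * x | x in Q]; first exact: compact_mull.
move=> x; rewrite /integers /= => x1.
have [->|x0] := eqVneq x 0.
  by exists 0; rewrite ?mulr0//; exact: nbhs_singleton.
have vNV y : v ^- N * (v ^+ N * y) = y by rewrite mulKf.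
suff : Q (v ^+ N * x) by exists (v ^+ N * x).
apply: contrapT => nO.
have [m mO] := toO x.
have Nm : (N <= m)%N.
  rewrite leqNgt; apply/negP => mN; apply: nO.
  rewrite -(subnK (ltnW mN)) exprD -mulrA; apply: (QM) => //.
  by elim: (N - m)%N => [|n IH]; rewrite ?expr0// exprS; apply: (QM).
have ex : exists n, `[< Q (v ^+ (N + n) * x) >].
  by exists (m - N)%N; apply/asboolP; rewrite subnKC.
case: (ex_minnP ex) => n /asboolP On nmin.
case: n On nmin => [|n] On nmin; first by rewrite addn0 in On.
have : E (v ^+ (N + n.+1) * x).
  split => // /interior_subset [y Oy]; rewrite expr1 addnS exprS -mulrA => /(mulfI v0) yE.
  have : `[< Q (v ^+ (N + n) * x) >] by apply/asboolP; rewrite -yE.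
  by move=> /nmin; rewrite ltnn.
move=> /Hb; rewrite absV absM absX; apply/negP; rewrite -ltNge.
rewrite -[ltLHS]invrK ltf_pV2 ?posrE ?invr_gt0 ?mulr_gt0 ?exprn_gt0 ?abs_gt0//.
apply: le_lt_trans HN.
rewrite exprD -mulrA ger_pMr ?exprn_gt0 ?abs_gt0//.
by rewrite mulr_ile1 ?abs_ge0 ?exprn_ge0 ?abs_ge0// exprn_ile1 ?abs_ge0// ltW.
Qed.

(** By the Frobenius identity (1 + x)^(p^n) = 1 + x^(p^n), the powers of |1 + x| are bounded,
because x^(p^n) is again an integer. *)
Lemma abs_add1 x : abs x <= 1 -> abs (1 + x) <= 1.
Proof.
move=> x1; have [C cC DC] := integers_bounded.
have [b b0 Hb] : exists2 b, 0 < b & forall y, C y -> abs (1 + y) <= b.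
  apply: (compact_ubound (g := fun y => abs (1 + y))) => // y _.
  have [b nb] := abs_locally_bounded (1 + y); exists b.
  exact: (addl_continuous nb).
have Hn n : abs (1 + x) ^+ (p ^ n) <= b.
  rewrite -absX (_ : _ ^+ _ = 1 + x ^+ (p ^ n)).
    by apply: Hb; apply: DC; rewrite /integers /= absX exprn_ile1// abs_ge0.
  have chp : p \in [pchar K] by case: K_local.
  elim: n => [|n IH]; first by rewrite expn0 !expr1.
  rewrite expnSr exprM IH -!(pFrobenius_autE chp) pFrobenius_autD_comm; last exact: mulrC.
  by rewrite !pFrobenius_autE expr1n exprM.
rewrite leNgt; apply/negP => gt1.
have v1 : (abs (1 + x))^-1 < 1 by rewrite invf_lt1// (lt_trans _ gt1).
have y0 : 0 < abs (1 + x) by rewrite (lt_trans _ gt1).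
have [||N] := expr_lt_small _ v1 (e := b^-1); rewrite ?invr_ge0 ?abs_ge0 ?invr_gt0//.
rewrite exprVn ltf_pV2 ?posrE ?exprn_gt0//; apply/negP; rewrite -leNgt.
apply: le_trans (Hn N); apply: ler_weXn2l; first exact: ltW.
by apply/ltnW/ltn_expl; exact: prime_gt1 p_prime.
Qed.

Lemma abs_ultra x y : abs (x + y) <= Num.max (abs x) (abs y).
Proof.
wlog xy : x y / abs x <= abs y => [H|].
  have [xy|/ltW xy] := leP (abs x) (abs y); first by have := H _ _ xy; rewrite max_r.
  by have := H _ _ xy; rewrite addrC max_r.
rewrite max_r//; have [y0|y0] := eqVneq y 0.
  by move: xy; rewrite y0 abs0 addr0.
have -> : x + y = y * (1 + x / y) by rewrite mulrDr mulr1 mulrCA mulfV// mulr1 addrC.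
by rewrite absM ger_pMr ?abs_gt0// abs_add1// absM absV ler_pdivrMr ?abs_gt0// mul1r.
Qed.

Lemma absN x : abs (- x) = abs x.
Proof.
have : abs (-1) ^+ 2 = 1 by rewrite -absX sqrrN expr1n abs1.
move/eqP; rewrite sqrp_eq1 ?abs_ge0// => /eqP h.
by rewrite -mulN1r absM h mul1r.
Qed.

Lemma abs_exprz x (n : int) : abs (x ^ n) = abs x ^ n.
Proof. by case: n => n; rewrite ?NegzE -?exprnN ?exprnP ?absV absX. Qed.

(** The fractional ideal varpi^M D. *)
Definition frac_ideal (M : int) : set K := [set x | abs x <= abs varpi ^ M].

Lemma frac_ideal0 M : frac_ideal M 0.
Proof. by rewrite /frac_ideal /= abs0 exprz_ge0// abs_ge0. Qed.

Lemma frac_idealD M x y : frac_ideal M x -> frac_ideal M y -> frac_ideal M (x + y).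
Proof. by move=> hx hy; apply: le_trans (abs_ultra _ _) _; rewrite ge_max hx hy. Qed.

Lemma frac_idealN M x : frac_ideal M x -> frac_ideal M (- x).
Proof. by rewrite /frac_ideal /= absN. Qed.

Lemma frac_idealM M N x y : frac_ideal M x -> frac_ideal N y -> frac_ideal (M + N) (x * y).
Proof.
rewrite /frac_ideal /= => hx hy.
by rewrite absM expfzDr ?gt_eqF ?abs_varpi_gt0// ler_pM ?abs_ge0.
Qed.

Lemma frac_ideal_scale M (j : int) x : frac_ideal (M + j) (varpi ^ j * x) <-> frac_ideal M x.
Proof.
rewrite /frac_ideal /= absM abs_exprz expfzDr ?gt_eqF ?abs_varpi_gt0// mulrC.
by rewrite ler_pM2r// exprz_gt0// abs_varpi_gt0.
Qed.

Lemma frac_ideal_sub M N : M <= N -> frac_ideal N `<=` frac_ideal M.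
Proof.
move=> MN x; rewrite /frac_ideal /= => /le_trans; apply.
rewrite -[abs varpi]invrK !(@exprz_inv _ (abs varpi)^-1) ler_weXz2l ?lerN2//.
by rewrite invf_ge1 ?abs_varpi_gt0// ltW// abs_varpi_lt1.
Qed.

Lemma integersE : integers abs = frac_ideal 0.
Proof. by rewrite /frac_ideal expr0z. Qed.

Lemma nbhs_integers : nbhs 0 (frac_ideal 0).
Proof.
have [Q [cQ clQ Q0 _ QM]] := multiplier_set.
by apply: (filterS _ Q0) => x /(abs_le1 cQ clQ Q0 QM); rewrite /frac_ideal /= expr0z.
Qed.

Lemma frac_ideal_image M : frac_ideal M = [set varpi ^ M * x | x in frac_ideal 0].
Proof.
apply/seteqP; split => [x Mx|_ [x Dx <-]].
  exists (varpi ^ (- M) * x); last by rewrite mulrA -expfzDr ?varpi_neq0// subrr mul1r.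
  by rewrite -(subrr M); apply/frac_ideal_scale.
by rewrite -[M in frac_ideal M]add0r; apply/frac_ideal_scale.
Qed.

Lemma nbhs_frac_ideal M : nbhs 0 (frac_ideal M).
Proof.
rewrite frac_ideal_image; apply: nbhs_mull nbhs_integers.
by rewrite expfz_neq0// varpi_neq0.
Qed.

Lemma invariant_open M U :
  (forall x z, U x -> frac_ideal M z -> U (x + z)) -> open U.
Proof.
move=> H; rewrite openE => x Ux; apply/nbhs_addl.
by apply: filterS (nbhs_frac_ideal M) => z; exact: H.
Qed.

Lemma frac_ideal_open M : open (frac_ideal M).
Proof. by apply: (@invariant_open M) => x z; exact: frac_idealD. Qed.

Lemma frac_ideal_closed M : closed (frac_ideal M).
Proof.
rewrite -(setCK (frac_ideal M)); apply: open_closedC; apply: (@invariant_open M).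
move=> x z /= Mx Mz Mxz; apply: Mx.
by rewrite -(addrK z x); apply: frac_idealD => //; exact: frac_idealN.
Qed.

Lemma frac_ideal_compact M : compact (frac_ideal M).
Proof.
rewrite frac_ideal_image; apply: compact_mull.
have [C cC DC] := integers_bounded.
by apply: (subclosed_compact (@frac_ideal_closed 0) cC) => x Dx; apply: DC; rewrite integersE.
Qed.

(** The ideals decrease to 0 inside the compact set D. *)
Lemma frac_ideal_base U : nbhs 0 U -> exists n : nat, frac_ideal n%:Z `<=` U.
Proof.
rewrite nbhsE => -[V [oV V0] VU].
have [||x _ H|n Hn] := compact_nested (@frac_ideal_compact 0) oV (F := fun n : nat => frac_ideal n%:Z).
- by move=> n; exact: frac_ideal_closed.
- by move=> n; apply: frac_ideal_sub; rewrite lez_nat.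
- suff -> : x = 0 by [].
  apply/eqP; apply/negP => /negP x0.
  have [n] := expr_lt_small (abs_ge0 varpi) abs_varpi_lt1 (abs_gt0 x0).
  by apply/negP; rewrite -leNgt; exact: H.
by exists n => x Mx; apply: VU; apply: Hn => //; apply: frac_ideal_sub Mx.
Qed.

Lemma frac_ideal_exhaust x : exists n : nat, frac_ideal (- n%:Z) x.
Proof.
have [|n] := expr_lt_small (abs_ge0 varpi) abs_varpi_lt1 (e := (1 + abs x)^-1).
  by rewrite invr_gt0 ltr_pwDl// ?abs_ge0.
move=> H; exists n.
rewrite /frac_ideal /= -exprnN.
have vn : 0 < abs varpi ^+ n by rewrite exprn_gt0// abs_varpi_gt0.
have [->|x0] := eqVneq x 0; first by rewrite abs0 invr_ge0 ltW.
rewrite -[leLHS]invrK lef_pV2 ?posrE ?invr_gt0 ?abs_gt0//.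
by apply/ltW/(lt_le_trans H); rewrite lef_pV2 ?posrE ?abs_gt0 ?ltr_pwDl ?abs_ge0// lerDr.
Qed.

Lemma expz_varpi_neq0 (j : int) : varpi ^ j != 0.
Proof. by rewrite expfz_neq0// varpi_neq0. Qed.

(** * Digits *)

Lemma p_gt0 : (0 < p)%N. Proof. exact: prime_gt0 p_prime. Qed.

Lemma modp_natr n : (n %% p)%:R = n%:R :> K.
Proof. by rewrite {2}(divn_eq n p) natrD natrM char0 mulr0 add0r. Qed.

Lemma base_expansion (a : nat -> nat) n : (forall i, (a i < p)%N) ->
  exists2 b, (b < p ^ n)%N & forall i, (i < n)%N -> ((b %/ p ^ i) %% p = a i)%N.
Proof.
move=> ap; elim: n a ap => [|n IH] a ap; first by exists 0%N; rewrite ?expn0.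
have [b bn Hb] := IH (fun i => a i.+1) (fun i => ap i.+1).
exists (a 0%N + p * b)%N.
  rewrite expnS; apply: (@leq_trans (p + p * b)); first by rewrite ltn_add2r.
  by rewrite -mulnS leq_mul2l bn orbT.
case=> [_|i]; first by rewrite expn0 divn1 addnC [(p * b)%N]mulnC modnMDl modn_small.
rewrite ltnS => /Hb <-; rewrite expnS divnMA.
by rewrite addnC [(p * b)%N]mulnC divnMDl ?p_gt0// (divn_small (ap 0%N)) addn0.
Qed.

Context {c : nat} {eps : 'I_c -> K}.
Hypothesis c_gt0 : (0 < c)%N.
Hypothesis qE : q = (p ^ c)%N.
Hypothesis epsP : residue_basis abs p eps.

(** For b < q these are the elements of the finite subfield spanned by eps. *)
Definition digit (b : nat) : K := \sum_(i < c) ((b %/ p ^ i) %% p)%:R * eps i.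

Lemma digits_field : exists (F : finFieldType) (f : {rmorphism F -> K}) (g : F -> 'I_q),
  bijective g /\ forall w : F, digit (g w) = f w.
Proof.
have [eps0 epsU [F [f [cardF rangef]]]] := epsP.
exists F, f.
have Hg (w : F) : exists b : 'I_q, digit b = f w.
  have : range f (f w) by exists w.
  rewrite rangef => -[a _ <-].
  have [|b bq Hb] := @base_expansion
     (fun i => if insub i is Some j then (a j %% p)%N else 0%N) c.
    by move=> i; case: insubP => *; rewrite ?ltn_mod p_gt0.
  have bq' : (b < q)%N by rewrite qE.
  exists (Ordinal bq'); apply: eq_bigr => i _ /=.
  by rewrite Hb// valK modp_natr.
have /boolp.choice[g gP] := Hg.
exists g; split => //; apply: inj_card_bij.
  by move=> w w' gw; apply: (fmorph_inj f); rewrite -!gP gw.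
by rewrite card_ord cardF qE.
Qed.

Lemma q_gt1 : (1 < q)%N.
Proof. by rewrite qE -(exp1n c) ltn_exp2r// prime_gt1// p_prime. Qed.

Lemma q_gt0 : (0 < q)%N. Proof. exact: ltnW q_gt1. Qed.

Lemma digit0 : digit 0 = 0.
Proof. by rewrite /digit big1// => i _; rewrite div0n mod0n mul0r. Qed.

Lemma digit_inj b b' : (b < q)%N -> (b' < q)%N -> digit b = digit b' -> b = b'.
Proof.
have [F [f [g [[h gh hg] gP]]]] := digits_field.
move=> bq bq'; rewrite -[b]/(val (Ordinal bq)) -[b']/(val (Ordinal bq')).
rewrite -(hg (Ordinal bq)) -(hg (Ordinal bq')) !gP => /(fmorph_inj f) e.
by rewrite e.
Qed.

Lemma digitD b b' : (b < q)%N -> (b' < q)%N ->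
  exists2 b'', (b'' < q)%N & digit b'' = digit b + digit b'.
Proof.
have [F [f [g [[h gh hg] gP]]]] := digits_field.
move=> bq bq'; exists (g (h (Ordinal bq) + h (Ordinal bq'))) => //.
by rewrite gP rmorphD -!gP !hg.
Qed.

Lemma digitN b : (b < q)%N -> exists2 b'', (b'' < q)%N & digit b'' = - digit b.
Proof.
have [F [f [g [[h gh hg] gP]]]] := digits_field.
move=> bq; exists (g (- h (Ordinal bq))) => //.
by rewrite gP rmorphN -!gP !hg.
Qed.

Lemma digitM b b' : (b < q)%N -> (b' < q)%N ->
  exists2 b'', (b'' < q)%N & digit b'' = digit b * digit b'.
Proof.
have [F [f [g [[h gh hg] gP]]]] := digits_field.
move=> bq bq'; exists (g (h (Ordinal bq) * h (Ordinal bq'))) => //.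
by rewrite gP rmorphM -!gP !hg.
Qed.

(** Nonzero elements of a finite field are roots of unity. *)
Lemma abs_digit b : (0 < b < q)%N -> abs (digit b) = 1.
Proof.
move=> /andP[b0 bq]; have [F [f [g [[h gh hg] gP]]]] := digits_field.
pose w := h (Ordinal bq).
have E : digit b = f w by rewrite -gP hg.
have fw0 : f w != 0.
  rewrite -E; apply/eqP; rewrite -digit0 => /(digit_inj bq q_gt0) b00.
  by rewrite b00 in b0.
have : abs (f w) ^+ #|F| = abs (f w) by rewrite -absX -rmorphXn/= expf_card.
rewrite -E in fw0 *; rewrite (cardD1 0) inE add1n exprS -[RHS]mulr1.
have a0 : abs (digit b) != 0 by rewrite abs_eq0.
move=> /(mulfI a0); rewrite (cardD1 1) !inE oner_neq0 add1n => /eqP.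
by rewrite pexpr_eq1 ?abs_ge0// => /eqP.
Qed.

Lemma digit_integer b : (b < q)%N -> frac_ideal 0 (digit b).
Proof.
case: b => [|b] bq; first by rewrite digit0; exact: frac_ideal0.
by rewrite /frac_ideal /= abs_digit// expr0z.
Qed.

Lemma abs_lt1E x : abs x < 1 <-> frac_ideal 1 x.
Proof.
rewrite /frac_ideal /= expr1z; split; first exact: abs_small.
by move=> /le_lt_trans; apply; exact: abs_varpi_lt1.
Qed.

Lemma digit_residue_inj b b' : (b < q)%N -> (b' < q)%N ->
  frac_ideal 1 (digit b - digit b') -> b = b'.
Proof.
move=> bq bq' /abs_lt1E h; have [b'' b''q E] := digitN bq'.
have [d dq E'] := digitD bq b''q.
move: h; rewrite -E -E'; case: d dq E' => [|d] dq E'; last by rewrite abs_digit// ltxx.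
move=> _; apply: digit_inj => //; apply/eqP; rewrite -subr_eq0 -E -E' digit0.
exact: eqxx.
Qed.

(** Distinct digits have distinct residues, and there are as many digits as residues. *)
Lemma digit_residue x : frac_ideal 0 x ->
  exists2 b, (b < q)%N & frac_ideal 1 (x - digit b).
Proof.
have [F [r [cardF [_ rD rM rs r0]]]] := residueP.
have r00 : r 0 = 0 by apply/r0; rewrite /integers /max_ideal /= abs0 ?ler01 ?ltr01.
have rN y : frac_ideal 0 y -> r (- y) = - r y.
  rewrite -integersE => Dy; have DyN : integers abs (- y) by rewrite /integers /= absN.
  by apply/eqP; rewrite -addr_eq0 -rD ?inE// addNr r00.
have rB y z : frac_ideal 0 y -> frac_ideal 0 z -> r y = r z -> frac_ideal 1 (y - z).
  move=> Dy Dz ryz; have DzN := frac_idealN Dz; have DB := frac_idealD Dy DzN.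
  rewrite -integersE in Dy DzN DB *; apply/abs_lt1E; apply/(r0 _ DB).
  by rewrite rD ?inE// rN// ryz subrr.
move=> Dx; have [h _ hK] : bijective (fun b : 'I_q => r (digit b)).
  apply: inj_card_bij; last by rewrite card_ord cardF.
  move=> b b' /rB H; apply/val_inj/(digit_residue_inj (ltn_ord b) (ltn_ord b')).
  by apply: H; exact: digit_integer.
exists (h (r x)) => //; apply: rB => //; first exact: digit_integer.
Qed.

(** * Coset representatives *)

Local Notation u := (coset_rep p varpi eps).

Lemma coset_rep_widen n N : (n <= N)%N ->
  u n = \sum_(k < N.+1) digit ((n %/ q ^ k) %% q) / varpi * varpi ^- k.
Proof.
move=> nN; rewrite /coset_rep -qE.
rewrite [RHS](bigID (fun k : 'I_N.+1 => (k < n.+1)%N)) /=.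
rewrite [X in _ + X]big1 ?addr0.
  by rewrite (big_ord_widen N.+1 (fun k => digit_rep p varpi eps ((n %/ q ^ k) %% q) * varpi ^- k)).
move=> k; rewrite -leqNgt => nk.
rewrite divn_small ?mod0n ?digit0 ?mul0r//.
exact: leq_trans nk (ltnW (ltn_expl _ q_gt1)).
Qed.

(** Splitting off the lowest digit; together with base_ind it gives induction on the base q
expansion. *)
Lemma coset_rep_rec b m : (b < q)%N ->
  u (b + q * m) = digit b / varpi + varpi^-1 * u m.
Proof.
move=> bq; have mN : (m <= b + q * m)%N.
  by apply: leq_trans (leq_addl _ _); rewrite leq_pmull// q_gt0.
rewrite (@coset_rep_widen _ (b + q * m).+1)// big_ord_recl expn0 divn1 expr0 invr1 mulr1.
rewrite mulnC addnC modnMDl modn_small//; congr (_ + _).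
rewrite (@coset_rep_widen m (m * q + b)); last by rewrite mulnC addnC.
rewrite mulr_sumr; apply: eq_bigr => k _ /=.
rewrite /bump /= add1n.
have -> : ((m * q + b) %/ q ^ k.+1 = m %/ q ^ k)%N.
  by rewrite expnS divnMA divnMDl ?q_gt0// (divn_small bq) addn0.
by rewrite exprS invfM !mulrA; congr (_ * _); rewrite mulrC mulrA.
Qed.

Lemma coset_rep0 : u 0 = 0.
Proof. by rewrite (@coset_rep_widen 0 0)// big1// => k _; rewrite div0n mod0n digit0 !mul0r. Qed.

Lemma base_split n : n = (n %% q + q * (n %/ q))%N.
Proof. by rewrite {1}(divn_eq n q) addnC mulnC. Qed.

Lemma base_ind (P : nat -> Prop) : P 0%N ->
  (forall b m, (b < q)%N -> P m -> P (b + q * m)%N) -> forall n, P n.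
Proof.
move=> P0 PS n; elim: n {-2}n (leqnn n) => [|N IH] n; first by rewrite leqn0 => /eqP ->.
case: n => [//|n] nN; rewrite (base_split n.+1).
apply: PS; first by rewrite ltn_mod q_gt0.
by apply: IH; rewrite -ltnS; apply: leq_trans nN; rewrite ltn_Pdiv// q_gt1.
Qed.

(** The digits form an additive group, so there are no carries. *)
Lemma coset_repD n n' : exists m, u m = u n + u n'.
Proof.
elim/base_ind: n n' => [|b m bq IH] n'; first by exists n'; rewrite coset_rep0 add0r.
rewrite (base_split n'); set b' := (n' %% q)%N; set m' := (n' %/ q)%N.
have b'q : (b' < q)%N by rewrite ltn_mod q_gt0.
have [d dq E] := digitD bq b'q; have [s Es] := IH m'.
exists (d + q * s)%N; rewrite !coset_rep_rec// E Es; ring.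
Qed.

Lemma coset_repN n : exists m, u m = - u n.
Proof.
elim/base_ind: n => [|b m bq [m' IH]]; first by exists 0%N; rewrite coset_rep0 oppr0.
have [d dq E] := digitN bq.
by exists (d + q * m')%N; rewrite !coset_rep_rec// E IH; ring.
Qed.

Lemma coset_rep_shift (j s v : nat) : (v < q ^ j)%N ->
  u (q ^ j * s + v) = varpi ^- j * u s + u v.
Proof.
elim: j v => [|j IH] v.
  by rewrite expn0 ltnS leqn0 => /eqP ->; rewrite mul1n addn0 expr0 invr1 mul1r coset_rep0 addr0.
move=> vq.
have bq : (v %% q < q)%N by rewrite ltn_mod q_gt0.
have vj : (v %/ q < q ^ j)%N by rewrite ltn_divLR ?q_gt0// -expnSr.
rewrite {2}(base_split v).
rewrite (_ : _ + v = v %% q + q * (q ^ j * s + v %/ q))%N; last first.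
  by rewrite {1}(base_split v) mulnDr mulnA -expnS addnCA.
rewrite !coset_rep_rec// IH// exprS invfM; ring.
Qed.

Lemma coset_rep_bound N n : (n < q ^ N)%N -> frac_ideal (- N%:Z) (u n).
Proof.
elim: N n => [|N IH] n.
  by rewrite expn0 ltnS leqn0 => /eqP ->; rewrite coset_rep0; exact: frac_ideal0.
rewrite (base_split n) => nN.
have bq : (n %% q < q)%N by rewrite ltn_mod q_gt0.
have mN : (n %/ q < q ^ N)%N.
  rewrite ltn_divLR ?q_gt0// -expnSr; apply: leq_ltn_trans nN.
  by rewrite {1}(divn_eq n q) addnC [(q * _)%N]mulnC.
rewrite coset_rep_rec// [digit _ / _]mulrC -mulrDr.
have -> : - N.+1%:Z = - N%:Z + -1 by lia.
apply/(@frac_ideal_scale _ (-1)); apply: frac_idealD; last exact: IH.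
by apply: frac_ideal_sub (digit_integer bq); rewrite oppr_le0.
Qed.

Lemma coset_rep_cover N x : frac_ideal (- N%:Z) x ->
  exists2 n, (n < q ^ N)%N & frac_ideal 0 (x - u n).
Proof.
elim: N x => [|N IH] x; first by rewrite oppr0; exists 0%N; rewrite ?coset_rep0 ?subr0.
have -> : - N.+1%:Z = - N%:Z + -1 by lia.
have E : x = varpi ^ (-1) * (varpi * x).
  by rewrite mulrA exprN1 mulVf ?mul1r// varpi_neq0.
rewrite E => /(@frac_ideal_scale _ (-1)) /IH [m mN] /digit_residue[b bq H].
exists (b + q * m)%N.
  apply: (@leq_trans (q + q * m)); first by rewrite ltn_add2r.
  by rewrite -mulnS expnS leq_mul2l mN orbT.
rewrite coset_rep_rec// [digit _ / _]mulrC -mulrDr.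
have -> : varpi ^ (-1) * (varpi * x) - varpi^-1 * (digit b + u m) = varpi ^ (-1) * (varpi * x - u m - digit b).
  by rewrite exprN1; ring.
by rewrite -(addrN 1); apply/(@frac_ideal_scale _ (-1)).
Qed.

Lemma coset_rep_uniq n n' : frac_ideal 0 (u n - u n') -> n = n'.
Proof.
elim/base_ind: n n' => [|b m bq IH] n'.
  rewrite coset_rep0 sub0r => /frac_idealN; rewrite opprK.
  elim/base_ind: n' => [//|b m bq IH].
  rewrite coset_rep_rec// [digit _ / _]mulrC -mulrDr -exprN1 -(addrN 1) => /(@frac_ideal_scale _ (-1)) H.
  have m0 : 0%N = m.
    apply: IH; rewrite -(addrK (digit b) (u m)) [u m + _]addrC.
    apply: frac_idealD; first exact: frac_ideal_sub H.
    by apply: frac_idealN; exact: digit_integer.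
  rewrite -m0 coset_rep0 addr0 in H.
  have -> : b = 0%N by apply: digit_residue_inj => //; rewrite ?q_gt0// digit0 subr0.
  by rewrite -m0 muln0.
rewrite (base_split n'); set b' := (n' %% q)%N; set m' := (n' %/ q)%N.
have b'q : (b' < q)%N by rewrite ltn_mod q_gt0.
rewrite !coset_rep_rec//.
have -> : digit b / varpi + varpi^-1 * u m - (digit b' / varpi + varpi^-1 * u m') =
  varpi ^ (-1) * ((u m - u m') + (digit b - digit b')) by rewrite exprN1; ring.
rewrite -(addrN 1) => /(@frac_ideal_scale _ (-1)) H.
have Db : frac_ideal 0 (digit b - digit b').
  by apply: frac_idealD; [|apply: frac_idealN]; exact: digit_integer.
have mm : m = m'.
  apply: IH; rewrite -(addrK (digit b - digit b') (u m - u m')).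
  by apply: frac_idealD; [exact: frac_ideal_sub H|exact: frac_idealN].
rewrite mm subrr add0r in H.
by rewrite mm (digit_residue_inj bq b'q H).
Qed.

Lemma modn_split b m d : (b < q)%N -> (0 < d)%N ->
  ((b + q * m) %% (q * d) = b + q * (m %% d))%N.
Proof.
move=> bq d0; rewrite {1}(divn_eq m d).
have -> : (b + q * (m %/ d * d + m %% d) = m %/ d * (q * d) + (b + q * (m %% d)))%N by ring.
rewrite modnMDl modn_small//.
apply: (@leq_trans (q + q * (m %% d))); first by rewrite ltn_add2r.
by rewrite -mulnS leq_mul2l ltn_mod d0 orbT.
Qed.

(** r is the number of lowest digits on which n and n' agree, and u s is the difference with
these digits shifted away. *)
Lemma coset_rep_pair n n' : n <> n' -> exists r s, [/\ ~~ (q %| s)%N,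
  u n' - u n = varpi ^- r * u s &
  forall j, (n %% q ^ j == n' %% q ^ j)%N = (j <= r)%N].
Proof.
elim: (n + n')%N {-2}n {-2}n' (leqnn (n + n')) => [|N IH] {}n {}n'.
  by rewrite leqn0 addn_eq0 => /andP[/eqP -> /eqP ->].
move=> nN; rewrite (base_split n) (base_split n').
set b := (n %% q)%N; set b' := (n' %% q)%N; set m := (n %/ q)%N; set m' := (n' %/ q)%N.
have bq : (b < q)%N by rewrite ltn_mod q_gt0.
have b'q : (b' < q)%N by rewrite ltn_mod q_gt0.
have qj j : (0 < q ^ j)%N by rewrite expn_gt0 q_gt0.
rewrite !coset_rep_rec//; have [<-|bb] := eqVneq b b' => neq.
  have mm : m <> m' by move=> e; apply: neq; rewrite e.
  have [|r [s [qs us H]]] := IH m m' _ mm.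
    rewrite -ltnS; apply: leq_trans nN.
    have [n0|n0] := posnP n.
      have [n'0|n'0] := posnP n'; first by move: mm; rewrite /m /m' n0 n'0.
      by rewrite /m n0 div0n !add0n ltn_Pdiv// q_gt1.
    by rewrite -addSn leq_add ?leq_div// ltn_Pdiv// q_gt1.
  exists r.+1, s; split=> //.
    by rewrite exprS invfM -mulrA -us; ring.
  case=> [|j]; first by rewrite expn0 !modn1 eqxx.
  by rewrite expnS !modn_split// eqn_add2l eqn_pmul2l ?q_gt0// H ltnS.
have [d dq E] := digitN bq; have [e eq E'] := digitD b'q dq.
have [m2 Em2] := coset_repN m; have [m3 Em3] := coset_repD m' m2.
exists 0%N, (e + q * m3)%N; split.
- rewrite /dvdn addnC mulnC modnMDl modn_small//; apply/negP => /eqP e0.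
  move: E'; rewrite e0 digit0 E => /esym/eqP; rewrite subr_eq0 => /eqP h.
  by move/negP: bb; apply; apply/eqP; apply: digit_inj.
- by rewrite expr0 invr1 mul1r coset_rep_rec// E' E Em3 Em2; ring.
- case=> [|j]; first by rewrite expn0 !modn1 eqxx.
  apply/negP => /eqP h; move/negP: bb; apply.
  have /(congr1 (modn^~ q)) := h; rewrite !modn_dvdm ?expnS ?dvdn_mulr//.
  by rewrite ![(_ + q * _)%N]addnC ![(q * _)%N]mulnC !modnMDl !modn_small// => ->.
Qed.

Lemma coset_rep_dvd s n : u n = u s -> n = s.
Proof. by move=> e; apply: coset_rep_uniq; rewrite e subrr; exact: frac_ideal0. Qed.

(** * The character *)

Context {chi : K -> R[i]}.
Hypothesis chiP : standard_character p varpi eps chi.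

Lemma chiD x y : chi (x + y) = chi x * chi y.
Proof. by case: chiP. Qed.

Lemma chi_neq0 x : chi x != 0.
Proof.
case: chiP => _ _ /(_ x) h _; apply/eqP => c0; move: h; rewrite c0.
by rewrite Normc.normc0 => /eqP; rewrite eq_sym oner_eq0.
Qed.

Lemma chi0 : chi 0 = 1.
Proof. by apply: (mulfI (chi_neq0 0)); rewrite -chiD addr0 mulr1. Qed.

Lemma chi_natr n x : chi (n%:R * x) = chi x ^+ n.
Proof.
elim: n => [|n IH]; first by rewrite mul0r expr0 chi0.
by rewrite -natr1 mulrDl mul1r chiD IH exprSr.
Qed.

Lemma chi_sum (I : finType) (F : I -> K) : chi (\sum_i F i) = \prod_i chi (F i).
Proof. exact: (big_morph chi chiD chi0). Qed.

Lemma chi_digit b (j : int) : j != 1 -> chi (digit b * varpi ^ (- j)) = 1.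
Proof.
move=> j1; rewrite /digit mulr_suml chi_sum big1// => i _.
rewrite -mulrA chi_natr; case: chiP => _ _ _ ->.
by rewrite (negbTE j1) andbF expr1n.
Qed.

Lemma chi_varpiV : chi varpi^-1 != 1.
Proof.
have [eps0 _ _] := epsP; case: chiP => _ _ _ /(_ (Ordinal c_gt0) 1).
rewrite eps0// mul1r exprN1 eqxx /= => ->; apply/eqP => -[cos1 sin0].
have p2 : (1 < p)%N := prime_gt1 p_prime.
have pR : 0 < p%:R :> R by rewrite ltr0n ltnW.
have [p_eq|p3] := eqVneq p 2%N.
  move: cos1; rewrite p_eq mulrC mulKf ?pnatr_eq0// cospi => /eqP.
  by rewrite -subr_eq0 -opprD oppr_eq0 -(natrD R 1 1) pnatr_eq0.
have : 0 < sin (2 * pi / p%:R : R).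
  apply: sin_gt0_pi; rewrite divr_gt0 ?mulr_gt0 ?pi_gt0//=.
  rewrite ltr_pdivrMr// mulrC ltr_pM2l ?pi_gt0// ltr_nat.
  by rewrite ltn_neqAle eq_sym p3.
by rewrite sin0 ltxx.
Qed.

(** Removing the digits of x one after the other moves x into varpi^n D without changing the
value of chi, and chi is continuous at 0. *)
Lemma chi_integers x : frac_ideal 0 x -> chi x = 1.
Proof.
move=> Dx; have H n : exists2 z, frac_ideal n%:Z z & chi x = chi z.
  elim: n => [|n [z nz ->]]; first by exists x.
  have : frac_ideal (0 + n%:Z) (varpi ^ n%:Z * (varpi ^ (- n%:Z) * z)).
    by rewrite add0r mulrA -expfzDr ?varpi_neq0// subrr mul1r.
  move=> /frac_ideal_scale /digit_residue[b bq Hb].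
  exists (varpi ^ n%:Z * (varpi ^ (- n%:Z) * z - digit b)).
    have -> : n.+1%:Z = 1 + n%:Z by lia.
    exact/frac_ideal_scale.
  have {1}-> : z = digit b * varpi ^ (- - n%:Z) + varpi ^ n%:Z * (varpi ^ (- n%:Z) * z - digit b).
    by rewrite opprK mulrBr mulrA -expfzDr ?varpi_neq0// subrr mul1r; ring.
  by rewrite chiD chi_digit ?mul1r//; lia.
have [cchi _ _ _] := chiP.
apply/eqP; rewrite -subr_eq0 -normr_eq0; apply/negP => /negP h.
have h0 : 0 < `|chi x - 1| by rewrite lt_neqAle eq_sym h normr_ge0.
have := cchi 0; rewrite /continuous_at chi0 => /cvgrPdist_lt /(_ _ h0).
move=> /frac_ideal_base[n Hn]; have [z nz E] := H n.
by have := Hn z nz; rewrite /= -E distrC ltxx.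
Qed.

Lemma chi_digit_coset_rep b i s : (b < q)%N ->
  chi (digit b * varpi ^- i.+1 * u s) = 1.
Proof.
move=> bq; elim/base_ind: s i => [|b' m b'q IH] i; first by rewrite coset_rep0 mulr0 chi0.
rewrite coset_rep_rec//; have [d dq E] := digitM bq b'q.
have -> : digit b * varpi ^- i.+1 * (digit b' / varpi + varpi^-1 * u m) =
  digit d * varpi ^ (- i.+2%:Z) + digit b * varpi ^- i.+2 * u m.
  by rewrite -exprnN [varpi ^+ i.+2]exprSr invfM E; ring.
by rewrite chiD IH chi_digit// mulr1.
Qed.

(** The product u k * u s is a sum of digits times varpi^(-j) with j >= 2, and chi is trivial on
such terms. *)
Lemma chi_coset_rep k s : chi (u k * u s) = 1.
Proof.
suff H i : chi (varpi ^- i * u k * u s) = 1.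
  by have := H 0%N; rewrite expr0 invr1 mul1r.
elim/base_ind: k i => [|b m bq IH] i; first by rewrite coset_rep0 mulr0 mul0r chi0.
rewrite coset_rep_rec//.
have -> : varpi ^- i * (digit b / varpi + varpi^-1 * u m) * u s =
  digit b * varpi ^- i.+1 * u s + varpi ^- i.+1 * u m * u s.
  by rewrite exprSr invfM; ring.
by rewrite chiD IH chi_digit_coset_rep// mulr1.
Qed.

(** * Borel sets *)

Definition balls : set (set K) :=
  [set B | B = set0 \/ exists a (n : nat), B = [set x | frac_ideal n%:Z (x - a)]].

Lemma ballsI : setI_closed balls.
Proof.
move=> A B [->|[a [n ->]]]; first by left; rewrite set0I.
case=> [->|[b [m ->]]]; first by left; rewrite setI0.
wlog nm : a b n m / (n <= m)%N => [H|].
  by have [/H//|/ltnW/H h] := leqP n m; rewrite setIC.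
have [[z [/= az bz]]|ab] := pselect (exists z, frac_ideal n%:Z (z - a) /\ frac_ideal m%:Z (z - b)).
  right; exists b, m; apply/seteqP; split => [x []//|x /= bx]; split => //.
  have -> : x - a = (x - b) - (z - b) + (z - a) by ring.
  apply: frac_idealD => //; apply: (@frac_ideal_sub _ m%:Z); first by rewrite lez_nat.
  by apply: frac_idealD => //; exact: frac_idealN.
left; apply/seteqP; split => // x [/= ax bx]; apply: ab; by exists x.
Qed.

(** An open set is the union of the balls it contains among those of radius |varpi|^n centred at
varpi^n u k, a countable family. *)
Lemma open_balls U : open U -> <<s balls >> U.
Proof.
move=> oU.
pose B (n k : nat) := [set x | frac_ideal n%:Z (x - varpi ^ n%:Z * u k)].
pose C n k := if `[< B n k `<=` U >] then B n k else set0.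
have -> : U = \bigcup_n \bigcup_k C n k.
  apply/seteqP; split => [x Ux|x [n _ [k _]]]; last first.
    by rewrite /C; case: asboolP => // BU /BU.
  have /nbhs_addl /frac_ideal_base [n Hn] : nbhs x U by exact: open_nbhs_nbhs.
  have [N] := frac_ideal_exhaust (varpi ^ (- n%:Z) * x).
  move=> /coset_rep_cover[k _ Hk]; exists n => //; exists k => //.
  have Bx : B n k x.
    rewrite /B /= -[n%:Z]add0r.
    have -> : x - varpi ^ n%:Z * u k = varpi ^ n%:Z * (varpi ^ (- n%:Z) * x - u k).
      by rewrite mulrBr mulrA -expfzDr ?varpi_neq0// subrr mul1r.
    exact/frac_ideal_scale.
  rewrite /C; case: asboolP => // BU; exfalso; apply: BU => y By.
  rewrite -(addrNK x y) addrC; apply: Hn.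
  have -> : y - x = (y - varpi ^ n%:Z * u k) - (x - varpi ^ n%:Z * u k) by ring.
  by apply: frac_idealD => //; exact: frac_idealN.
have sB : sigma_algebra setT <<s balls >> by exact: smallest_sigma_algebra.
have [s0 _ sU] := sB.
apply: (sU) => n; apply: (sU) => k; rewrite /C; case: asboolP => // _.
by apply: sub_sigma_algebra; right; exists (varpi ^ n%:Z * u k), n.
Qed.

(** The pi-lambda theorem: balls are stable under intersection and generate the Borel sets. *)
Lemma borel_ind (P : set (borel K) -> Prop) :
  P setT -> (forall B, balls B -> P B) ->
  (forall A, measurable A -> P A -> P (~` A)) ->
  (forall F : (set (borel K))^nat, (forall n, measurable (F n)) ->
    trivIset [set: nat] F -> (forall n, P (F n)) -> P (\bigcup_k F k)) ->
  forall A, measurable A -> P A.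
Proof.
move=> PT PB PC PU A mA.
have E : @measurable _ (borel K) = <<s balls >>.
  apply/seteqP; split.
    by apply: smallest_sub => [|U oU]; [exact: smallest_sigma_algebra|exact: open_balls].
  apply: smallest_sub; first exact: sigma_algebra_measurable.
  move=> B [->|[a [n ->]]]; first exact: measurable0.
  apply: open_measurable; apply: (@invariant_open n%:Z) => x z /= ax nz.
  by rewrite addrAC; exact: frac_idealD.
apply: (dynkin_induction E ballsI PT PB PC PU).
by rewrite -E.
Qed.

Lemma affine_measurable a b : measurable_fun setT (fun x : borel K => (a * x + b : borel K)).
Proof.
apply: (@measurability _ _ (borel K) (borel K) setT _ (@open K)) => //.
move=> _ [U oU <-]; rewrite setTI; apply: open_measurable.
rewrite (_ : _ @^-1` _ = *%R a @^-1` (+%R b @^-1` U)); last first.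
  by apply/seteqP; split => x /=; rewrite addrC.
apply: open_comp => [x _|]; first exact: mull_continuous.
by apply: open_comp => // x _; exact: addl_continuous.
Qed.

(** * Haar measure *)

Lemma mu_addl a (E : set (borel K)) : measurable E -> mu [set a + x | x in E] = mu E.
Proof. by case: mu_haar => + _ _; apply. Qed.

Hypothesis mu_integers : mu (integers abs) = 1%E.

(** The set varpi^(-1) D is the disjoint union of q translates of D. *)
Lemma abs_varpiE : abs varpi = q%:R^-1.
Proof.
have mD : measurable (frac_ideal 0 : set (borel K)).
  by apply: open_measurable; exact: frac_ideal_open.
pose B (b : nat) := [set digit b / varpi + x | x in frac_ideal 0].
have E : [set varpi^-1 * x | x in frac_ideal 0] = \big[setU/set0]_(b < q) B b.
  rewrite -bigcup_mkord; apply/seteqP; split => [_ [x Dx <-]|_ [b /= bq [x Dx <-]]].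
    have [b bq Hb] := digit_residue Dx; exists b => //.
    exists (varpi ^ (-1) * (x - digit b)); last by rewrite exprN1 /=; ring.
    by rewrite -(addrN 1); apply/(@frac_ideal_scale _ (-1)).
  exists (digit b + varpi * x); last first.
    by rewrite mulrDr mulKf ?varpi_neq0// mulrC.
  apply: frac_idealD; first exact: digit_integer.
  apply: (@frac_ideal_sub _ (0 + 1)) => //; rewrite -[varpi]expr1z.
  exact/frac_ideal_scale.
have vi0 : varpi^-1 != 0 by rewrite invr_eq0 varpi_neq0.
have muE := mu_mull vi0 mD.
have mu1 : mu (frac_ideal 0) = 1%E by rewrite -integersE.
rewrite E mu1 mule1 absV measure_bigsetU_ord in muE.
- have muB b : mu (B b) = 1%E by rewrite -mu1; exact: mu_addl.
  move: muE; rewrite (eq_bigr (fun=> 1%E)); last by move=> i _; exact: muB.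
  rewrite -(big_morph EFin (@EFinD R) erefl) => -[].
  by rewrite sumr_const card_ord => ->; rewrite invrK.
- by move=> b; apply: open_measurable; apply: open_addl; exact: frac_ideal_open.
- apply/trivIsetP => b b' _ _ bb; apply/seteqP; split => // x [[y Dy <-] [z Dz e]].
  move/negP: bb; apply; apply/eqP/val_inj; apply: (digit_residue_inj (ltn_ord b) (ltn_ord b')).
  have -> : digit b - digit b' = varpi ^ 1 * (z - y).
    apply: (mulfI vi0); rewrite expr1z mulKf ?varpi_neq0//.
    have -> : z = digit b / varpi + y - digit b' / varpi by rewrite -e; ring.
    by ring.
  have -> : (1 : int) = 0 + 1 by [].
  apply/frac_ideal_scale.
  by apply: frac_idealD => //; exact: frac_idealN.
Qed.

(** * Affine changes of variables *)

Lemma measurable_mull (a : K) (E : set (borel K)) : a != 0 -> measurable E ->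
  measurable ([set a * x | x in E] : set (borel K)).
Proof.
move=> a0 mE; rewrite image_mull//.
have := affine_measurable a^-1 0 measurableT mE; rewrite setTI.
by congr measurable; apply/seteqP; split => x /=; rewrite addr0.
Qed.

Lemma mu_affine (a b : K) (E : set (borel K)) : a != 0 -> measurable E ->
  mu ((fun x => a * x + b) @^-1` E) = ((abs a)^-1%:E * mu E)%E.
Proof.
move=> a0 mE; have ai0 : a^-1 != 0 by rewrite invr_eq0.
rewrite -absV -mu_mull// -(mu_addl (- (a^-1 * b)) (measurable_mull ai0 mE)).
congr (mu _); rewrite image_addl opprK image_mull// invrK.
by apply/seteqP; split => x /=; rewrite mulrDr mulVKf// addrC.
Qed.

Lemma ge0_integral_affine (a b : K) (f : borel K -> \bar R) : a != 0 ->
  measurable_fun setT f -> (forall x, (0 <= f x)%E) ->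
  (\int[mu]_x f (a * x + b)%R = (abs a)^-1%:E * \int[mu]_x f x)%E.
Proof.
move=> a0 mf f0.
have := ge0_integral_pushforward (affine_measurable a b) mu measurableT mf (fun x _ => f0 x).
rewrite preimage_setT => <-.
have ai0 : 0 <= (abs a)^-1 by rewrite invr_ge0 abs_ge0.
rewrite -(ge0_integral_mscale mu measurableT (NngNum ai0) mf (fun x _ => f0 x)).
apply: eq_measure_integral => [|mphi A mA _]; first exact: affine_measurable.
by rewrite /pushforward /= /mscale /= -(mu_affine b a0 mA).
Qed.

Lemma cmeasurable_affine (a b : K) (f : K -> R[i]) : cmeasurable f ->
  cmeasurable (fun x => f (a * x + b)).
Proof. exact: cmeasurable_comp (affine_measurable a b). Qed.

Lemma sqI_affine (a b : K) (f : K -> R[i]) : a != 0 -> cmeasurable f ->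
  sqI mu (fun x => f (a * x + b)) = ((abs a)^-1%:E * sqI mu f)%E.
Proof.
move=> a0 mf; rewrite /sqI -(@ge0_integral_affine a b)//.
- by apply/measurable_EFinP; exact: cmeasurable_normc2.
- by move=> x; rewrite lee_fin sqr_ge0.
Qed.

Lemma L2_affine (a b : K) (f : K -> R[i]) : a != 0 -> L2 mu f ->
  L2 mu (fun x => f (a * x + b)).
Proof.
move=> a0 Lf; split; first exact: cmeasurable_affine (L2_meas Lf).
by rewrite sqI_affine//; [rewrite (L2_fin Lf) -EFinM ltry|exact: L2_meas Lf].
Qed.

Lemma Rintegral_affine (a b : K) (f : borel K -> R) : a != 0 ->
  mu.-integrable setT (EFin \o f) ->
  Rintegral mu setT (fun x => f (a * x + b)) = (abs a)^-1 * Rintegral mu setT f.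
Proof.
move=> a0 iF; have /integrableP[mf _] := iF.
rewrite /Rintegral -[X in X * _]/(fine (abs a)^-1%:E) -fineM//; last exact: integrable_fin_num.
congr fine; rewrite [LHS]integralE [in RHS]integralE.
rewrite muleBr//; last first.
  by apply: fin_num_adde_defl; rewrite fin_numN; exact: (integrable_neg_fin_num measurableT iF).
rewrite -(ge0_integral_affine b a0 (measurable_funepos mf))// -(ge0_integral_affine b a0 (measurable_funeneg mf))//.
by congr (_ - _)%E; apply: eq_integral => x _; rewrite ?funeposE ?funenegE.
Qed.

Lemma cintegrable_affine (a b : K) (f : K -> R[i]) : a != 0 -> cintegrable mu f ->
  cintegrable mu (fun x => f (a * x + b)).
Proof.
move=> a0 cf; have mf := cintegrable_measurable cf.
apply: cintegrableP; first exact: cmeasurable_affine.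
rewrite (@ge0_integral_affine a b (fun x => (normc (f x))%:E))//.
- have /integrable_fin_num := cintegrable_normc cf.
  move=> /(_ measurableT)/fineK <-; rewrite -EFinM ltry//.
- by apply/measurable_EFinP; exact: cmeasurable_normc.
- by move=> x; rewrite lee_fin normc_ge0.
Qed.

Lemma cintegral_affine (a b : K) (f : K -> R[i]) : a != 0 -> cintegrable mu f ->
  cintegral mu (fun x => f (a * x + b)) = ((abs a)^-1)%:C%C * cintegral mu f.
Proof.
move=> a0 [f1 f2]; rewrite /cintegral; apply: complex_ext; rewrite /= ?mul0r ?subr0 ?addr0.
  by rewrite -(@Rintegral_affine a b (fun x => Re (f x)) a0 f1).
by rewrite -(@Rintegral_affine a b (fun x => Im (f x)) a0 f2).
Qed.

(** * Integrals over balls *)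

Definition cball (a : K) (M : int) : set K := [set x | frac_ideal M (x - a)].

Lemma cballE a M x : (x \in cball a M) = `[< frac_ideal M (x - a) >].
Proof. by apply/idP/asboolP; rewrite inE. Qed.

(** Every preimage is open, being a union of cosets of an open subgroup. *)
Lemma invariant_measurable {d} {T : measurableType d} (M : int) (f : K -> T) :
  (forall x z, frac_ideal M z -> f (x + z) = f x) ->
  measurable_fun [set: borel K] (f : borel K -> T).
Proof.
move=> H _ Y mY; rewrite setTI; apply: open_measurable.
by apply: (@invariant_open M) => x z /= Yx Mz; rewrite H.
Qed.

Lemma invariant_cmeasurable (M : int) (f : K -> R[i]) :
  (forall x z, frac_ideal M z -> f (x + z) = f x) -> cmeasurable f.
Proof. by move=> H; split; apply: (@invariant_measurable _ _ M) => x z Mz; rewrite H. Qed.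

Lemma cball_invariant a M x z : frac_ideal M z -> cball a M (x + z) <-> cball a M x.
Proof.
move=> Mz; rewrite /cball /= addrAC; split => h; last exact: frac_idealD.
by rewrite -(addrK z (x - a)); apply: frac_idealD => //; exact: frac_idealN.
Qed.

Lemma measurable_cball a M : measurable (cball a M : set (borel K)).
Proof.
by apply: open_measurable; apply: (@invariant_open M) => x z ax Mz; apply/cball_invariant.
Qed.

Lemma mu_cball a M : mu (cball a M) = (abs varpi ^ M)%:E.
Proof.
have E : cball a M = (fun x => varpi ^ (- M) * x + - (varpi ^ (- M) * a)) @^-1` frac_ideal 0.
  apply/seteqP; split => x; rewrite /cball /= -mulrBr -[in frac_ideal 0](subrr M);
    by move=> /(@frac_ideal_scale _ (- M)).
have mD : measurable (frac_ideal 0 : set (borel K)).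
  by have := measurable_cball 0 0; congr measurable; apply/seteqP; split => x; rewrite /cball /= subr0.
rewrite E mu_affine ?expz_varpi_neq0//.
by rewrite -integersE mu_integers mule1 abs_exprz invr_expz opprK.
Qed.

Lemma abs_varpi_exprz M : abs varpi ^ M = (q%:R : R) ^ (- M).
Proof. by rewrite abs_varpiE exprz_inv. Qed.

Lemma cball_cintegrable a M : cintegrable mu (cindic (R:=R) (cball a M)).
Proof.
apply: cintegrableP; first exact: cmeasurable_indic (measurable_cball a M).
under eq_integral => x _ do rewrite /cindic normc_real ger0_norm ?ler0n//.
by rewrite integral_indic ?setIT ?mu_cball ?ltry//; exact: measurable_cball.
Qed.

Lemma cintegral_cball a M : cintegral mu (cindic (R:=R) (cball a M)) = (abs varpi ^ M)%:C%C.
Proof.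
rewrite cintegral_real; congr (_%:C%C); rewrite /Rintegral integral_indic ?setIT ?mu_cball//.
exact: measurable_cball.
Qed.

Lemma chi_normc x : normc (chi x) = 1. Proof. by case: chiP. Qed.

Lemma chi_invariant y (n : nat) x z : frac_ideal (- n%:Z) y -> frac_ideal n%:Z z ->
  chi (y * (x + z)) = chi (y * x).
Proof.
move=> yn zn; rewrite mulrDr chiD [X in _ * X]chi_integers ?mulr1//.
by rewrite -(addNr n%:Z); exact: frac_idealM.
Qed.

Lemma cmeasurable_chi y : cmeasurable (fun x => chi (y * x)).
Proof.
have [n yn] := frac_ideal_exhaust y.
by apply: (@invariant_cmeasurable n%:Z) => x z; exact: chi_invariant.
Qed.

Lemma conj_chi x : conjc (chi x) = chi (- x).
Proof.
apply: (mulfI (chi_neq0 x)); rewrite -chiD subrr chi0 mulcJ chi_normc expr1n.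
by [].
Qed.

Lemma cintegrable_chi_ball a M y : cintegrable mu (fun x => cindic (cball a M) x * chi (y * x)).
Proof.
apply: (cintegrable_dom (g := \1_(cball a M))).
- apply: cmeasurableM; last exact: cmeasurable_chi.
  exact: cmeasurable_indic (measurable_cball a M).
- by move=> x; rewrite Normc.normcM chi_normc mulr1 /cindic normc_real ger0_norm// ler0n.
- apply: integrable_ge0; first exact: measurable_indic (measurable_cball a M).
    by move=> x; rewrite ler0n.
  by rewrite integral_indic ?setIT ?mu_cball ?ltry//; exact: measurable_cball.
Qed.

Lemma chi_nontrivial y M : ~ frac_ideal (- M) y ->
  exists2 x, frac_ideal M x & chi (y * x) != 1.
Proof.
move=> My; have y0 : y != 0 by apply/eqP => y0; apply: My; rewrite y0; exact: frac_ideal0.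
exists (y^-1 * varpi^-1); last by rewrite mulVKf// chi_varpiV.
have : abs (varpi ^ M * y)^-1 < 1.
  rewrite absV invf_lt1; last by rewrite abs_gt0 ?mulf_neq0 ?expz_varpi_neq0.
  move/negP: My; rewrite /frac_ideal /= -ltNge absM abs_exprz.
  by rewrite -invr_expz -[X in X < _]mulr1 ltr_pdivrMl ?exprz_gt0 ?abs_varpi_gt0.
move=> /abs_lt1E h.
have -> : y^-1 * varpi^-1 = varpi ^ (M - 1) * (varpi ^ M * y)^-1.
  rewrite invfM expfzDr ?varpi_neq0// exprN1.
  have := expz_varpi_neq0 M; set w := varpi ^ M => w0; field.
  by rewrite w0 y0 varpi_neq0.
suff : frac_ideal (1 + (M - 1)) (varpi ^ (M - 1) * (varpi ^ M * y)^-1) by rewrite addrC subrK.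
exact/frac_ideal_scale.
Qed.

(** If chi (y .) is nontrivial on the ball, a translation by some x multiplies the integral by
chi (y x) <> 1 without changing it. *)
Lemma cintegral_chi_ball0 M y :
  cintegral mu (fun x => cindic (cball 0 M) x * chi (y * x)) =
  if `[< frac_ideal (- M) y >] then (abs varpi ^ M)%:C%C else 0.
Proof.
case: asboolP => [My|/chi_nontrivial[x Mx chix]].
  rewrite -(cintegral_cball 0); apply: eq_cintegral => x.
  rewrite cindicE cballE subr0; case: asboolP => [Mx|]; last by rewrite mul0r.
  rewrite chi_integers ?mulr1// -(addNr M); exact: frac_idealM.
have := @cintegral_affine 1 x _ (oner_neq0 _) (cintegrable_chi_ball 0 M y).
rewrite abs1 invr1 mul1r => h.
have : cintegral mu (fun z => cindic (cball 0 M) z * chi (y * z)) * chi (y * x) =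
       cintegral mu (fun z => cindic (cball 0 M) z * chi (y * z)).
  rewrite -[RHS]h mulrC -cintegralZ; last exact: cintegrable_chi_ball.
  apply: eq_cintegral => z; rewrite mul1r mulrDr chiD.
  have -> : cindic (cball 0 M) (z + x) = cindic (cball 0 M) z :> R[i].
    by rewrite !cindicE; congr (if _ then _ else _); apply/idP/idP; rewrite !inE => /cball_invariant; exact.
  ring.
move/eqP; rewrite -subr_eq0 -[X in _ - X]mulr1 -mulrBr mulf_eq0 subr_eq0 (negbTE chix) orbF.
by move/eqP.
Qed.

(** * Locally constant functions with compact support *)

Definition level (n N : nat) (f : K -> R[i]) :=
  (forall x z, frac_ideal n%:Z z -> f (x + z) = f x) /\
  (forall x, ~ frac_ideal (- N%:Z) x -> f x = 0).

Definition locally_constant (f : K -> R[i]) := exists n N : nat, level n N f.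

Lemma expansion_scale (n : nat) x : x = varpi ^+ n * (varpi ^ (- n%:Z) * x).
Proof. by rewrite -exprnN mulVKf// expf_neq0// varpi_neq0. Qed.

Lemma frac_ideal_shift (n : nat) M x : frac_ideal (M + n%:Z) (varpi ^+ n * x) <-> frac_ideal M x.
Proof. exact: (@frac_ideal_scale M n%:Z). Qed.

Lemma ball_cover (n N : nat) x : frac_ideal (- N%:Z) x ->
  exists2 k, (k < q ^ (n + N))%N & frac_ideal n%:Z (x - varpi ^+ n * u k).
Proof.
rewrite (expansion_scale n x) => Hx.
have : frac_ideal (- (n + N)%:Z) (varpi ^ (- n%:Z) * x).
  by apply/(@frac_ideal_shift n); move: Hx; congr frac_ideal; lia.
move=> /coset_rep_cover[k kN Hk]; exists k => //.
by rewrite -mulrBr -[n%:Z]add0r; apply/frac_ideal_shift.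
Qed.

Lemma ball_unique (n : nat) x k k' : frac_ideal n%:Z (x - varpi ^+ n * u k) ->
  frac_ideal n%:Z (x - varpi ^+ n * u k') -> k = k'.
Proof.
move=> h h'; apply: coset_rep_uniq; apply/(@frac_ideal_shift n); rewrite add0r.
have -> : varpi ^+ n * (u k - u k') = (x - varpi ^+ n * u k') - (x - varpi ^+ n * u k) by ring.
by apply: frac_idealD => //; exact: frac_idealN.
Qed.

Lemma locally_constant_expand (n N : nat) (f : K -> R[i]) :
  (forall x z, frac_ideal n%:Z z -> f (x + z) = f x) ->
  (forall x, ~ frac_ideal (- N%:Z) x -> f x = 0) ->
  forall x, f x = \sum_(k < q ^ (n + N)) f (varpi ^+ n * u k) * cindic (cball (varpi ^+ n * u k) n%:Z) x.
Proof.
move=> finv fsupp x; have [Nx|Nx] := pselect (frac_ideal (- N%:Z) x); last first.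
  rewrite fsupp// big1// => k _; rewrite cindicE cballE.
  case: asboolP => [h|_]; last by rewrite mulr0.
  by rewrite -(finv _ _ h) addrC subrK fsupp// mul0r.
have [k kN Hk] := ball_cover n Nx.
rewrite (bigD1 (Ordinal kN))//= big1 ?addr0; last first.
  move=> k' kk'; rewrite cindicE cballE; case: asboolP => [h|_]; last by rewrite mulr0.
  by move/eqP: kk'; case; apply/val_inj; exact: ball_unique h Hk.
rewrite cindicE cballE; case: asboolP => // _; rewrite mulr1 -(finv (varpi ^+ n * u k) _ Hk).
by rewrite addrC subrK.
Qed.

Lemma cball_L2 a M : L2 mu (cindic (R:=R) (cball a M)).
Proof.
split; first exact: cmeasurable_indic (measurable_cball a M).
rewrite /sqI (eq_integral (fun x : borel K => (\1_(cball a M) x)%:E)); last first.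
  move=> x _; rewrite /cindic normc_real ger0_norm ?ler0n// indicE.
  by case: (_ \in _); rewrite ?expr1n ?expr0n.
by rewrite integral_indic ?setIT ?mu_cball ?ltry//; exact: measurable_cball.
Qed.

Lemma locally_constant_cball a M : locally_constant (cindic (cball a M)).
Proof.
have [N1 HN1] := frac_ideal_exhaust a.
exists `|M|%N, (N1 + `|M|)%N; split => x.
  move=> z Mz; have Mz' : frac_ideal M z by apply: frac_ideal_sub Mz; lia.
  by rewrite !cindicE; congr (if _ then _ else _); apply/idP/idP; rewrite !inE => /(cball_invariant _ _ Mz').
move=> Nx; rewrite cindicE cballE; case: asboolP => // h; exfalso; apply: Nx.
rewrite -(subrK a x); apply: frac_idealD.
  by apply: frac_ideal_sub h; lia.
by apply: frac_ideal_sub HN1; lia.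
Qed.

Lemma locally_constant_zero : locally_constant (fun=> 0).
Proof. by exists 0%N, 0%N. Qed.

Lemma locally_constantD f g : locally_constant f -> locally_constant g ->
  locally_constant (fun x => f x + g x).
Proof.
move=> [n [N [fi fs]]] [m [M [gi gs]]]; exists (n + m)%N, (N + M)%N; split => x.
  move=> z nz; rewrite fi ?gi//; by apply: frac_ideal_sub nz; lia.
move=> Nx; rewrite fs ?gs ?addr0// => h; apply: Nx; apply: frac_ideal_sub h; lia.
Qed.

Lemma locally_constantZ (a : R[i]) f : locally_constant f -> locally_constant (fun x => a * f x).
Proof.
by move=> [n [N [fi fs]]]; exists n, N; split => x; [move=> z /fi ->|move=> /fs ->; rewrite mulr0].
Qed.

Lemma locally_constantB f g : locally_constant f -> locally_constant g ->
  locally_constant (fun x => f x - g x).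
Proof.
move=> lf lg; have := locally_constantD lf (locally_constantZ (-1) lg).
by congr locally_constant; apply/funext => x; rewrite mulN1r.
Qed.

Lemma locally_constant_mul_cball f a M : locally_constant f ->
  locally_constant (fun x => cindic (cball a M) x * f x).
Proof.
move=> [n [N [fi fs]]]; exists (n + `|M|)%N, N; split => x; last by move=> /fs ->; rewrite mulr0.
move=> z nz; rewrite fi; last by apply: frac_ideal_sub nz; lia.
congr (_ * _); have Mz : frac_ideal M z by apply: frac_ideal_sub nz; lia.
by rewrite !cindicE; congr (if _ then _ else _); apply/idP/idP; rewrite !inE => /(cball_invariant _ _ Mz).
Qed.

Lemma locally_constant_L2 f : locally_constant f -> L2 mu f.
Proof.
move=> [n [N [fi fs]]]; rewrite (funext (locally_constant_expand fi fs)).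
by apply: L2_sum => k; apply: L2Z; exact: cball_L2.
Qed.

Lemma locally_constant_cintegrable f : locally_constant f -> cintegrable mu f.
Proof.
move=> [n [N [fi fs]]]; rewrite (funext (locally_constant_expand fi fs)).
by apply: cintegrable_sum => k; apply: cintegrableZ; exact: cball_cintegrable.
Qed.

Definition approximable (f : K -> R[i]) := L2 mu f /\
  forall d : R, 0 < d -> exists2 g, locally_constant g & nrm mu (fun x => f x - g x) < d.

Lemma approximable_locally_constant f : locally_constant f -> approximable f.
Proof.
move=> lf; have Lf := locally_constant_L2 lf; split => // d d0; exists f => //.
by rewrite nrmB// inner_nrm//= mulr2n mulrDl !mul1r opprD addrA subrr sub0r addNr.
Qed.

Lemma approximable_limit f : L2 mu f ->
  (forall d : R, 0 < d -> exists2 h, approximable h & nrm mu (fun x => f x - h x) < d) ->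
  approximable f.
Proof.
move=> Lf H; split => // d d0; have d4 : 0 < d / 4 by rewrite divr_gt0.
have [h [Lh hW] fh] := H _ d4; have [g lg hg] := hW _ d4; exists g => //.
have Lg := locally_constant_L2 lg.
have -> : (fun x => f x - g x) = (fun x => (f x - h x) + (h x - g x)) by apply/funext => x; ring.
apply: le_lt_trans (nrmD_le (L2B Lf Lh) (L2B Lh Lg) ltr01) _; rewrite invr1; lra.
Qed.

Lemma approximableD f g : approximable f -> approximable g ->
  approximable (fun x => f x + g x).
Proof.
move=> [Lf fW] [Lg gW]; split; first exact: L2D.
move=> d d0; have d4 : 0 < d / 4 by rewrite divr_gt0.
have [f1 lf1 ff] := fW _ d4; have [g1 lg1 gg] := gW _ d4.
exists (fun x => f1 x + g1 x); first exact: locally_constantD.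
have -> : (fun x => f x + g x - (f1 x + g1 x)) = (fun x => (f x - f1 x) + (g x - g1 x)).
  by apply/funext => x; ring.
have Lf1 := locally_constant_L2 lf1; have Lg1 := locally_constant_L2 lg1.
apply: le_lt_trans (nrmD_le (L2B Lf Lf1) (L2B Lg Lg1) ltr01) _; rewrite invr1; lra.
Qed.

Lemma approximableZ (a : R[i]) f : approximable f -> approximable (fun x => a * f x).
Proof.
move=> [Lf fW]; split; first exact: L2Z.
move=> d d0; have a0 : 0 < normc a ^+ 2 + 1 by rewrite ltr_wpDl// sqr_ge0.
have [g lg fg] := fW _ (divr_gt0 d0 a0).
exists (fun x => a * g x); first exact: locally_constantZ.
rewrite (_ : (fun x => _) = (fun x => a * (f x - g x))); last by apply/funext => x; ring.
have LB := L2B Lf (locally_constant_L2 lg).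
rewrite nrmZ//; move: fg; rewrite ltr_pdivlMr// => fg; apply: le_lt_trans fg.
by rewrite mulrDr mulr1 mulrC lerDl nrm_ge0.
Qed.

Lemma approximable_zero : approximable (fun=> 0).
Proof. exact: approximable_locally_constant locally_constant_zero. Qed.

Lemma approximable_sum (I : Type) (s : seq I) (F : I -> K -> R[i]) :
  (forall i, approximable (F i)) -> approximable (fun x => \sum_(i <- s) F i x).
Proof.
move=> mF; elim: s => [|i s IH].
  by under eq_fun do rewrite big_nil; exact: approximable_zero.
by under eq_fun do rewrite big_cons; exact: approximableD.
Qed.

Lemma cindicI A B x : cindic (A `&` B) x = cindic A x * cindic B x :> R[i].
Proof.
rewrite !cindicE in_setI; case: (x \in A); case: (x \in B); by rewrite /= ?mul1r ?mul0r.
Qed.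

Lemma cindic_normc_le1 (A : set K) x : normc (cindic A x : R[i]) <= 1.
Proof. by rewrite cindicE; case: ifP; rewrite ?Normc.normc1 ?Normc.normc0. Qed.

(** The sets A with this property form a lambda-system containing the balls. Intersecting with a
fixed ball keeps all indicators square integrable. *)
Lemma approximable_indic (N : nat) (A : set (borel K)) : measurable A ->
  approximable (cindic (A `&` cball 0 (- N%:Z))).
Proof.
set B := cball 0 _.
have aB : approximable (cindic B) by exact: approximable_locally_constant (locally_constant_cball _ _).
have mB : measurable (B : set (borel K)) by exact: measurable_cball.
have LI (A' : set (borel K)) : measurable A' -> L2 mu (cindic (A' `&` B)).
  move=> mA; apply: (L2_le _ (cball_L2 0 (- N%:Z))).
    by apply: cmeasurable_indic; exact: measurableI.
  move=> x; rewrite cindicI Normc.normcM -[leRHS]mul1r ler_wpM2r ?normc_ge0//.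
  exact: cindic_normc_le1.
apply: (@borel_ind (fun A => approximable (cindic (A `&` B)))).
- by rewrite setTI.
- move=> C [->|[a [n ->]]]; first by rewrite set0I; apply: approximable_locally_constant;
    have := locally_constant_zero; congr locally_constant; apply/funext => x; rewrite cindicE in_set0.
  rewrite (funext (cindicI _ _)); apply: approximable_locally_constant.
  apply: (@locally_constant_mul_cball _ a n%:Z); exact: locally_constant_cball.
- move=> C mC aC; have := approximableD aB (approximableZ (-1) aC).
  congr approximable; apply/funext => x; rewrite !cindicI !cindicE in_setC.
  by case: (x \in C); case: (x \in B) => /=; ring.
- move=> F mF tF aF.
  have aU n : approximable (cindic (\big[setU/set0]_(k < n) F k `&` B)).
    have := approximable_sum (index_enum 'I_n) (fun k : 'I_n => aF k).
    congr approximable; apply/funext => x.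
    elim: n => [|n IH]; first by rewrite !big_ord0 cindicI cindicE in_set0 mul0r.
    rewrite !big_ord_recr /= IH !cindicI -mulrDl; congr (_ * _).
    rewrite !cindicE in_setU; case: ifPn; case: (boolP (x \in F n)) => //=; rewrite ?addr0 ?add0r//.
    rewrite !inE -bigcup_mkord => Fnx [k /= kn Fkx]; exfalso.
    have := tF k n I I (ex_intro _ x (conj Fkx Fnx)) => kn'; by rewrite kn' ltnn in kn.
  have mU : measurable (\bigcup_k F k) by exact: bigcupT_measurable.
  apply: approximable_limit; first exact: LI.
  move=> d d0.
  have [||x|n Hn] := @L2_dominated _ _ mu (fun n => cindic (\big[setU/set0]_(k < n) F k `&` B)) _ _ (LI _ mU) (cball_L2 0 (- N%:Z)) _ _ _ d d0.
  + move=> n; apply: cmeasurable_indic; apply: measurableI => //.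
    by rewrite -bigcup_mkord; exact: bigcup_measurable.
  + move=> n x; rewrite cindicI Normc.normcM -[leRHS]mul1r ler_wpM2r ?normc_ge0//.
    exact: cindic_normc_le1.
  + have [[k _ Fkx]|nU] := pselect ((\bigcup_k F k) x).
      apply: (@cvg_eventually_eq0 _ _ k.+1) => n kn.
      have x1 : cindic (\bigcup_k F k) x = 1 :> R[i] by rewrite cindicE mem_set//; exists k.
      have x2 : cindic (\big[setU/set0]_(k < n) F k) x = 1 :> R[i].
        by rewrite cindicE mem_set// -bigcup_mkord; exists k.
      by rewrite !cindicI x1 x2 subrr Normc.normc0.
    apply: (@cvg_eventually_eq0 _ _ 0%N) => n _.
    have x1 : cindic (\bigcup_k F k) x = 0 :> R[i] by rewrite cindicE memNset.
    have x2 : cindic (\big[setU/set0]_(k < n) F k) x = 0 :> R[i].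
      by rewrite cindicE memNset// -bigcup_mkord => -[k _ Fkx]; apply: nU; exists k.
    by rewrite !cindicI x1 x2 mul0r subrr Normc.normc0.
  by exists (cindic (\big[setU/set0]_(k < n) F k `&` B)).
Qed.

Import HBSimple HBNNSimple.

(** Simple functions below h increase to h. *)
Lemma approximable_real (N : nat) (h : borel K -> R) : measurable_fun setT h ->
  (forall x, 0 <= h x) -> (forall x, ~ cball 0 (- N%:Z) x -> h x = 0) ->
  L2 mu (fun x => (h x)%:C%C) -> approximable (fun x => (h x)%:C%C).
Proof.
move=> mh h0 hB Lh; set B := cball 0 (- N%:Z).
have mh' : measurable_fun setT (EFin \o h) by exact/measurable_EFinP.
pose s := nnsfun_approx measurableT mh'.
have sh n (x : borel K) : s n x <= h x.
  rewrite -lee_fin /s nnsfun_approxE.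
  by apply: (@le_approx _ _ _ setT (EFin \o h)) => // y _; rewrite /= lee_fin.
have s0 n (x : borel K) : 0 <= s n x by [].
have scvg (x : borel K) : (fun n => s n x) @ \oo --> h x.
  have /fine_cvgP[_] := @cvg_nnsfun_approx _ _ _ _ measurableT _ mh' (fun x _ => h0 x) x I.
  exact.
have ms n : cmeasurable (fun x : borel K => (s n x)%:C%C).
  by apply: cmeasurable_real.
have aS n : approximable (fun x : borel K => (s n x)%:C%C).
  have H (y : R) : approximable (fun x => y%:C%C * cindic (s n @^-1` [set y] `&` B) x).
    by apply: approximableZ; apply: approximable_indic.
  have := approximable_sum (fset_set (range (s n))) H.
  congr approximable; apply/funext => x.
  rewrite [in RHS](fimfunE (s n) x) fsbig_finite//= rmorph_sum /=.
  apply: eq_bigr => y _; rewrite cindicI rmorphM /=.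
  have [Bx|NB] := pselect (B x); first by rewrite [cindic B x]cindicE mem_set// mulr1.
  have sx : s n x = 0 by apply/eqP; rewrite eq_le s0 andbT -(hB x NB) sh.
  rewrite [cindic B x]cindicE memNset// !mulr0 /cindic indicE.
  by case: (boolP (x \in _)); rewrite ?mulr0// inE /= sx => <-; rewrite mul0r.
apply: approximable_limit => // d d0.
have [||x|n Hn] := @L2_dominated _ _ mu (fun n (x : borel K) => (s n x)%:C%C) _ _ Lh Lh _ _ _ d d0.
- by [].
- by move=> n x; rewrite !normc_real !ger0_norm.
- rewrite (_ : (fun n => _) = (fun n => `|h x - s n x|)); last first.
    by apply/funext => n; rewrite -rmorphB normc_real.
  rewrite -[X in _ --> X](normr0 R) -(subrr (h x)).
  by apply: cvg_norm; apply: cvgB; [exact: cvg_cst|exact: scvg].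
by exists (fun x : borel K => (s n x)%:C%C).
Qed.

Lemma approximable_real_signed (N : nat) (h : borel K -> R) : measurable_fun setT h ->
  (forall x, ~ cball 0 (- N%:Z) x -> h x = 0) ->
  L2 mu (fun x => (h x)%:C%C) -> approximable (fun x => (h x)%:C%C).
Proof.
move=> mh hB Lh.
have P (r : borel K -> R) : measurable_fun setT r -> (forall x, 0 <= r x) ->
    (forall x, r x <= `|h x|) -> approximable (fun x => (r x)%:C%C).
  move=> mr r0 rh; apply: (@approximable_real N) => //.
    by move=> x /hB hx; apply/eqP; rewrite eq_le r0 (le_trans (rh x))// hx normr0.
  apply: (L2_le _ Lh); first exact: cmeasurable_real.
  by move=> x; rewrite !normc_real [leLHS]ger0_norm.
have a1 : approximable (fun x => (Num.max (h x) 0)%:C%C).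
  apply: P; first by apply: measurable_maxr => //; exact: measurable_cst.
    by move=> x; rewrite le_max lexx orbT.
  by move=> x; rewrite ge_max ler_norm normr_ge0.
have a2 : approximable (fun x => (Num.max (- h x) 0)%:C%C).
  apply: P; first by apply: measurable_maxr; [exact: measurable_funN|exact: measurable_cst].
    by move=> x; rewrite le_max lexx orbT.
  by move=> x; rewrite ge_max normr_ge0 andbT -normrN ler_norm.
have := approximableD a1 (approximableZ (-1) a2).
congr approximable; apply/funext => x; rewrite mulN1r -rmorphB; congr (_%:C%C).
have [hx|hx] := leP (h x) 0.
  by rewrite max_l ?oppr_ge0// sub0r opprK.
by rewrite max_r ?oppr_le0 ?subr0// ltW.
Qed.

(** Truncation to a large ball reduces to the indicators of Borel subsets of a ball, through
real and imaginary, positive and negative parts and simple functions. *)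
Lemma locally_constant_dense f : L2 mu f -> approximable f.
Proof.
move=> Lf; apply: approximable_limit => // d d0.
pose F (n : nat) (x : K) : R[i] := cindic (cball 0 (- n%:Z)) x * f x.
have mB (n : nat) : measurable (cball 0 (- n%:Z) : set (borel K)) by exact: measurable_cball.
have mF n : cmeasurable (F n).
  by apply: cmeasurableM; [exact: cmeasurable_indic|exact: L2_meas Lf].
have Ff n x : normc (F n x) <= normc (f x).
  by rewrite Normc.normcM -[leRHS]mul1r ler_wpM2r ?normc_ge0// cindic_normc_le1.
have LF n : L2 mu (F n) by exact: (L2_le (mF n) Lf).
have aF n : approximable (F n).
  have [m1 m2] := mF n.
  have F0 x : ~ cball 0 (- n%:Z) x -> F n x = 0.
    by move=> nx; rewrite /F cindicE memNset// mul0r.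
  have a1 : approximable (fun x => (Re (F n x))%:C%C).
    apply: (@approximable_real_signed n) => //; first by move=> x /F0 ->.
    apply: (L2_le _ (LF n)); first exact: cmeasurable_real.
    by move=> x; rewrite normc_real Re_le_normc.
  have a2 : approximable (fun x => (Im (F n x))%:C%C).
    apply: (@approximable_real_signed n) => //; first by move=> x /F0 ->.
    apply: (L2_le _ (LF n)); first exact: cmeasurable_real.
    by move=> x; rewrite normc_real Im_le_normc.
  have := approximableD a1 (approximableZ 'i%C a2).
  by congr approximable; apply/funext => x; rewrite -complexE.
have [x|n Hn] := L2_dominated Lf Lf mF Ff _ d0; last by exists (F n).
have [m xm] := frac_ideal_exhaust x.
apply: (@cvg_eventually_eq0 _ _ m) => n mn.
rewrite /F cindicE mem_set ?mul1r ?subrr ?Normc.normc0//.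
by rewrite /cball /= subr0; apply: frac_ideal_sub xm; lia.
Qed.

(** * Fourier series on the integers *)

(** The sum is the integral of chi (y .) over varpi^(-n) D, decomposed into cosets of D. *)
Lemma chi_orthogonality (n : nat) y : frac_ideal 0 y ->
  \sum_(k < q ^ n) chi (u k * y) = if `[< frac_ideal n%:Z y >] then (q ^ n)%:R else 0.
Proof.
move=> Dy.
have := cintegral_chi_ball0 (- n%:Z) y; rewrite opprK.
have -> : cintegral mu (fun x => cindic (cball 0 (- n%:Z)) x * chi (y * x)) =
    \sum_(k < q ^ n) chi (u k * y).
  rewrite (_ : (fun x => _) = (fun x => \sum_(k < q ^ n) chi (u k * y) * cindic (cball (u k) 0) x)).
    rewrite cintegral_sum; last by move=> k; apply: cintegrableZ; exact: cball_cintegrable.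
    apply: eq_bigr => k _; rewrite cintegralZ; last exact: cball_cintegrable.
    by rewrite cintegral_cball expr0z mulr1.
  apply/funext => x; have E := @locally_constant_expand 0 n (fun x => cindic (cball 0 (- n%:Z)) x * chi (y * x)) _ _ x.
  rewrite E.
  - rewrite add0n; apply: eq_bigr => k _; rewrite expr0 mul1r; congr (_ * _).
    rewrite cindicE mem_set; first by rewrite mul1r mulrC.
    by rewrite /cball /= subr0; exact: coset_rep_bound.
  - move=> z w wD; rewrite mulrDr chiD (chi_integers (frac_idealM Dy wD)) mulr1.
    congr (_ * _); have w0 : frac_ideal (- n%:Z) w by apply: frac_ideal_sub wD; lia.
    by rewrite !cindicE; congr (if _ then _ else _); apply/idP/idP; rewrite !inE => /(cball_invariant _ _ w0).
  - by move=> z nz; rewrite cindicE memNset ?mul0r// /cball /= subr0.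
move=> ->; case: asboolP => // _.
by rewrite abs_varpi_exprz opprK -exprnP natrX rmorphXn /= rmorph_nat.
Qed.

Definition integer_char (k : nat) (x : K) : R[i] := cindic (cball 0 0) x * chi (u k * x).

Lemma integer_char_L2 k : L2 mu (integer_char k).
Proof.
have mc : cmeasurable (integer_char k).
  by apply: cmeasurableM; [exact: cmeasurable_indic (measurable_cball _ _)|exact: cmeasurable_chi].
apply: (L2_le mc (cball_L2 0 0)) => x.
by rewrite Normc.normcM chi_normc mulr1.
Qed.

Lemma cindic_sq A x : cindic A x * cindic A x = cindic A x :> R[i].
Proof. by rewrite cindicE; case: ifP; rewrite ?mulr1 ?mulr0. Qed.

Lemma cindicJ A x : conjc (cindic A x) = cindic A x :> R[i].
Proof. by rewrite /cindic conjc_real. Qed.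

Lemma integer_char_orthonormal k l :
  inner mu (integer_char k) (integer_char l) = (k == l)%:R.
Proof.
rewrite /inner (_ : (fun x => _) = (fun x => cindic (cball 0 0) x * chi ((u k - u l) * x))); last first.
  apply/funext => x; rewrite /integer_char conjcM cindicJ conj_chi -[in RHS]cindic_sq mulrBl chiD.
  by rewrite -mulNr; ring.
rewrite cintegral_chi_ball0 oppr0 expr0z; case: asboolP => [/coset_rep_uniq ->|]; first by rewrite eqxx.
by have [->|//] := eqVneq k l; rewrite subrr => h; exfalso; apply: h; exact: frac_ideal0.
Qed.

(** By discrete Fourier inversion on D / varpi^n D, a locally constant function on D is a finite
combination of the characters; completeness thus follows from density. *)
Lemma parseval_integers h : L2 mu h -> (forall x, ~ frac_ideal 0 x -> h x = 0) ->
  \esum_(k in [set: nat]) (normc (inner mu h (integer_char k)) ^+ 2)%:E = (nrm mu h)%:E.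
Proof.
move=> Lh h0; apply: (parseval integer_char_L2 integer_char_orthonormal Lh) => d d0.
have [_ /(_ _ d0)[g [n [N [gi gs]]] hg]] := locally_constant_dense Lh.
pose a k := \sum_(v < q ^ n) ((q ^ n)%:R^-1 * g (varpi ^+ n * u v)) * chi (- (u k * (varpi ^+ n * u v))).
exists (index_iota 0 (q ^ n)), a.
have E x : \sum_(0 <= k < q ^ n) a k * integer_char k x = cindic (cball 0 0) x * g x.
  rewrite big_mkord; have [Dx|ND] := pselect (frac_ideal 0 x); last first.
    have -> : cindic (cball 0 0) x = 0 :> R[i] by rewrite cindicE memNset// /cball /= subr0.
    rewrite mul0r big1// => k _; rewrite /integer_char cindicE memNset ?mul0r ?mulr0//.
    by rewrite /cball /= subr0.
  have Bx : cindic (cball 0 0) x = 1 :> R[i] by rewrite cindicE mem_set// /cball /= subr0.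
  under eq_bigr do rewrite /integer_char Bx mul1r /a mulr_suml.
  rewrite exchange_big /=.
  rewrite Bx mul1r.
  have gE := @locally_constant_expand n 0 (fun x => cindic (cball 0 0) x * g x) _ _ x.
  rewrite -[RHS]mul1r -Bx gE.
  - rewrite addn0; apply: eq_bigr => v _.
    have Dv : frac_ideal 0 (varpi ^+ n * u v).
      by rewrite -(addNr n%:Z); apply/frac_ideal_shift; exact: coset_rep_bound.
    rewrite [cindic (cball 0 0) _]cindicE mem_set ?mul1r; last by rewrite /cball /= subr0.
    under eq_bigr => k _ do rewrite -mulrA -chiD -mulrN -mulrDr.
    rewrite -mulr_sumr chi_orthogonality; last first.
      by apply: frac_idealD => //; exact: frac_idealN.
    rewrite [_ + x]addrC [cindic (cball _ n%:Z) x]cindicE cballE; case: asboolP => _; last by rewrite !mulr0.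
    rewrite [cindic (cball 0 0) _]cindicE mem_set; last by rewrite /cball /= subr0.
    rewrite mul1r mulr1 mulrAC mulVf ?mul1r//.
    by rewrite pnatr_eq0 -lt0n expn_gt0 q_gt0.
  - move=> y z nz; rewrite gi//; congr (_ * _).
    have w0 : frac_ideal 0 z by apply: frac_ideal_sub nz; lia.
    by rewrite !cindicE; congr (if _ then _ else _); apply/idP/idP; rewrite !inE => /(cball_invariant _ _ w0).
  - by move=> y; rewrite oppr0 => ny; rewrite cindicE memNset ?mul0r// /cball /= subr0.
have Lg : L2 mu g by apply: locally_constant_L2; exists n, N.
have LB := L2B Lh Lg.
have mD := cmeasurableM (cmeasurable_indic (measurable_cball 0 0)) (L2_meas LB).
have LD : L2 mu (fun x => cindic (cball 0 0) x * (h x - g x)).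
  apply: (L2_le mD LB) => x; rewrite Normc.normcM -[leRHS]mul1r ler_wpM2r ?normc_ge0//.
  exact: cindic_normc_le1.
rewrite (_ : (fun x => _) = (fun x => cindic (cball 0 0) x * (h x - g x))); last first.
  apply/funext => x; rewrite E mulrBr; congr (_ - _).
  have [Dx|ND] := pselect (frac_ideal 0 x); last by rewrite h0// mulr0.
  by rewrite cindicE mem_set ?mul1r// /cball /= subr0.
apply: le_lt_trans hg; rewrite -lee_fin -!L2_fin//; apply: sqI_le => // [|x].
  exact: L2_meas LB.
rewrite Normc.normcM -[leRHS]mul1r ler_wpM2r ?normc_ge0//; exact: cindic_normc_le1.
Qed.

(** * The inverse Fourier transform of locally constant functions *)

Lemma level_mono n N m M f : (n <= m)%N -> (N <= M)%N -> level n N f -> level m M f.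
Proof.
move=> nm NM [fi fs]; split => [x z mz|x Mx]; first by apply: fi; apply: frac_ideal_sub mz; lia.
by apply: fs => h; apply: Mx; apply: frac_ideal_sub h; lia.
Qed.

Lemma cintegral_level n N f : level n N f ->
  cintegral mu f = (abs varpi ^ n%:Z)%:C%C * \sum_(k < q ^ (n + N)) f (varpi ^+ n * u k).
Proof.
move=> [fi fs]; rewrite {1}(funext (locally_constant_expand fi fs)) cintegral_sum; last first.
  by move=> k; apply: cintegrableZ; exact: cball_cintegrable.
rewrite mulr_sumr; apply: eq_bigr => k _.
by rewrite cintegralZ ?cintegral_cball 1?mulrC//; exact: cball_cintegrable.
Qed.

Lemma locally_constant_sum (I : Type) (s : seq I) (F : I -> K -> R[i]) :
  (forall i, locally_constant (F i)) -> locally_constant (fun x => \sum_(i <- s) F i x).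
Proof.
move=> mF; elim: s => [|i s IH].
  by under eq_fun do rewrite big_nil; exact: locally_constant_zero.
by under eq_fun do rewrite big_cons; exact: locally_constantD.
Qed.

Lemma locally_constant_mulchi f y : locally_constant f ->
  locally_constant (fun x => f x * chi (y * x)).
Proof.
move=> [n [N [fi fs]]]; have [m ym] := frac_ideal_exhaust y.
exists (n + m)%N, N; split => [x z nz|x /fs ->]; last by rewrite mul0r.
rewrite fi; last by apply: frac_ideal_sub nz; lia.
by congr (_ * _); apply: chi_invariant ym _; apply: frac_ideal_sub nz; lia.
Qed.

Definition invF (F : K -> R[i]) (x : K) : R[i] :=
  cintegral mu (fun xi => F xi * chi (x * xi)).

Lemma cintegrable_mulchi F x : locally_constant F ->
  cintegrable mu (fun xi => F xi * chi (x * xi)).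
Proof. by move=> lF; apply: locally_constant_cintegrable; exact: locally_constant_mulchi. Qed.

Lemma invFB F G x : locally_constant F -> locally_constant G ->
  invF (fun xi => F xi - G xi) x = invF F x - invF G x.
Proof.
move=> lF lG; rewrite /invF -cintegralB; try exact: cintegrable_mulchi.
by apply: eq_cintegral => xi; rewrite mulrBl.
Qed.

Lemma invFZ (a : R[i]) F x : locally_constant F ->
  invF (fun xi => a * F xi) x = a * invF F x.
Proof.
move=> lF; rewrite /invF -cintegralZ; last exact: cintegrable_mulchi.
by apply: eq_cintegral => xi; rewrite mulrA.
Qed.

Lemma invF_sum (I : Type) (s : seq I) (F : I -> K -> R[i]) x :
  (forall i, locally_constant (F i)) ->
  invF (fun xi => \sum_(i <- s) F i xi) x = \sum_(i <- s) invF (F i) x.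
Proof.
move=> lF; rewrite /invF -cintegral_sum; last by move=> i; exact: cintegrable_mulchi.
by apply: eq_cintegral => xi; rewrite mulr_suml.
Qed.

Lemma invF_cball a M x : invF (cindic (cball a M)) x =
  (abs varpi ^ M)%:C%C * (cindic (cball 0 (- M)) x * chi (a * x)).
Proof.
have := @cintegral_affine 1 (- a) _ (oner_neq0 _) (cintegrable_chi_ball 0 M x).
rewrite abs1 invr1 mul1r cintegral_chi_ball0 => h.
have -> : invF (cindic (cball a M)) x = chi (a * x) *
   cintegral mu (fun z => cindic (cball 0 M) (1 * z - a) * chi (x * (1 * z - a))).
  rewrite -cintegralZ; last first.
    by have := @cintegrable_affine 1 (- a) _ (oner_neq0 _) (cintegrable_chi_ball 0 M x).
  apply: eq_cintegral => z; rewrite mul1r mulrCA -chiD.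
  have -> : a * x + x * (z - a) = x * z by ring.
  by congr (_ * _); rewrite !cindicE !cballE subr0.
by rewrite h cindicE cballE subr0; case: asboolP; rewrite ?mul0r ?mulr0// mul1r mulrC.
Qed.

Lemma invF_expand n N F x : level n N F -> invF F x =
  \sum_(k < q ^ (n + N)) F (varpi ^+ n * u k) *
     invF (cindic (cball (varpi ^+ n * u k) n%:Z)) x.
Proof.
move=> [Fi Fs]; rewrite {1}(funext (locally_constant_expand Fi Fs)) invF_sum; last first.
  by move=> k; apply: locally_constantZ; exact: locally_constant_cball.
by apply: eq_bigr => k _; rewrite invFZ//; exact: locally_constant_cball.
Qed.

Lemma locally_constant_invF_cball a M : locally_constant (invF (cindic (cball a M))).
Proof.
rewrite (funext (invF_cball a M)); apply: locally_constantZ.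
by apply: locally_constant_mulchi; exact: locally_constant_cball.
Qed.

Lemma locally_constant_invF F : locally_constant F -> locally_constant (invF F).
Proof.
move=> [n [N lF]]; rewrite (funext (fun x => invF_expand x lF)).
apply: locally_constant_sum => k; apply: locally_constantZ.
exact: locally_constant_invF_cball.
Qed.

Lemma invF_supp n N F x : level n N F -> ~ frac_ideal (- n%:Z) x -> invF F x = 0.
Proof.
move=> lF nx; rewrite (invF_expand x lF) big1// => k _.
by rewrite invF_cball cindicE memNset ?mul0r ?mulr0// /cball /= subr0.
Qed.

Lemma inner_invF_cball a b M :
  inner mu (invF (cindic (cball a M))) (invF (cindic (cball b M))) =
  inner mu (cindic (cball a M)) (cindic (cball b M)).
Proof.
set w := (abs varpi ^ M)%:C%C.
have -> : inner mu (invF (cindic (cball a M))) (invF (cindic (cball b M))) =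
    w * w * (if `[< frac_ideal M (a - b) >] then (abs varpi ^ (- M))%:C%C else 0).
  rewrite -[in frac_ideal M]((opprK M)) -cintegral_chi_ball0 -cintegralZ; last exact: cintegrable_chi_ball.
  apply: eq_cintegral => x; rewrite !invF_cball !conjcM cindicJ conj_chi conjc_real -/w.
  rewrite -[in RHS]cindic_sq mulrBl chiD -!mulNr; ring.
rewrite /inner.
have [ab|nab] := asboolP.
  have -> : cball b M = cball a M.
    apply/seteqP; split => x; rewrite /cball /= => h.
      have -> : x - a = (x - b) - (a - b) by ring.
      by apply: frac_idealD => //; exact: frac_idealN.
    have -> : x - b = (x - a) + (a - b) by ring.
    exact: frac_idealD.
  under eq_cintegral do rewrite cindicJ cindic_sq.
  rewrite cintegral_cball /w -!rmorphM /= -!expfzDr ?gt_eqF ?abs_varpi_gt0//.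
  by rewrite addrK.
rewrite mulr0 -[LHS](cintegral0 mu); apply: eq_cintegral => x.
rewrite cindicJ !cindicE !cballE; case: asboolP; case: asboolP; rewrite ?mulr0 ?mul0r// => hb ha.
exfalso; apply: nab; have -> : a - b = (x - b) - (x - a) by ring.
by apply: frac_idealD => //; exact: frac_idealN.
Qed.

(** Plancherel: the indicators of distinct balls of equal radius are orthogonal, and so are
their transforms. *)
Lemma nrm_invF F : locally_constant F -> nrm mu (invF F) = nrm mu F.
Proof.
move=> lF; have [n [N lF']] := lF; have [Fi Fs] := lF'.
apply: (@complexI R); rewrite -!inner_nrm; try exact: locally_constant_L2; last first.
  by apply: locally_constant_L2; exact: locally_constant_invF.
rewrite (funext (fun x => invF_expand x lF')) [in RHS](funext (locally_constant_expand Fi Fs)).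
have L1 (k : 'I_(q ^ (n + N))) : L2 mu (cindic (R:=R) (cball (varpi ^+ n * u k) n)) by exact: cball_L2.
have L1' (k : 'I_(q ^ (n + N))) : L2 mu (invF (cindic (cball (varpi ^+ n * u k) n))).
  by apply: locally_constant_L2; exact: locally_constant_invF_cball.
rewrite !inner_suml; try (by move=> k; exact: L2Z); try (by apply: L2_sum => k; exact: L2Z).
apply: eq_bigr => k _.
rewrite !inner_sumr; try (by move=> l; exact: L2Z); try exact: L2Z.
apply: eq_bigr => l _.
rewrite !innerZl ?innerZr ?inner_invF_cball//; exact: L2Z.
Qed.

(** By linearity it suffices to treat the indicator of a ball, which is the inverse transform of
a character restricted to the dual ball. *)
Lemma invF_onto g : locally_constant g -> exists2 F, locally_constant F & g = invF F.
Proof.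
move=> [n [N [gi gs]]].
pose G (a : K) xi := (abs varpi ^ n%:Z)%:C%C * (cindic (cball 0 (- n%:Z)) xi * chi (- a * xi)).
have lG a : locally_constant (G a).
  by apply: locally_constantZ; apply: locally_constant_mulchi; exact: locally_constant_cball.
exists (fun xi => \sum_(k < q ^ (n + N)) g (varpi ^+ n * u k) * G (varpi ^+ n * u k) xi).
  by apply: locally_constant_sum => k; exact: locally_constantZ.
apply/funext => x; rewrite invF_sum; last by move=> k; exact: locally_constantZ.
rewrite (locally_constant_expand gi gs); apply: eq_bigr => k _.
rewrite invFZ//; congr (_ * _); set a := _ * u k.
have lB : locally_constant (fun xi => cindic (cball 0 (- n%:Z)) xi * chi (- a * xi)).
  by apply: locally_constant_mulchi; exact: locally_constant_cball.
rewrite /G invFZ// /invF.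
under eq_cintegral => xi do rewrite -mulrA -chiD -mulrDl.
rewrite cintegral_chi_ball0 opprK cindicE cballE addrC; case: asboolP => _; last by rewrite mulr0.
by rewrite -rmorphM /= -expfzDr ?subrr ?expr0z// gt_eqF ?abs_varpi_gt0.
Qed.

(** * The Fourier transform on L2 *)

Lemma cintegrable_mul_unimodular f y : cintegrable mu f ->
  cintegrable mu (fun x => f x * conjc (chi (y * x))).
Proof.
move=> cf; have mf := cintegrable_measurable cf.
apply: (cintegrable_dom (g := fun x => normc (f x))).
- by apply: cmeasurableM => //; apply: cmeasurableJ; exact: cmeasurable_chi.
- by move=> x; rewrite Normc.normcM normc_conj chi_normc mulr1.
- exact: cintegrable_normc.
Qed.

Local Notation fourier1 := (fourier1 mu chi).

Lemma fourier1_invariant n f : (forall x, ~ frac_ideal (- n%:Z) x -> f x = 0) ->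
  forall xi z, frac_ideal n%:Z z -> fourier1 f (xi + z) = fourier1 f xi.
Proof.
move=> fs xi z nz; apply: eq_cintegral => x.
have [nx|/fs ->] := pselect (frac_ideal (- n%:Z) x); last by rewrite !mul0r.
by rewrite [(xi + z) * x]mulrC [xi * x]mulrC (chi_invariant _ nx nz).
Qed.

(** Both sides are the same finite sum over the cosets of varpi^n D. *)
Lemma fourier1_pairing_level n N f F : cintegrable mu f ->
  (forall x, ~ frac_ideal (- n%:Z) x -> f x = 0) -> level n N F ->
  inner mu f (invF F) = inner mu (fourier1 f) F.
Proof.
move=> cf fs lF; have [Fi Fs] := lF.
have -> : inner mu (fourier1 f) F = (abs varpi ^ n%:Z)%:C%C *
    \sum_(k < q ^ (n + N)) fourier1 f (varpi ^+ n * u k) * conjc (F (varpi ^+ n * u k)).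
  apply: (@cintegral_level n N (fun xi => fourier1 f xi * conjc (F xi))).
  split => [xi z nz|xi /Fs ->]; last by rewrite conjc0 mulr0.
  by rewrite Fi// (fourier1_invariant fs).
have -> : inner mu f (invF F) = cintegral mu (fun x => \sum_(k < q ^ (n + N))
   ((abs varpi ^ n%:Z)%:C%C * conjc (F (varpi ^+ n * u k))) * (f x * conjc (chi (varpi ^+ n * u k * x)))).
  apply: eq_cintegral => x; have [nx|/fs ->] := pselect (frac_ideal (- n%:Z) x); last first.
    by rewrite mul0r big1// => k _; rewrite mul0r mulr0.
  rewrite (invF_expand x lF) rmorph_sum mulr_sumr; apply: eq_bigr => k _ /=.
  rewrite invF_cball cindicE cballE subr0; case: asboolP => // _.
  rewrite mul1r !conjcM conjc_real; ring.
rewrite cintegral_sum; last by move=> k; apply: cintegrableZ; exact: cintegrable_mul_unimodular.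
rewrite mulr_sumr; apply: eq_bigr => k _; rewrite cintegralZ; last exact: cintegrable_mul_unimodular.
by rewrite /Defs.fourier1; ring.
Qed.

Definition trunc (m : nat) (f : K -> R[i]) (x : K) : R[i] := cindic (cball 0 (- m%:Z)) x * f x.

Lemma trunc_le m f x : normc (trunc m f x) <= normc (f x).
Proof. by rewrite Normc.normcM -[leRHS]mul1r ler_wpM2r ?normc_ge0// cindic_normc_le1. Qed.

Lemma cmeasurable_trunc m f : cmeasurable f -> cmeasurable (trunc m f).
Proof. by move=> mf; apply: cmeasurableM => //; exact: cmeasurable_indic (measurable_cball _ _). Qed.

Lemma cintegrable_trunc m f : cintegrable mu f -> cintegrable mu (trunc m f).
Proof.
move=> cf; apply: (cintegrable_dom (g := fun x => normc (f x))).
- by apply: cmeasurable_trunc; exact: cintegrable_measurable cf.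
- exact: trunc_le.
- exact: cintegrable_normc.
Qed.

Lemma trunc_supp m f x : ~ frac_ideal (- m%:Z) x -> trunc m f x = 0.
Proof. by move=> mx; rewrite /trunc cindicE memNset ?mul0r// /cball /= subr0. Qed.

Lemma trunc_id m f x : frac_ideal (- m%:Z) x -> trunc m f x = f x.
Proof. by move=> mx; rewrite /trunc cindicE mem_set ?mul1r// /cball /= subr0. Qed.

Lemma trunc_small f : cintegrable mu f -> forall d : R, 0 < d -> exists M, forall m, (M <= m)%N ->
  (\int[mu]_x (normc (f x - trunc m f x))%:E < d%:E)%E.
Proof.
move=> cf d d0; have mf := cintegrable_measurable cf.
pose h m (x : borel K) := (normc (f x - trunc m f x))%:E.
have mh m : measurable_fun setT (h m).
  apply/measurable_EFinP; apply: cmeasurable_normc; apply: cmeasurableB => //.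
  exact: cmeasurable_trunc.
have hE m x : h m x = if `[< frac_ideal (- m%:Z) x >] then 0%E else (normc (f x))%:E.
  rewrite /h; case: asboolP => mx; first by rewrite trunc_id// subrr Normc.normc0.
  by rewrite trunc_supp// subr0.
have hc x : h^~ x @ \oo --> (0 : \bar R)%E.
  have [m xm] := frac_ideal_exhaust x; apply: cvg_near_cst; exists m => // k /= mk.
  by rewrite hE; case: asboolP => // -[]; apply: frac_ideal_sub xm; lia.
have [||[_ _]] := dominated_convergence measurableT mh (measurable_cst (0 : \bar R)) _ (cintegrable_normc cf) _.
- by apply: aeW => x _; exact: hc.
- apply: aeW => x n _; rewrite hE; case: asboolP => _; rewrite ?abse0 ?gee0_abs ?lee_fin ?normc_ge0//.
rewrite integral0 => /(ecvg0P _) H; apply: H => // n.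
by apply: integral_ge0 => x _; rewrite lee_fin normc_ge0.
Qed.

Lemma normc_fourier1_sub f m xi : cintegrable mu f ->
  ((normc (fourier1 f xi - fourier1 (trunc m f) xi))%:E <=
   \int[mu]_x (normc (f x - trunc m f x))%:E)%E.
Proof.
move=> cf; have ct := cintegrable_trunc m cf.
rewrite -cintegralB; try exact: cintegrable_mul_unimodular.
apply: le_trans (normc_cintegral_le _) _.
  have := cintegrable_mul_unimodular xi (cintegrableD cf (cintegrableZ (-1) ct)).
  by congr cintegrable; apply/funext => x; ring.
rewrite le_eqVlt; apply/orP; left; apply/eqP; apply: eq_integral => x _.
by rewrite -mulrBl Normc.normcM normc_conj chi_normc mulr1.
Qed.

Lemma cmeasurable_fourier1 f : cintegrable mu f -> cmeasurable (fourier1 f).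
Proof.
move=> cf.
have mt m : cmeasurable (fourier1 (trunc m f)).
  apply: (@invariant_cmeasurable m%:Z); apply: fourier1_invariant => x; exact: trunc_supp.
have small (x : K) (e : R) : 0 < e -> exists M, forall m, (M <= m)%N ->
    normc (fourier1 f x - fourier1 (trunc m f) x) < e.
  move=> e0; have [M HM] := trunc_small cf e0; exists M => m /HM.
  by rewrite -lte_fin; exact: le_lt_trans (normc_fourier1_sub _ _ cf).
split.
  apply: (@measurable_fun_cvg _ (borel K) _ _ (fun n (x : borel K) => Re (fourier1 (trunc n f) x))).
    by move=> n; case: (mt n).
  move=> x _; apply/cvgrPdist_lt => e /(small x)[M HM]; exists M => // m /HM.
  by apply: le_lt_trans; rewrite -ReN -ReD Re_le_normc.
apply: (@measurable_fun_cvg _ (borel K) _ _ (fun n (x : borel K) => Im (fourier1 (trunc n f) x))).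
  by move=> n; case: (mt n).
move=> x _; apply/cvgrPdist_lt => e /(small x)[M HM]; exists M => // m /HM.
by apply: le_lt_trans; rewrite -ImN -ImD Im_le_normc.
Qed.

Lemma cintegrable_bounded_mul (h F : K -> R[i]) (C : R) : cmeasurable h ->
  (forall x, normc (h x) <= C) -> cintegrable mu F -> cintegrable mu (fun x => h x * F x).
Proof.
move=> mh hC cF; apply: (cintegrable_dom (g := fun x => C * normc (F x))).
- by apply: cmeasurableM => //; exact: cintegrable_measurable cF.
- by move=> x; rewrite Normc.normcM ler_wpM2r// normc_ge0.
- exact: (integrableZl measurableT C (cintegrable_normc cF)).
Qed.

(** The identity holds for the truncations of f, whose transforms converge uniformly to that of
f. *)
Lemma fourier1_pairing f F : cintegrable mu f -> locally_constant F ->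
  inner mu f (invF F) = inner mu (fourier1 f) F.
Proof.
move=> cf lF; have [n [N lnF]] := lF; have cF := locally_constant_cintegrable lF.
have cFJ := cintegrableJ cF.
have mf1 := cmeasurable_fourier1 cf.
pose C := fine (\int[mu]_x (normc (conjc (F x)))%:E).
have CE : (\int[mu]_x (normc (conjc (F x)))%:E = C%:E)%E.
  rewrite /C fineK//; apply: integrable_fin_num => //; exact: cintegrable_normc.
have C0 : 0 <= C by rewrite /C fine_ge0// integral_ge0// => x _; rewrite lee_fin normc_ge0.
apply: eq_normc_small => e2 e20.
have [e e0 <-] : exists2 e, 0 < e & e ^+ 2 = e2.
  by exists (Num.sqrt e2); rewrite ?sqrtr_gt0// sqr_sqrtr// ltW.
rewrite ler_pXn2r ?nnegrE ?normc_ge0 ?(ltW e0)//.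
have C1 : 0 < C + 1 by rewrite ltr_wpDl.
have [M HM] := trunc_small cf (divr_gt0 e0 C1).
pose m := (M + n)%N; have := HM m (leq_addr _ _) => {}HM.
have -> : inner mu f (invF F) = inner mu (fourier1 (trunc m f)) F.
  rewrite -(@fourier1_pairing_level m N)//; last 3 first.
  - exact: cintegrable_trunc.
  - exact: trunc_supp.
  - by apply: level_mono lnF => //; rewrite leq_addl.
  apply: eq_cintegral => x; have [nx|nx] := pselect (frac_ideal (- n%:Z) x).
    by rewrite trunc_id//; apply: frac_ideal_sub nx; lia.
  by rewrite (invF_supp lnF nx) conjc0 !mulr0.
have le_d x : normc (fourier1 (trunc m f) x - fourier1 f x) <= e / (C + 1).
  rewrite -normc_oppr opprB -lee_fin; apply: ltW.
  exact: le_lt_trans (normc_fourier1_sub m x cf) HM.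
have mt : cmeasurable (fourier1 (trunc m f)).
  by apply: cmeasurable_fourier1; exact: cintegrable_trunc.
have mB := cmeasurableB mt mf1.
have cB := cintegrable_bounded_mul mB le_d cFJ.
have -> : inner mu (fourier1 (trunc m f)) F - inner mu (fourier1 f) F =
   cintegral mu (fun x => (fourier1 (trunc m f) x - fourier1 f x) * conjc (F x)).
  have bd g x : cintegrable mu g -> normc (fourier1 g x) <= fine (\int[mu]_x (normc (g x))%:E).
    move=> cg; rewrite -lee_fin fineK; last by apply: integrable_fin_num => //; exact: cintegrable_normc.
    apply: le_trans (normc_cintegral_le (cintegrable_mul_unimodular x cg)) _.
    rewrite le_eqVlt; apply/orP; left; apply/eqP; apply: eq_integral => y _.
    by rewrite Normc.normcM normc_conj chi_normc mulr1.
  rewrite -cintegralB; last 2 first.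
  - by apply: (cintegrable_bounded_mul mt _ cFJ) => x; apply: bd; exact: cintegrable_trunc.
  - by apply: (cintegrable_bounded_mul mf1 _ cFJ) => x; exact: bd.
  by apply: eq_cintegral => x; rewrite mulrBl.
rewrite -lee_fin; apply: le_trans (normc_cintegral_le cB) _.
apply: (@le_trans _ _ (\int[mu]_x ((e / (C + 1))%:E * (normc (conjc (F x)))%:E))%E).
  apply: ge0_le_integral => //.
  - by move=> x _; rewrite lee_fin normc_ge0.
  - by apply/measurable_EFinP; apply: cmeasurable_normc; exact: cintegrable_measurable cB.
  - by apply/measurable_EFinP; apply: measurable_funM => //; apply: cmeasurable_normc; exact: cintegrable_measurable cFJ.
  by move=> x _; rewrite -EFinM lee_fin Normc.normcM ler_wpM2r ?normc_ge0.
rewrite ge0_integralZl_EFin//; last 3 first.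
- by move=> x _; rewrite lee_fin normc_ge0.
- by apply/measurable_EFinP; apply: cmeasurable_normc; exact: cintegrable_measurable cFJ.
- by rewrite divr_ge0// ltW.
by rewrite CE -EFinM lee_fin mulrAC ler_pdivrMr// ler_pM2l// lerDl.
Qed.

Lemma cLfun1_cintegrable f : cLfun mu 1 f <-> cintegrable mu f.
Proof.
have E : cLnorm mu 1 f = (\int[mu]_x (normc (f x))%:E)%E.
  rewrite /cLnorm Lnorm1; apply: eq_integral => x _ /=.
  by rewrite ger0_norm ?normc_ge0.
split => [[mf]|cf]; first by rewrite E; exact: cintegrableP.
split; first exact: cintegrable_measurable cf.
rewrite E; have /integrableP[_] := cintegrable_normc cf.
by under eq_integral do rewrite gee0_abs ?lee_fin ?normc_ge0//.
Qed.

Lemma nrm_lt f (d : R) : L2 mu f -> (sqI mu f < d%:E)%E -> nrm mu f < d.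
Proof. by move=> Lf; rewrite (L2_fin Lf) lte_fin. Qed.

(** Both sides are continuous in the L2 norm, so the identity passes from the f_n to the limit.
This weak form characterizes the transform and is the form in which it is applied below. *)
Lemma is_fourier_pairing f g F : L2 mu f -> is_fourier mu chi f g -> locally_constant F ->
  inner mu f (invF F) = inner mu g F.
Proof.
move=> Lf [/cLfun2P Lg [f_ [Lf_ /cLnorm2_cvg0 ff /cLnorm2_cvg0 gg]]] lF.
have LF := locally_constant_L2 lF; have LI := locally_constant_L2 (locally_constant_invF lF).
apply: eq_normc_small => e e0.
pose A := nrm mu (invF F) + nrm mu F.
have A0 : 0 < 2 * A + 1 by rewrite ltr_wpDl// mulr_ge0// addr_ge0 ?nrm_ge0.
have e1 : 0 < e / (2 * A + 1) by rewrite divr_gt0.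
have [N1 H1] := ff _ e1; have [N2 H2] := gg _ e1; pose n := (N1 + N2)%N.
have {}H1 := H1 n (leq_addr _ _); have {}H2 := H2 n (leq_addl _ _).
have [/cLfun1_cintegrable cf /cLfun2P Lfn] := Lf_ n.
have LB : L2 mu (fun x => f_ n x - f x) by exact: L2B.
have LC : L2 mu (fun x => fourier1 (f_ n) x - g x).
  split; last by apply: lt_trans H2 _; exact: ltry.
  by apply: cmeasurableB; [exact: cmeasurable_fourier1|exact: L2_meas Lg].
have {}H1 := nrm_lt LB H1; have {}H2 := nrm_lt LC H2.
have Lh : L2 mu (fourier1 (f_ n)).
  by have := L2D LC Lg; congr L2; apply/funext => x; rewrite subrK.
have -> : inner mu f (invF F) - inner mu g F =
   inner mu (fun x => fourier1 (f_ n) x - g x) F - inner mu (fun x => f_ n x - f x) (invF F).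
  rewrite (innerBl Lh Lg LF) (innerBl Lfn Lf LI) (fourier1_pairing cf lF); ring.
apply: le_trans (normc_sqD _ _) _; rewrite normc_oppr.
have h1 : normc (inner mu (fun x => f_ n x - f x) (invF F)) ^+ 2 <= e / (2 * A + 1) * nrm mu (invF F).
  by apply: le_trans (inner_CS LB LI) _; rewrite ler_wpM2r ?nrm_ge0// ltW.
have h2 : normc (inner mu (fun x => fourier1 (f_ n) x - g x) F) ^+ 2 <= e / (2 * A + 1) * nrm mu F.
  by apply: le_trans (inner_CS LC LF) _; rewrite ler_wpM2r ?nrm_ge0// ltW.
apply: le_trans (lerD (ler_wpM2l _ h2) (ler_wpM2l _ h1)) _ => //.
have -> : 2 * (e / (2 * A + 1) * nrm mu F) + 2 * (e / (2 * A + 1) * nrm mu (invF F)) =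
   e * (2 * A) / (2 * A + 1) by rewrite /A; ring.
by rewrite ler_pdivrMr// ler_pM2l// lerDl.
Qed.

Lemma fourier1_locally_constant F xi : fourier1 F xi = invF F (- xi).
Proof. by apply: eq_cintegral => x; rewrite conj_chi mulNr. Qed.

(** On locally constant functions the transform is an isometry, so it maps an approximating
sequence of f to a Cauchy sequence. *)
Lemma fourier_exists f : L2 mu f -> exists g, is_fourier mu chi f g.
Proof.
move=> Lf.
have d8 n : 0 < (n.+1%:R^-1 : R) by rewrite invr_gt0.
have /boolp.choice[F HF] : forall n, exists g, locally_constant g /\ nrm mu (fun x => f x - g x) < n.+1%:R^-1.
  by move=> n; have [_ /(_ _ (d8 n))[g lg fg]] := locally_constant_dense Lf; exists g.
have lF n := (HF n).1; have LF n := locally_constant_L2 (lF n).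
have small (d : R) : 0 < d -> exists N, forall n, (N <= n)%N -> nrm mu (fun x => f x - F n x) < d.
  move=> d0; have [N HN] : exists N : nat, d^-1 < N%:R.
    by exists (Num.truncn d^-1).+1; exact: truncnS_gt.
  exists N => n Nn; apply: lt_trans (HF n).2 _.
  rewrite -[ltRHS]invrK ltf_pV2 ?posrE ?invr_gt0 ?ltr0n//.
  by apply: lt_le_trans HN _; rewrite ler_nat leqW.
have ffF n : fourier1 (F n) = (fun xi => invF (F n) (-1 * xi + 0)).
  by apply/funext => xi; rewrite fourier1_locally_constant mulN1r addr0.
have N1 : -1 != 0 :> K by rewrite oppr_eq0 oner_eq0.
have isoB m n : sqI mu (fun x => fourier1 (F m) x - fourier1 (F n) x) =
                (nrm mu (fun x => F m x - F n x))%:E.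
  rewrite !ffF; have lB := locally_constantB (lF m) (lF n).
  have := @sqI_affine (-1) 0 _ N1 (L2_meas (locally_constant_L2 (locally_constant_invF lB))).
  rewrite absN abs1 invr1 mul1e (L2_fin (locally_constant_L2 (locally_constant_invF lB))) nrm_invF// => <-.
  by congr sqI; apply/funext => x; rewrite invFB.
have [n|d d0|g Lg Hg] := @L2_complete _ _ mu (fun n => fourier1 (F n)).
- by rewrite ffF; apply: L2_affine => //; apply: locally_constant_L2; exact: locally_constant_invF.
- have d4 : 0 < d / 4 by rewrite divr_gt0.
  have [N HN] := small _ d4; exists N => m n Nm Nn; rewrite isoB lte_fin.
  have LBm := L2B Lf (LF m); have LBn := L2B Lf (LF n).
  have -> : (fun x => F m x - F n x) = (fun x => (f x - F n x) + (-1) * (f x - F m x)).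
    by apply/funext => x; ring.
  apply: le_lt_trans (nrmD_le LBn (L2Z (-1) LBm) ltr01) _.
  rewrite nrmZ// normc_oppr Normc.normc1 expr1n mul1r invr1.
  by have := HN m Nm; have := HN n Nn; lra.
exists g; split; first exact/cLfun2P.
exists F; split.
- move=> n; split; last exact/cLfun2P.
  by apply/cLfun1_cintegrable; exact: locally_constant_cintegrable.
- apply/cLnorm2_cvg0 => e e0; have [N HN] := small _ e0; exists N => n Nn.
  by rewrite (L2_fin (L2B (LF n) Lf)) nrm_subC lte_fin; exact: HN.
- exact/cLnorm2_cvg0.
Qed.

Lemma fourierP f : L2 mu f -> is_fourier mu chi f (fourier mu chi f).
Proof. by move=> /fourier_exists[g Hg]; exact: (xgetPex _ (ex_intro _ g Hg)). Qed.

Lemma fourier_L2 f : L2 mu f -> L2 mu (fourier mu chi f).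
Proof. by move=> /fourierP[/cLfun2P]. Qed.

Lemma fourier_pairing f F : L2 mu f -> locally_constant F ->
  inner mu f (invF F) = inner mu (fourier mu chi f) F.
Proof. by move=> Lf; apply: is_fourier_pairing => //; exact: fourierP. Qed.

(** * Coefficients of the affine system on the Fourier side *)

Local Notation aff := (affine p varpi eps).

Lemma qR_gt0 : 0 < q%:R :> R. Proof. by rewrite ltr0n q_gt0. Qed.

Lemma powR_half_sq (j : int) : (q%:R `^ (j%:~R / 2) : R) ^+ 2 = q%:R ^ j.
Proof.
rewrite -powR_mulrn ?powR_ge0// -powRrM mulfVK ?pnatr_eq0//.
by rewrite powR_intmul// ltW// qR_gt0.
Qed.

Lemma affineE (psi : K -> R[i]) j k x : aff psi j k x =
  (q%:R `^ (j%:~R / 2))%:C%C * psi (varpi ^ (- j) * x + - u k).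
Proof. by rewrite /affine -qE. Qed.

Lemma L2_aff psi j k : L2 mu psi -> L2 mu (aff psi j k).
Proof.
move=> Lp; rewrite (funext (affineE psi j k)); apply: L2Z.
by apply: L2_affine => //; exact: expz_varpi_neq0.
Qed.

Lemma nrm_aff psi j k : L2 mu psi -> nrm mu (aff psi j k) = nrm mu psi.
Proof.
move=> Lp; have v0 := expz_varpi_neq0 (- j).
rewrite (funext (affineE psi j k)) nrmZ; last exact: L2_affine.
rewrite /nrm sqI_affine//; last exact: L2_meas Lp.
rewrite (L2_fin Lp) -EFinM /= normc_real ger0_norm ?powR_ge0// powR_half_sq.
rewrite abs_exprz abs_varpi_exprz opprK mulrA mulfV ?mul1r//.
by rewrite expfz_neq0// gt_eqF// qR_gt0.
Qed.

Lemma locally_constant_scale F (j : int) : locally_constant F ->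
  locally_constant (fun xi => F (varpi ^ j * xi)).
Proof.
move=> [n [N [Fi Fs]]]; exists (n + `|j|)%N, (N + `|j|)%N; split => x.
  move=> z nz; rewrite mulrDr Fi// -[n%:Z](subrK j); apply/frac_ideal_scale.
  by apply: frac_ideal_sub nz; lia.
move=> Nx; apply: Fs; rewrite -[- N%:Z](subrK j) => /frac_ideal_scale h.
by apply: Nx; apply: frac_ideal_sub h; lia.
Qed.

Lemma invF_scale F (j : int) k y : locally_constant F ->
  invF F (varpi ^ j * (y + u k)) =
  invF (fun eta => (abs varpi ^ (- j))%:C%C * (F (varpi ^ (- j) * eta) * chi (u k * eta))) y.
Proof.
move=> lF; set x := varpi ^ j * _; have v0 := expz_varpi_neq0 (- j).
have := @cintegral_affine (varpi ^ (- j)) 0 _ v0 (cintegrable_mulchi x lF).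
rewrite abs_exprz invr_expz opprK => h.
have w0 : (abs varpi ^ (- j))%:C%C * (abs varpi ^ j)%:C%C = 1 :> R[i].
  by rewrite -rmorphM /= -expfzDr ?addNr ?expr0z// gt_eqF// abs_varpi_gt0.
rewrite invFZ; last by apply: locally_constant_mulchi; exact: locally_constant_scale.
rewrite [LHS]/invF -[LHS]mul1r -w0 -mulrA -h; congr (_ * _).
apply: eq_cintegral => eta; rewrite addr0 -mulrA -chiD; congr (_ * chi _).
by rewrite /x mulrA [varpi ^ j * _]mulrC -[_ * varpi ^ j * _]mulrA -expfzDr ?varpi_neq0// subrr mulr1 mulrDl addrC.
Qed.

(** Moving the dilation and the translation from psi to invF F turns them into a dilation of F
and a factor chi (u k .); then psi is paired with an inverse transform. *)
Lemma coefficient_sq F psi j k : L2 mu psi -> locally_constant F ->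
  normc (inner mu (invF F) (aff psi j k)) ^+ 2 =
  q%:R ^ j * normc (cintegral mu (fun eta =>
     F (varpi ^ (- j) * eta) * conjc (fourier mu chi psi eta) * chi (u k * eta))) ^+ 2.
Proof.
move=> Lp lF; have v0 := expz_varpi_neq0 (- j).
set F' := fun eta => F (varpi ^ (- j) * eta) * chi (u k * eta).
have lF' : locally_constant F' by apply: locally_constant_mulchi; exact: locally_constant_scale.
have lwF' := locally_constantZ (abs varpi ^ (- j))%:C%C lF'.
have LI := locally_constant_L2 (locally_constant_invF lwF').
have cI := L2_mulJ LI Lp.
have -> : inner mu (invF F) (aff psi j k) =
   (q%:R `^ (j%:~R / 2))%:C%C * ((abs varpi ^ j)%:C%C *
     inner mu (invF (fun eta => (abs varpi ^ (- j))%:C%C * F' eta)) psi).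
  have := @cintegral_affine (varpi ^ (- j)) (- u k) _ v0 cI.
  rewrite abs_exprz invr_expz opprK => <-.
  rewrite -cintegralZ; last exact: (cintegrable_affine (- u k) v0 cI).
  apply: eq_cintegral => x; rewrite affineE conjcM conjc_real.
  have -> : invF F x = invF (fun eta => (abs varpi ^ (- j))%:C%C * F' eta) (varpi ^ (- j) * x - u k).
    by rewrite -invF_scale// subrK [varpi ^ j * _]mulrA -expfzDr ?varpi_neq0// subrr mul1r.
  ring.
rewrite (innerJ Lp LI) fourier_pairing// -innerJ; last 2 first.
- exact: fourier_L2.
- exact: locally_constant_L2.
rewrite innerZl; [|exact: locally_constant_L2|exact: fourier_L2].
rewrite !Normc.normcM !normc_real !exprMn.
rewrite !ger0_norm ?powR_ge0 ?exprz_ge0 ?abs_ge0// powR_half_sq.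
rewrite [X in _ * X]mulrA -exprMn -expfzDr ?gt_eqF ?abs_varpi_gt0// subrr expr0z expr1n mul1r.
by congr (_ * normc _ ^+ 2); apply: eq_cintegral => eta; rewrite /F' mulrAC.
Qed.

(** * Periodization *)

Notation D := (cball 0 0).

Lemma cball00E x : D x = frac_ideal 0 x. Proof. by rewrite /cball /= subr0. Qed.

Lemma coset_partition (N : nat) x : frac_ideal (- N%:Z) x ->
  \sum_(s < q ^ N) \1_(cball (u s) 0) x = 1 :> R.
Proof.
move=> /coset_rep_cover[n nN Hn]; rewrite (bigD1 (Ordinal nN))//= big1 ?addr0.
  by rewrite indicE mem_set.
move=> s sn; rewrite indicE cballE; case: asboolP => // Hs; case/eqP: sn.
apply/val_inj/coset_rep_uniq => /=; have -> : u s - u n = (x - u n) - (x - u s) by ring.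
by apply: frac_idealD => //; exact: frac_idealN.
Qed.

Lemma indic_shift a x : \1_(cball a 0) (x + a) = \1_D x :> R.
Proof. by rewrite !indicE !cballE subr0 addrK. Qed.

Lemma integral_fold (N : nat) (g : borel K -> R) : measurable_fun setT g ->
  (forall x, 0 <= g x) -> (forall x, ~ frac_ideal (- N%:Z) x -> g x = 0) ->
  (\int[mu]_x (g x)%:E = \sum_(s < q ^ N) \int[mu]_x (\1_D x * g (x + u s)%R)%:E)%E.
Proof.
move=> mg g0 gs.
have mi (s : nat) : measurable_fun setT (fun x : borel K => (\1_(cball (u s) 0) x * g x)%:E).
  apply/measurable_EFinP; apply: measurable_funM => //.
  exact: measurable_indic (measurable_cball _ _).
have i0 (s : nat) (x : borel K) : (0 <= (\1_(cball (u s) 0) x * g x)%:E)%E.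
  by rewrite lee_fin mulr_ge0// indicE.
transitivity (\int[mu]_x (\sum_(s < q ^ N) (\1_(cball (u s) 0) x * g x)%:E))%E.
  apply: eq_integral => x _; rewrite sumEFin -mulr_suml.
  have [Nx|/gs ->] := pselect (frac_ideal (- N%:Z) x); last by rewrite mulr0.
  by rewrite coset_partition// mul1r.
rewrite ge0_integral_sum//; apply: eq_bigr => s _.
have := @ge0_integral_affine 1 (u s) _ (oner_neq0 _) (mi s) (i0 s).
rewrite abs1 invr1 mul1e => <-; apply: eq_integral => x _.
by rewrite mul1r indic_shift.
Qed.

Lemma cintegral_fold (N : nat) (g : K -> R[i]) : cintegrable mu g ->
  (forall x, ~ frac_ideal (- N%:Z) x -> g x = 0) ->
  cintegral mu g = \sum_(s < q ^ N) cintegral mu (fun x => cindic D x * g (x + u s)).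
Proof.
move=> cg gs.
have ci (s : nat) : cintegrable mu (fun x => cindic (cball (u s) 0) x * g x).
  apply: (@cintegrable_bounded_mul _ _ 1) => //; last by move=> x; exact: cindic_normc_le1.
  exact: cmeasurable_indic (measurable_cball _ _).
transitivity (cintegral mu (fun x => \sum_(s < q ^ N) cindic (cball (u s) 0) x * g x)).
  apply: eq_cintegral => x; rewrite -mulr_suml.
  have [Nx|/gs ->] := pselect (frac_ideal (- N%:Z) x); last by rewrite mulr0.
  by rewrite /cindic -rmorph_sum /= coset_partition// mul1r.
rewrite cintegral_sum//; apply: eq_bigr => s _.
have := @cintegral_affine 1 (u s) _ (oner_neq0 _) (ci s).
rewrite abs1 invr1 mul1r => <-; apply: eq_cintegral => x.
by rewrite mul1r /cindic indic_shift.
Qed.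

(** The D-periodization of a function supported in varpi^(-N) D, restricted to D. *)
Definition periodization (N : nat) (G : K -> R[i]) (x : K) : R[i] :=
  \sum_(s < q ^ N) cindic D x * G (x + u s).

Lemma L2_indic_mul f A : L2 mu f -> measurable (A : set (borel K)) -> L2 mu (fun x => cindic A x * f x).
Proof.
move=> Lf mA; apply: (@L2_mul_bounded _ _ _ _ _ 1) => //.
- exact: cmeasurable_indic.
- by move=> x; exact: cindic_normc_le1.
Qed.

Lemma L2_translate f a : L2 mu f -> L2 mu (fun x => f (x + a)).
Proof. by move=> /(@L2_affine 1 a _ (oner_neq0 _)); under eq_fun do rewrite mul1r. Qed.

Lemma L2_periodization N G : L2 mu G -> L2 mu (periodization N G).
Proof.
move=> LG; apply: L2_sum => s; apply: L2_indic_mul (measurable_cball _ _).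
exact: L2_translate.
Qed.

Lemma sqI_conj f : sqI mu (fun x => conjc (f x)) = sqI mu f.
Proof. by apply: eq_integral => x _; rewrite normc_conj. Qed.

Lemma L2J f : L2 mu f -> L2 mu (fun x => conjc (f x)).
Proof. by move=> Lf; split; [exact: cmeasurableJ (L2_meas Lf)|rewrite sqI_conj; case: Lf]. Qed.

(** Since chi (u k * u s) = 1, the integral of G against chi (u k .) equals that of its
periodization over D, where Parseval's identity applies. *)
Lemma parseval_periodization (N : nat) G : L2 mu G ->
  (forall x, ~ frac_ideal (- N%:Z) x -> G x = 0) ->
  \esum_(k in [set: nat]) (normc (cintegral mu (fun eta => G eta * chi (u k * eta))) ^+ 2)%:E =
  sqI mu (periodization N G).
Proof.
move=> LG Gs; have LP := L2_periodization N LG; have LPJ := L2J LP.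
rewrite -sqI_conj (L2_fin LPJ) -(parseval_integers LPJ); last first.
  move=> x Dx; rewrite /periodization big1 ?conjc0// => s _.
  by rewrite cindicE memNset ?mul0r// cball00E.
apply: eq_esum => k _; congr ((_ ^+ 2)%:E).
have LGc : cintegrable mu (fun eta => G eta * chi (u k * eta)).
  have LB : L2 mu (fun x => cindic (cball 0 (- N%:Z)) x * chi (- u k * x)).
    by apply: locally_constant_L2; apply: locally_constant_mulchi; exact: locally_constant_cball.
  have := L2_mulJ LG LB; congr cintegrable; apply/funext => x.
  rewrite conjcM cindicJ conj_chi -mulNr opprK.
  have [nx|/Gs ->] := pselect (frac_ideal (- N%:Z) x); last by rewrite !mul0r.
  by rewrite cindicE mem_set ?mul1r// /cball /= subr0.
have -> : cintegral mu (fun eta => G eta * chi (u k * eta)) =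
   cintegral mu (fun x => periodization N G x * (cindic D x * chi (u k * x))).
  rewrite (cintegral_fold (N := N) LGc); last by move=> x /Gs ->; rewrite mul0r.
  rewrite -cintegral_sum; last first.
    move=> s; apply: (@cintegrable_bounded_mul _ _ 1).
    - exact: cmeasurable_indic (measurable_cball _ _).
    - by move=> x; exact: cindic_normc_le1.
    - by have := @cintegrable_affine 1 (u s) _ (oner_neq0 _) LGc; under eq_fun do rewrite mul1r.
  apply: eq_cintegral => x; rewrite /periodization mulr_suml; apply: eq_bigr => s _.
  rewrite mulrDr chiD chi_coset_rep mulr1 -[in LHS]cindic_sq; ring.
rewrite -normc_conj -cintegralJ; last first.
  by have := L2_mulJ LP (L2J (integer_char_L2 k)); under eq_fun do rewrite conjcK.
by congr normc; apply: eq_cintegral => x; rewrite conjcM.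
Qed.

(** * The energy at one scale *)

(** By coefficient_sq, the contribution of scale j to the frame sum of the function with
transform F. *)
Definition energy (h F : K -> R[i]) (j : int) : \bar R :=
  \esum_(k in [set: nat]) (q%:R ^ j * normc (cintegral mu (fun eta =>
     F (varpi ^ (- j) * eta) * conjc (h eta) * chi (u k * eta))) ^+ 2)%:E.

Definition diagonal_energy (h F : K -> R[i]) (j : int) : \bar R :=
  sqI mu (fun xi => F xi * h (varpi ^ j * xi)).

Lemma locally_constant_bounded F : locally_constant F -> exists C : R, forall x, normc (F x) <= C.
Proof.
move=> [n [N [Fi Fs]]]; exists (\sum_(k < q ^ (n + N)) normc (F (varpi ^+ n * u k))) => x.
have [Nx|/Fs ->] := pselect (frac_ideal (- N%:Z) x); last first.
  by rewrite Normc.normc0 sumr_ge0// => k _; exact: normc_ge0.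
have [k kN Hk] := ball_cover n Nx.
have -> : F x = F (varpi ^+ n * u (Ordinal kN)) by rewrite -[RHS](Fi _ _ Hk) addrC subrK.
rewrite (bigD1 (Ordinal kN))//= lerDl sumr_ge0// => l _; exact: normc_ge0.
Qed.

Lemma L2_mul_lc F h : locally_constant F -> L2 mu h -> L2 mu (fun x => F x * h x).
Proof.
move=> lF Lh; have [C HC] := locally_constant_bounded lF.
apply: (L2_mul_bounded _ HC Lh); exact: L2_meas (locally_constant_L2 lF).
Qed.

Lemma L2_scale h (a : K) : a != 0 -> L2 mu h -> L2 mu (fun x => h (a * x)).
Proof. by move=> a0 /(@L2_affine a 0 _ a0); under eq_fun do rewrite addr0. Qed.

Lemma energy_periodization h F j (N : nat) : L2 mu h -> locally_constant F ->
  (forall x, ~ frac_ideal (- N%:Z) x -> F (varpi ^ (- j) * x) = 0) ->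
  energy h F j = ((q%:R ^ j)%:E *
    sqI mu (periodization N (fun eta => F (varpi ^ (- j) * eta) * conjc (h eta))%R))%E.
Proof.
move=> Lh lF Fs.
have LG : L2 mu (fun eta => F (varpi ^ (- j) * eta) * conjc (h eta)).
  by apply: L2_mul_lc (L2J Lh); exact: locally_constant_scale.
rewrite -parseval_periodization//; last by move=> x /Fs ->; rewrite mul0r.
rewrite /energy; under eq_esum do rewrite EFinM.
rewrite -!nneseries_esumT ?nneseriesZl// => k *; rewrite -?EFinM lee_fin ?mulr_ge0 ?sqr_ge0//.
all: by rewrite ?normc_ge0// exprz_ge0// ltW// qR_gt0.
Qed.

Lemma sum_residue_class (V : zmodType) (H : nat -> V) (d m v : nat) : (v < d)%N ->
  \sum_(s < m) H (d * s + v)%N = \sum_(0 <= n < d * m | (n %% d == v)%N) H n.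
Proof.
move=> vd; have d0 : (0 < d)%N by exact: leq_ltn_trans vd.
elim: m => [|m IH]; first by rewrite big_ord0 muln0 big_geq.
rewrite big_ord_recr /= IH [RHS](@big_cat_nat _ _ _ (d * m)%N) ?leq_pmul2l//= mulnS.
congr (_ + _); rewrite -{2}[(d * m)%N]add0n big_addn addnK big_mkord.
rewrite (big_pred1 (Ordinal vd)) /=; first by rewrite addnC.
by move=> i /=; rewrite addnC [(d * m)%N]mulnC modnMDl modn_small.
Qed.

Lemma sum_sq_classes (H : nat -> R[i]) (d m : nat) : (0 < d)%N ->
  (forall n, (m <= n)%N -> H n = 0) ->
  (\sum_(v < d) normc (\sum_(s < m) H (d * s + v)%N) ^+ 2)%:C%C =
  \sum_(n < m) H n * conjc (H n) +
  \sum_(n < m) \sum_(n' < m | (n' != n) && (n %% d == n' %% d)%N) H n * conjc (H n').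
Proof.
move=> d0 H0.
have E (v : 'I_d) : \sum_(s < m) H (d * s + v)%N = \sum_(n < m | (n %% d == v)%N) H n.
  rewrite sum_residue_class// (@big_cat_nat _ _ _ m)//=; last by rewrite leq_pmull.
  rewrite [X in _ + X]big1_seq ?addr0 ?big_mkord// => n /andP[_].
  by rewrite mem_index_iota => /andP[mn _]; exact: H0.
rewrite rmorph_sum /=.
transitivity (\sum_(v < d) \sum_(n < m | (n %% d == v)%N) \sum_(n' < m | (n' %% d == v)%N) H n * conjc (H n')).
  apply: eq_bigr => v _; rewrite -mulcJ E rmorph_sum mulr_suml.
  by apply: eq_bigr => n _; rewrite mulr_sumr.
rewrite (exchange_big_dep xpredT)//= -big_split; apply: eq_bigr => n _ /=.
have nd : (n %% d < d)%N by rewrite ltn_mod.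
rewrite (big_pred1 (Ordinal nd)); last first.
  by move=> v; apply/eqP/eqP => [e|->//]; apply/val_inj.
rewrite (bigD1 n)//=; congr (_ + _); apply: eq_bigl => n'.
by rewrite andbC [(n' %% d)%N == _]eq_sym.
Qed.

Definition pair_integral (h : K -> R[i]) (j n n' : nat) : R[i] := cintegral mu (fun x =>
  cindic D x * (conjc (h (varpi ^+ j * (x + u n))) * h (varpi ^+ j * (x + u n')))).

Definition off_energy (h F : K -> R[i]) (m j : nat) : R[i] :=
  \sum_(n < m) \sum_(n' < m | (n' != n) && (n %% q ^ j == n' %% q ^ j)%N)
    F (u n) * conjc (F (u n')) * pair_integral h j n n'.

Lemma level0_value N F x n : level 0 N F -> frac_ideal 0 x -> F (x + u n) = F (u n).
Proof. by move=> [Fi _] Dx; rewrite addrC Fi. Qed.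

Lemma coset_rep_outside N n : (q ^ N <= n)%N -> ~ frac_ideal (- N%:Z) (u n).
Proof.
move=> Nn /coset_rep_cover[k kN /coset_rep_uniq nk].
by move: Nn; rewrite nk leqNgt kN.
Qed.

Lemma L2_sample h (j n : nat) : L2 mu h -> L2 mu (fun x => h (varpi ^+ j * (x + u n))).
Proof.
move=> Lh; have := @L2_affine (varpi ^+ j) (varpi ^+ j * u n) h _ Lh.
by under eq_fun do rewrite -mulrDr; apply; rewrite expf_neq0// varpi_neq0.
Qed.

Lemma cintegrable_pair h j n n' : L2 mu h -> cintegrable mu (fun x =>
  cindic D x * (conjc (h (varpi ^+ j * (x + u n))) * h (varpi ^+ j * (x + u n')))).
Proof.
move=> Lh; apply: (@cintegrable_bounded_mul _ _ 1).
- exact: cmeasurable_indic (measurable_cball _ _).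
- by move=> x; exact: cindic_normc_le1.
- have := L2_mulJ (L2_sample j n' Lh) (L2_sample j n Lh).
  by congr cintegrable; apply/funext => x; rewrite mulrC.
Qed.

(** At eta = varpi^j (x + u v) with x in D and v < q^j, the periodization adds up F (u n) over
the n congruent to v modulo q^j. Expanding its square couples the pairs congruent modulo
q^j. *)
Lemma energy_nonneg_scale h F N (j : nat) : L2 mu h -> level 0 N F ->
  energy h F j%:Z = (diagonal_energy h F j%:Z + (Re (off_energy h F (q ^ N) j))%:E)%E.
Proof.
move=> Lh lF; have [Fi Fs] := lF; have lcF : locally_constant F by exists 0%N, N.
have v0 : varpi ^+ j != 0 by rewrite expf_neq0// varpi_neq0.
have FsJ x : ~ frac_ideal (- N%:Z) x -> F (varpi ^ (- j%:Z) * x) = 0.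
  move=> Nx; apply: Fs => h'; apply: Nx.
  have : frac_ideal (- N%:Z + j%:Z) (varpi ^ j%:Z * (varpi ^ (- j%:Z) * x)) by apply/frac_ideal_scale.
  rewrite mulrA -expfzDr ?varpi_neq0// subrr mul1r; apply: frac_ideal_sub; lia.
rewrite (energy_periodization Lh lcF FsJ).
pose G eta := F (varpi ^ (- j%:Z) * eta) * conjc (h eta).
have LG : L2 mu G by apply: L2_mul_lc (L2J Lh); exact: locally_constant_scale.
have LP := L2_periodization N LG.
pose Hx x n := F (u n) * conjc (h (varpi ^+ j * (x + u n))).
have H0 x n : (q ^ N <= n)%N -> Hx x n = 0.
  by move=> Nn; rewrite /Hx Fs ?mul0r//; exact: coset_rep_outside.
have qj0 : (0 < q ^ j)%N by rewrite expn_gt0 q_gt0.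
have PE x (v : nat) : frac_ideal 0 x -> (v < q ^ j)%N ->
    periodization N G (varpi ^+ j * (x + u v)) = \sum_(s < q ^ N) Hx x (q ^ j * s + v)%N.
  move=> Dx vj; apply: eq_bigr => s _.
  have -> : cindic D (varpi ^+ j * (x + u v)) = 1 :> R[i].
    rewrite cindicE mem_set// cball00E -(addNr j%:Z); apply/frac_ideal_shift.
    apply: frac_idealD; first by apply: frac_ideal_sub Dx; lia.
    exact: coset_rep_bound.
  rewrite mul1r /G /Hx coset_rep_shift//.
  have -> : varpi ^+ j * (x + u v) + u s = varpi ^+ j * (x + (varpi ^- j * u s + u v)).
    by rewrite !mulrDr mulrA mulfV// mul1r; ring.
  rewrite -[in F _]exprnN mulKf//.
  congr (_ * _); rewrite -[in RHS]coset_rep_shift// -(@level0_value N F x (q ^ j * s + v))//.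
  by rewrite coset_rep_shift.
have iE : ((q%:R ^ j%:Z)%:E * sqI mu (periodization N G) =
   \int[mu]_x (\sum_(v < q ^ j) \1_D x * normc (periodization N G (varpi ^+ j * (x + u v))) ^+ 2)%:E)%E.
  pose g (x : borel K) := normc (periodization N G (varpi ^+ j * x + 0)) ^+ 2.
  have mg : measurable_fun setT g.
    by apply: cmeasurable_normc2; exact: cmeasurable_affine (L2_meas LP).
  have := @sqI_affine (varpi ^+ j) 0 _ v0 (L2_meas LP).
  rewrite absX abs_varpiE -exprVn invrK => <-.
  rewrite [LHS](@integral_fold j g)//; last 2 first.
  - by move=> x; exact: sqr_ge0.
  - move=> x jx; rewrite /g addr0 /periodization big1 ?Normc.normc0 ?expr0n// => s _.
    rewrite cindicE memNset ?mul0r// cball00E -(addNr j%:Z) => /frac_ideal_shift; exact: jx.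
  under [RHS]eq_integral do rewrite -sumEFin.
  rewrite ge0_integral_sum//.
  - by apply: eq_bigr => v _; apply: eq_integral => x _; rewrite /g addr0.
  - move=> v; apply/measurable_EFinP; apply: measurable_funM.
      exact: measurable_indic (measurable_cball _ _).
    apply: cmeasurable_normc2.
    have := @cmeasurable_affine (varpi ^+ j) (varpi ^+ j * u v) _ (L2_meas LP).
    by under eq_fun do rewrite -mulrDr.
  - by move=> v x _; rewrite lee_fin mulr_ge0 ?indicE ?sqr_ge0.
have {}iE := iE.
rewrite iE /diagonal_energy.
pose T (x : K) : R[i] := \sum_(n < q ^ N) (F (u n) * conjc (F (u n))) *
   (cindic D x * (conjc (h (varpi ^+ j * (x + u n))) * h (varpi ^+ j * (x + u n)))).
pose O (x : K) : R[i] := \sum_(n < q ^ N) \sum_(n' < q ^ N | (n' != n) && (n %% q ^ j == n' %% q ^ j)%N)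
  (F (u n) * conjc (F (u n'))) * (cindic D x * (conjc (h (varpi ^+ j * (x + u n))) * h (varpi ^+ j * (x + u n')))).
have cT : cintegrable mu T by apply: cintegrable_sum => n; apply: cintegrableZ; exact: cintegrable_pair.
have cO : cintegrable mu O.
  by apply: cintegrable_sum => n; apply: cintegrable_sum => n'; apply: cintegrableZ; exact: cintegrable_pair.
have TOE (x : K) : \sum_(v < q ^ j) \1_D x * normc (periodization N G (varpi ^+ j * (x + u v))) ^+ 2 =
    Re (T x + O x).
  have [Dx|ND] := pselect (frac_ideal 0 x); last first.
    have c0 : cindic D x = 0 :> R[i] by rewrite cindicE memNset// cball00E.
    rewrite big1; last by move=> v _; rewrite indicE memNset ?mul0r// cball00E.
    rewrite /T /O big1 ?add0r; last by move=> n _; rewrite c0 mul0r mulr0.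
    by rewrite big1// => n _; rewrite big1// => n' _; rewrite c0 mul0r mulr0.
  have c1 : cindic D x = 1 :> R[i] by rewrite cindicE mem_set// cball00E.
  transitivity (Re (\sum_(v < q ^ j) normc (\sum_(s < q ^ N) Hx x (q ^ j * s + v)%N) ^+ 2)%:C%C).
    by apply: eq_bigr => v _; rewrite indicE mem_set ?cball00E// mul1r PE.
  rewrite sum_sq_classes; [|exact: qj0|exact: H0].
  congr Re; congr (_ + _); apply: eq_bigr => n _.
    by rewrite /Hx c1 mul1r conjcM conjcK; ring.
  by apply: eq_bigr => n' _; rewrite /Hx c1 mul1r conjcM conjcK; ring.
have -> : (\int[mu]_x (\sum_(v < q ^ j) \1_D x * normc (periodization N G (varpi ^+ j * (x + u v))) ^+ 2)%:E)%E
   = (Re (cintegral mu (fun x => T x + O x)))%:E.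
  rewrite (eq_integral (fun x : borel K => (Re (T x + O x))%:E)); last by move=> x _; rewrite TOE.
  have [i1 _] := cintegrableD cT cO.
  by rewrite /cintegral /= /Rintegral fineK//; exact: integrable_fin_num.
rewrite cintegralD// ReD EFinD; congr (_ + (Re _)%:E)%E; last first.
  rewrite cintegral_sum; last by move=> n; apply: cintegrable_sum => n'; apply: cintegrableZ; exact: cintegrable_pair.
  apply: eq_bigr => n _; rewrite cintegral_sum; last by move=> n'; apply: cintegrableZ; exact: cintegrable_pair.
  by apply: eq_bigr => n' _; rewrite cintegralZ//; exact: cintegrable_pair.
have LS : L2 mu (fun xi => F xi * h (varpi ^ j%:Z * xi)).
  by apply: L2_mul_lc => //; apply: L2_scale => //; exact: expz_varpi_neq0.
rewrite (L2_fin LS); congr EFin.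
rewrite -[RHS]/(Re (nrm mu (fun xi => F xi * h (varpi ^ j%:Z * xi)))%:C%C) -inner_nrm//; congr Re.
rewrite /T /inner (cintegral_fold (N := N) (L2_mulJ LS LS)); last by move=> x /Fs ->; rewrite !mul0r.
rewrite cintegral_sum; last by move=> n; apply: cintegrableZ; exact: cintegrable_pair.
apply: eq_bigr => n _; apply: eq_cintegral => x.
have [Dx|ND] := pselect (frac_ideal 0 x); last first.
  by have -> : cindic D x = 0 :> R[i]; [rewrite cindicE memNset// cball00E|rewrite !mul0r mulr0].
by rewrite (level0_value n lF Dx) conjcM -exprnP; ring.
Qed.

(** * Negative scales *)

Lemma sum_by_residues (V : zmodType) (H : nat -> V) (d m : nat) : (0 < d)%N ->
  \sum_(n < d * m) H n = \sum_(v < d) \sum_(s < m) H (d * s + v)%N.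
Proof.
move=> d0; transitivity (\sum_(v < d) \sum_(n < d * m | (n %% d == v)%N) H n); last first.
  by apply: eq_bigr => v _; rewrite sum_residue_class// big_mkord.
rewrite (exchange_big_dep xpredT)//=; apply: eq_bigr => n _.
have nd : (n %% d < d)%N by rewrite ltn_mod.
by rewrite (big_pred1 (Ordinal nd)).
Qed.

Definition support_card (F : K -> R[i]) (m : nat) : R := \sum_(n < m) (F (u n) != 0)%:R.

Lemma support_card_ge0 F m : 0 <= support_card F m.
Proof. by apply: sumr_ge0 => n _; rewrite ler0n. Qed.

Lemma support_card_scale F N (i : nat) : level 0 N F ->
  \sum_(s < q ^ (N + i)) (F (varpi ^+ i * u s) != 0)%:R = (q ^ i)%:R * support_card F (q ^ N) :> R.
Proof.
move=> lF; have qi0 : (0 < q ^ i)%N by rewrite expn_gt0 q_gt0.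
have -> : (q ^ (N + i) = q ^ i * q ^ N)%N by rewrite addnC expnD.
rewrite (sum_by_residues (fun s => (F (varpi ^+ i * u s) != 0)%:R : R))//.
rewrite (eq_bigr (fun=> support_card F (q ^ N))); first by rewrite sumr_const card_ord mulr_natl.
move=> v _; apply: eq_bigr => s _; rewrite coset_rep_shift//.
have -> : varpi ^+ i * (varpi ^- i * u s + u v) = varpi ^+ i * u v + u s.
  by rewrite mulrDr mulrA mulfV ?expf_neq0 ?varpi_neq0// mul1r addrC.
rewrite (level0_value s lF)//.
by rewrite -(addNr i%:Z); apply/frac_ideal_shift; exact: coset_rep_bound.
Qed.

Lemma sqI_fold (N : nat) G : L2 mu G -> (forall x, ~ frac_ideal (- N%:Z) x -> G x = 0) ->
  (sqI mu G = \int[mu]_x (\sum_(s < q ^ N) \1_D x * normc (G (x + u s)%R) ^+ 2)%:E)%E.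
Proof.
move=> LG Gs; rewrite /sqI (@integral_fold N (fun x => normc (G x) ^+ 2))//; last 3 first.
- by apply: cmeasurable_normc2; exact: L2_meas LG.
- by move=> x; exact: sqr_ge0.
- by move=> x /Gs ->; rewrite Normc.normc0 expr0n.
under [RHS]eq_integral do rewrite -sumEFin.
rewrite ge0_integral_sum//.
- move=> s; apply/measurable_EFinP; apply: measurable_funM.
    exact: measurable_indic (measurable_cball _ _).
  by apply: cmeasurable_normc2; exact: L2_meas (L2_translate (u s) LG).
- by move=> s x _; rewrite lee_fin mulr_ge0 ?indicE ?sqr_ge0.
Qed.

(** The function F (varpi^i .) is constant on the cosets of D, so for each x in D at most q^i
times support_card F terms of the periodization are nonzero. Cauchy-Schwarz costs this
factor, and the normalization of the energy compensates q^i. *)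
Lemma energy_negative_scale h F N (i : nat) : L2 mu h -> level 0 N F ->
  (energy h F (- i%:Z) <= (support_card F (q ^ N))%:E *
     sqI mu (fun eta => F (varpi ^+ i * eta) * h eta)%R)%E.
Proof.
move=> Lh lF; have [Fi Fs] := lF; have lcF : locally_constant F by exists 0%N, N.
have FsJ x : ~ frac_ideal (- (N + i)%N%:Z) x -> F (varpi ^ (- - i%:Z) * x) = 0.
  move=> Nx; rewrite opprK; apply: Fs => h'; apply: Nx.
  by move: h'; rewrite -[- N%:Z](subrK i%:Z) => /(@frac_ideal_scale _ i%:Z); congr frac_ideal; lia.
rewrite (energy_periodization Lh lcF FsJ); set G := (fun eta => _); pose G' eta := F (varpi ^+ i * eta) * conjc (h eta).
have LG : L2 mu G'.
  by have := L2_mul_lc (locally_constant_scale i%:Z lcF) (L2J Lh).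
have -> : G = G'.
  by apply/funext => x; rewrite /G opprK.
have Gs x : ~ frac_ideal (- (N + i)%N%:Z) x -> G' x = 0.
  by move=> /FsJ; rewrite /G' opprK -exprnP => ->; rewrite mul0r.
have -> : sqI mu (fun eta => F (varpi ^+ i * eta) * h eta)%R = sqI mu G'.
  by apply: eq_integral => x _; rewrite !Normc.normcM normc_conj.
pose A := support_card F (q ^ N); pose C := (q ^ i)%:R * A.
have C0 : 0 <= C by rewrite mulr_ge0 ?support_card_ge0.
suff : (sqI mu (periodization (N + i) G') <= C%:E * sqI mu G')%E.
  move=> /(@lee_wpmul2l _ (q%:R ^ (- i%:Z))%:E); rewrite lee_fin exprz_ge0 ?ler0n// => /(_ isT).
  move=> /le_trans; apply; rewrite muleA -EFinM /C mulrA -exprnN natrX.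
  by rewrite mulVf ?mul1r// expf_neq0// gt_eqF// qR_gt0.
rewrite (sqI_fold LG Gs) -ge0_integralZl_EFin//; last 2 first.
- by move=> x _; rewrite lee_fin sumr_ge0// => s _; rewrite mulr_ge0 ?indicE ?sqr_ge0.
- apply/measurable_EFinP; apply: measurable_sum => s; apply: measurable_funM.
    exact: measurable_indic (measurable_cball _ _).
  by apply: cmeasurable_normc2; exact: L2_meas (L2_translate (u s) LG).
apply: ge0_le_integral => //.
- by move=> x _; rewrite lee_fin sqr_ge0.
- by apply/measurable_EFinP; apply: cmeasurable_normc2; exact: L2_meas (L2_periodization _ LG).
- apply/measurable_EFinP; apply: measurable_funM => //; apply: measurable_sum => s; apply: measurable_funM.
    exact: measurable_indic (measurable_cball _ _).
  by apply: cmeasurable_normc2; exact: L2_meas (L2_translate (u s) LG).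
move=> x _; rewrite -EFinM lee_fin.
have [Dx|ND] := pselect (frac_ideal 0 x); last first.
  rewrite /periodization big1; last by move=> s _; rewrite cindicE memNset ?mul0r// cball00E.
  rewrite Normc.normc0 expr0n /= mulr_ge0// sumr_ge0// => s _.
  by rewrite mulr_ge0 ?indicE ?sqr_ge0.
rewrite /C /A -support_card_scale//.
rewrite [X in _ <= _ * X](eq_bigr (fun s : 'I_(q ^ (N + i)) => normc (cindic D x * G' (x + u s)) ^+ 2)); last first.
  by move=> s _; rewrite indicE cindicE !mem_set ?cball00E// !mul1r.
apply: normc_sum_sq => s; rewrite negbK => /eqP Fs0.
rewrite /G' mulrDr.
suff -> : F (varpi ^+ i * x + varpi ^+ i * u s) = 0 by rewrite mul0r mulr0.
rewrite addrC Fi//; apply: (@frac_ideal_sub _ (0 + i%:Z)); first by lia.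
exact/frac_ideal_shift.
Qed.

Lemma diagonal_negative_scale h F (i : nat) : L2 mu h -> locally_constant F ->
  (diagonal_energy h F (- i%:Z) <= sqI mu (fun eta => F (varpi ^+ i * eta) * h eta)%R)%E.
Proof.
move=> Lh lF; have v0 := expz_varpi_neq0 (- i%:Z).
have LG : L2 mu (fun eta => F (varpi ^+ i * eta) * h eta).
  by have := L2_mul_lc (locally_constant_scale i%:Z lF) Lh.
have := @sqI_affine (varpi ^ (- i%:Z)) 0 _ v0 (L2_meas LG).
have -> : sqI mu (fun x => F (varpi ^+ i * (varpi ^ (- i%:Z) * x + 0)) * h (varpi ^ (- i%:Z) * x + 0))
   = diagonal_energy h F (- i%:Z).
  by congr sqI; apply/funext => x; rewrite addr0 -exprnN mulVKf// expf_neq0// varpi_neq0.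
move=> ->; rewrite (L2_fin LG) -EFinM lee_fin ler_piMl ?nrm_ge0//.
by rewrite abs_exprz invr_expz opprK -exprnP exprn_ile1 ?abs_ge0// ltW// abs_varpi_lt1.
Qed.

(** * The correlations *)

Definition correlation_term (h : K -> R[i]) (s i : nat) (y : K) : R[i] :=
  h (varpi ^- i * y) * conjc (h (varpi ^- i * (y + u s))).

Lemma scaled_L2 h (i s : nat) : L2 mu h -> L2 mu (fun y => h (varpi ^- i * (y + u s))).
Proof.
move=> Lh; have v0 : varpi ^- i != 0 by rewrite invr_eq0 expf_neq0// varpi_neq0.
by have := L2_affine (varpi ^- i * u s) v0 Lh; under eq_fun do rewrite -mulrDr.
Qed.

Lemma nrm_scaled h (i s : nat) : L2 mu h ->
  nrm mu (fun y => h (varpi ^- i * (y + u s))) = q%:R^-1 ^+ i * nrm mu h.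
Proof.
move=> Lh; have v0 : varpi ^- i != 0 by rewrite invr_eq0 expf_neq0// varpi_neq0.
have := sqI_affine (varpi ^- i * u s) v0 (L2_meas Lh); under eq_fun do rewrite -mulrDr.
by rewrite /nrm => ->; rewrite absV absX invrK abs_varpiE (L2_fin Lh) -EFinM.
Qed.

Lemma cmeasurable_correlation_term h s i : L2 mu h -> cmeasurable (correlation_term h s i).
Proof.
move=> Lh; apply: cmeasurableM; last first.
  by apply: cmeasurableJ; exact: L2_meas (scaled_L2 i s Lh).
by have := L2_meas (scaled_L2 i 0 Lh); under eq_fun do rewrite coset_rep0 addr0.
Qed.

Lemma geometric_sum_le2 n : \sum_(0 <= i < n) (q%:R^-1 ^+ i : R) <= 2.
Proof.
have H m : \sum_(0 <= i < m) (2^-1 ^+ i : R) = 2 - 2 * 2^-1 ^+ m.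
  elim: m => [|m IH]; first by rewrite big_nil expr0; ring.
  by rewrite big_nat_recr//= IH exprS; field.
apply: (@le_trans _ _ (\sum_(0 <= i < n) (2^-1 ^+ i : R))).
  apply: ler_sum => i _; rewrite lerXn2r ?nnegrE ?invr_ge0 ?ler0n//.
  by rewrite lef_pV2 ?posrE ?qR_gt0// ler_nat q_gt1.
by rewrite H gerBl mulr_ge0// exprn_ge0// invr_ge0.
Qed.

(** Bound the product by half the sum of the squares; the change of variables in each of them
gives the factor q^(-i). *)
Lemma integral_correlation_term h s i : L2 mu h ->
  (\int[mu]_y (normc (correlation_term h s i y))%:E <= (q%:R^-1 ^+ i * nrm mu h)%:E)%E.
Proof.
move=> Lh; have L0 := scaled_L2 i 0 Lh; have Ls := scaled_L2 i s Lh.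
have n0 := nrm_scaled i 0 Lh; have ns := nrm_scaled i s Lh.
apply: (@le_trans _ _ (\int[mu]_y ((2^-1)%:E * (normc (h (varpi ^- i * (y + u 0))) ^+ 2)%:E +
    (2^-1)%:E * (normc (h (varpi ^- i * (y + u s))) ^+ 2)%:E))%E).
  apply: ge0_le_integral => //.
  - by move=> y _; rewrite lee_fin normc_ge0.
  - by apply/measurable_EFinP; apply: cmeasurable_normc; exact: cmeasurable_correlation_term.
  - by apply: emeasurable_funD; apply: measurable_funeM; apply/measurable_EFinP; apply: cmeasurable_normc2; [exact: L2_meas L0|exact: L2_meas Ls].
  move=> y _; rewrite -!EFinM -EFinD lee_fin coset_rep0 addr0.
  apply: le_trans (normcM_le _ _) _; rewrite normc_conj; lra.
rewrite ge0_integralD//; last 4 first.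
- by move=> x _; rewrite -EFinM lee_fin mulr_ge0// sqr_ge0.
- by apply: measurable_funeM; apply/measurable_EFinP; apply: cmeasurable_normc2; exact: L2_meas L0.
- by move=> x _; rewrite -EFinM lee_fin mulr_ge0// sqr_ge0.
- by apply: measurable_funeM; apply/measurable_EFinP; apply: cmeasurable_normc2; exact: L2_meas Ls.
rewrite !ge0_integralZl_EFin//; try (by move=> x _; rewrite lee_fin sqr_ge0);
  try (by apply/measurable_EFinP; apply: cmeasurable_normc2; exact: L2_meas L0);
  try (by apply/measurable_EFinP; apply: cmeasurable_normc2; exact: L2_meas Ls).
rewrite -![(\int[mu]_x _)%E]/(sqI mu _) (L2_fin L0) (L2_fin Ls) n0 ns -!EFinM -EFinD lee_fin; lra.
Qed.

Lemma integral_correlation_series h s : L2 mu h ->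
  (\int[mu]_y (\sum_(0 <= i <oo) (normc (correlation_term h s i y))%:E) < +oo)%E.
Proof.
move=> Lh; rewrite integral_nneseries//; last 2 first.
- by move=> i; apply/measurable_EFinP; apply: cmeasurable_normc; exact: cmeasurable_correlation_term.
- by move=> i y _; rewrite lee_fin normc_ge0.
apply: (@le_lt_trans _ _ (2 * nrm mu h)%:E); last exact: ltry.
apply: lime_le; first by apply: is_cvg_nneseries => i _ _; apply: integral_ge0 => y _; rewrite lee_fin normc_ge0.
apply: nearW => n; apply: (@le_trans _ _ (\sum_(0 <= i < n) (q%:R^-1 ^+ i * nrm mu h)%:E)%E).
  by apply: lee_sum => i _; exact: integral_correlation_term.
by rewrite sumEFin lee_fin -mulr_suml ler_wpM2r ?nrm_ge0// geometric_sum_le2.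
Qed.

(** The series t_s converges only almost everywhere. The function T is a measurable version
whose distance to the partial sums is controlled at every point. *)
Definition is_correlation (h : K -> R[i]) (s : nat) (T : K -> R[i]) :=
  [/\ cmeasurable T,
  forall x, (\sum_(0 <= i <oo) (normc (correlation_term h s i x))%:E < +oo)%E ->
    limn (series (fun i => correlation_term h s i x : R[i]^o)) = T x &
  forall m x, ((normc (T x - \sum_(0 <= i < m) correlation_term h s i x))%:E <=
    \sum_(m <= i <oo) (normc (correlation_term h s i x))%:E)%E].

Definition correlation (h : K -> R[i]) (s : nat) : K -> R[i] := xget (fun=> 0) (is_correlation h s).

Lemma correlationP h s : L2 mu h -> is_correlation h s (correlation h s).
Proof.
move=> Lh; apply: xgetPex.
by apply: absolute_series_limit => i; exact: cmeasurable_correlation_term.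
Qed.

Lemma measurable_correlation_series h s (m : nat) : L2 mu h -> measurable_fun setT
  (fun y : borel K => \sum_(m <= i <oo) (normc (correlation_term h s i y))%:E)%E.
Proof.
move=> Lh; rewrite (_ : (fun y => _) = (fun y : borel K => \sum_(i <oo) (normc (correlation_term h s (i + m) y))%:E)%E).
  apply: ge0_emeasurable_sum => // [k x _ _|k _]; first by rewrite lee_fin normc_ge0.
  by apply/measurable_EFinP; apply: cmeasurable_normc; exact: cmeasurable_correlation_term.
apply/funext => y; rewrite -(@nneseries_addn R (fun i => (normc (correlation_term h s i y))%:E))//.
by move=> i; rewrite lee_fin normc_ge0.
Qed.

Lemma cintegrable_correlation h s : L2 mu h -> cintegrable mu (correlation h s).
Proof.
move=> Lh; have [mT _ HT] := correlationP s Lh.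
apply: cintegrableP => //; apply: le_lt_trans (integral_correlation_series s Lh).
apply: ge0_le_integral => //.
- by move=> x _; rewrite lee_fin normc_ge0.
- by apply/measurable_EFinP; exact: cmeasurable_normc.
- exact: measurable_correlation_series.
- by move=> x _; have := HT 0%N x; rewrite big_nil subr0.
Qed.

Lemma ae_correlation h s : L2 mu h -> {ae mu, forall y : borel K,
  limn (series (fun i => correlation_term h s i y : R[i]^o)) = correlation h s y}.
Proof.
move=> Lh; have [mT TE _] := correlationP s Lh.
have S0 x : (0 <= \sum_(0 <= i <oo) (normc (correlation_term h s i x))%:E)%E.
  by apply: nneseries_ge0 => i _ _; rewrite lee_fin normc_ge0.
have iS : mu.-integrable setT (fun y : borel K => \sum_(0 <= i <oo) (normc (correlation_term h s i y))%:E)%E.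
  apply/integrableP; split; first exact: measurable_correlation_series.
  apply: le_lt_trans (integral_correlation_series s Lh).
  by rewrite le_eqVlt; apply/orP; left; apply/eqP; apply: eq_integral => x _; rewrite gee0_abs.
apply: filterS (integrable_ae measurableT iS) => x /(_ I) h1.
by apply: TE; rewrite -ge0_fin_numE.
Qed.

(** * Cross terms *)

(** In varpi^(-r) u s = u (q^r s), the exponent r is the multiplicity of q in the index. *)
Lemma coset_rep_pair_uniq r s r' s' : ~~ (q %| s)%N -> ~~ (q %| s')%N ->
  varpi ^- r * u s = varpi ^- r' * u s' -> r = r' /\ s = s'.
Proof.
have E k t : varpi ^- k * u t = u (q ^ k * t).
  by rewrite -[(q ^ k * t)%N]addn0 coset_rep_shift ?expn_gt0 ?q_gt0// coset_rep0 addr0.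
move=> qs qs'; rewrite !E => /coset_rep_dvd.
wlog rr : r s r' s' qs qs' / (r <= r')%N => [H|].
  by have [/H|/ltnW/H h] := leqP r r'; [apply|move=> /esym /h [] // -> ->].
rewrite -(subnK rr) addnC expnD -mulnA => /eqP; rewrite eqn_pmul2l ?expn_gt0 ?q_gt0// => /eqP se.
case: (r' - r)%N se => [|k] se; first by rewrite addn0 se expn0 mul1n.
by move: qs; rewrite se expnS -mulnA dvdn_mulr.
Qed.

Definition cross_tail (h : K -> R[i]) (n n' : nat) : \bar R :=
  (\sum_(0 <= i <oo) \int[mu]_x (\1_D x * (normc (h (varpi ^- i.+1 * (x + u n)%R)) *
     normc (h (varpi ^- i.+1 * (x + u n')%R))))%:E)%E.

Definition correlation_integral (h : K -> R[i]) (r s n : nat) : R[i] :=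
  conjc (cintegral mu (fun x => cindic D x * correlation h s (varpi ^+ r * (x + u n)))).

(** At the point varpi^r (x + u n), the i-th term of the correlation is the conjugate of the
integrand of the pair integral at scale r - i. So the first r + 1 terms give the pair
integrals, and the tail of the series is the error. *)
Lemma cross_term_estimate h n n' r s : L2 mu h -> u n' - u n = varpi ^- r * u s ->
  ((normc (correlation_integral h r s n - \sum_(j < r.+1) pair_integral h j n n'))%:E <=
   cross_tail h n n')%E.
Proof.
move=> Lh nn; have [mT _ HT] := correlationP s Lh.
have v0 k : varpi ^+ k != 0 by rewrite expf_neq0// varpi_neq0.
pose y (x : K) := varpi ^+ r * (x + u n).
have yE x : y x = varpi ^+ r * x + varpi ^+ r * u n by rewrite /y mulrDr.
have termE (i : nat) x : varpi ^- i * (y x + u s) = varpi ^- i * (varpi ^+ r * (x + u n')).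
  congr (_ * _); rewrite -(subrK (u n) (u n')) nn /y !mulrDr mulrA mulfV// mul1r; ring.
have cC : cintegrable mu (fun x => cindic D x * correlation h s (y x)).
  apply: (@cintegrable_bounded_mul _ _ 1).
  - exact: cmeasurable_indic (measurable_cball _ _).
  - by move=> x; exact: cindic_normc_le1.
  - have := cintegrable_affine (varpi ^+ r * u n) (v0 r) (cintegrable_correlation s Lh).
    by under eq_fun do rewrite -yE.
have pairE j : (j <= r)%N -> conjc (pair_integral h j n n') =
    cintegral mu (fun x => cindic D x * correlation_term h s (r - j) (y x)).
  move=> jr; rewrite -cintegralJ; last exact: cintegrable_pair.
  apply: eq_cintegral => x; rewrite !conjcM cindicJ conjcK; congr (_ * _).
  rewrite /correlation_term termE /y.
  have E z : varpi ^- (r - j) * (varpi ^+ r * z) = varpi ^+ j * z.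
    by rewrite -{2}(subnK jr) exprD -[varpi ^+ (r - j) * _ * z]mulrA mulKf.
  by rewrite !E.
have cterm i : (i <= r)%N -> cintegrable mu (fun x => cindic D x * correlation_term h s i (y x)).
  move=> ir; have := cintegrableJ (cintegrable_pair (r - i) n n' Lh).
  congr cintegrable; apply/funext => x; rewrite !conjcM cindicJ conjcK; congr (_ * _).
  rewrite /correlation_term termE /y.
  have E z : varpi ^- i * (varpi ^+ r * z) = varpi ^+ (r - i) * z.
    by rewrite -{1}(subnKC ir) exprD -[varpi ^+ i * _ * z]mulrA mulKf.
  by rewrite !E.
have -> : normc (correlation_integral h r s n - \sum_(j < r.+1) pair_integral h j n n') =
   normc (cintegral mu (fun x => cindic D x *
     (correlation h s (y x) - \sum_(0 <= i < r.+1) correlation_term h s i (y x)))).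
  rewrite -normc_conj conjcB conjcK; congr normc.
  have -> : conjc (\sum_(j < r.+1) pair_integral h j n n') = \sum_(j < r.+1) conjc (pair_integral h j n n').
    exact: rmorph_sum.
  rewrite (eq_bigr (fun j : 'I_r.+1 => cintegral mu (fun x => cindic D x * correlation_term h s (r - j) (y x)))); last first.
    by move=> j _; rewrite pairE// -ltnS.
  have -> : \sum_(j < r.+1) cintegral mu (fun x => cindic D x * correlation_term h s (r - j) (y x)) =
     \sum_(i < r.+1) cintegral mu (fun x => cindic D x * correlation_term h s i (y x)).
    rewrite (reindex_inj rev_ord_inj) /=; apply: eq_bigr => j _.
    by rewrite subKn// -ltnS.
  rewrite -cintegral_sum; last by move=> i; apply: cterm; rewrite -ltnS.
  rewrite -cintegralB//; last by apply: cintegrable_sum => i; apply: cterm; rewrite -ltnS.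
  by apply: eq_cintegral => x; rewrite big_mkord mulrBr mulr_sumr.
have cB : cintegrable mu (fun x => cindic D x *
     (correlation h s (y x) - \sum_(0 <= i < r.+1) correlation_term h s i (y x))).
  have := cintegrableD cC (cintegrableZ (-1) (cintegrable_sum (index_enum 'I_r.+1) xpredT (fun i : 'I_r.+1 => cterm i (ltn_ord i)))).
  congr cintegrable; apply/funext => x; by rewrite mulN1r big_mkord mulrBr mulr_sumr.
apply: le_trans (normc_cintegral_le cB) _.
rewrite /cross_tail -integral_nneseries//; last 2 first.
- move=> i; apply/measurable_EFinP; apply: measurable_funM.
    exact: measurable_indic (measurable_cball _ _).
  by apply: measurable_funM; apply: cmeasurable_normc; exact: L2_meas (scaled_L2 _ _ Lh).
- by move=> i x _; rewrite lee_fin !mulr_ge0 ?indicE ?normc_ge0.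
apply: ge0_le_integral => //.
- by move=> x _; rewrite lee_fin normc_ge0.
- by apply/measurable_EFinP; apply: cmeasurable_normc; exact: cintegrable_measurable cB.
- apply: ge0_emeasurable_sum => // [k x _ _|k _]; first by rewrite lee_fin !mulr_ge0 ?indicE ?normc_ge0.
  apply/measurable_EFinP; apply: measurable_funM.
    exact: measurable_indic (measurable_cball _ _).
  by apply: measurable_funM; apply: cmeasurable_normc; exact: L2_meas (scaled_L2 _ _ Lh).
move=> x _; have [Dx|ND] := pselect (frac_ideal 0 x); last first.
  rewrite cindicE memNset ?mul0r ?Normc.normc0 ?cball00E//.
  by apply: nneseries_ge0 => i _ _; rewrite lee_fin !mulr_ge0 ?indicE ?normc_ge0.
rewrite cindicE mem_set ?mul1r ?cball00E//; apply: le_trans (HT r.+1 (y x)) _.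
rewrite -(@nneseries_addn R (fun i => (normc (correlation_term h s i (y x)))%:E)); last first.
  by move=> i; rewrite lee_fin normc_ge0.
rewrite le_eqVlt; apply/orP; left; apply/eqP; apply: eq_eseriesr => i _.
rewrite indicE mem_set ?mul1r ?cball00E// /correlation_term Normc.normcM normc_conj termE /y.
have E z : varpi ^- (i + r.+1) * (varpi ^+ r * z) = varpi ^- i.+1 * z.
  rewrite addnS -addSn exprD invfM -mulrA; congr (_ * _).
  by rewrite mulKf.
by rewrite !E.
Qed.

Definition sample_tail (h : K -> R[i]) (n : nat) : \bar R :=
  (\sum_(0 <= i <oo) \int[mu]_x (\1_D x * normc (h (varpi ^- i.+1 * (x + u n)%R)) ^+ 2)%:E)%E.

Lemma measurable_sample h (i n : nat) : L2 mu h ->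
  measurable_fun setT (fun x : borel K => (\1_D x * normc (h (varpi ^- i.+1 * (x + u n)%R)) ^+ 2)%:E).
Proof.
move=> Lh; apply/measurable_EFinP; apply: measurable_funM.
  exact: measurable_indic (measurable_cball _ _).
by apply: cmeasurable_normc2; exact: L2_meas (scaled_L2 _ _ Lh).
Qed.

Lemma sample_ge0 (h : K -> R[i]) (i n : nat) (x : borel K) :
  (0 <= (\1_D x * normc (h (varpi ^- i.+1 * (x + u n)%R)) ^+ 2)%:E)%E.
Proof. by rewrite lee_fin mulr_ge0 ?indicE ?sqr_ge0. Qed.

Lemma sample_tail_ge0 h n : (0 <= sample_tail h n)%E.
Proof. by apply: nneseries_ge0 => i _ _; apply: integral_ge0 => x _; exact: sample_ge0. Qed.

Lemma sample_tail_fin h n : L2 mu h -> sample_tail h n \is a fin_num.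
Proof.
move=> Lh; rewrite ge0_fin_numE ?sample_tail_ge0//.
apply: (@le_lt_trans _ _ (2 * nrm mu h)%:E); last exact: ltry.
apply: lime_le.
  by apply: is_cvg_nneseries => i _ _; apply: integral_ge0 => x _; exact: sample_ge0.
apply: nearW => m; apply: (@le_trans _ _ (\sum_(0 <= i < m) (q%:R^-1 ^+ i.+1 * nrm mu h)%:E)%E).
  apply: lee_sum => i _; rewrite -(nrm_scaled i.+1 n Lh) -(L2_fin (scaled_L2 i.+1 n Lh)).
  apply: ge0_le_integral => //.
  - by move=> x _; exact: sample_ge0.
  - exact: measurable_sample.
  - by apply/measurable_EFinP; apply: cmeasurable_normc2; exact: L2_meas (scaled_L2 _ _ Lh).
  move=> x _; rewrite lee_fin indicE; case: (x \in _); rewrite ?mul1r// mul0r; exact: sqr_ge0.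
rewrite sumEFin lee_fin -mulr_suml ler_wpM2r ?nrm_ge0//.
apply: le_trans (geometric_sum_le2 m.+1); rewrite big_nat_recl//= lerDr.
by rewrite expr0.
Qed.

(** The inequality 2 (a s) (b t) <= (a s)^2 + (b t)^2 under the integral. The weights a and b
will be |F (u n)| and |F (u n')|. *)
Lemma cross_tail_le h n n' (a b : R) : L2 mu h -> 0 <= a -> 0 <= b ->
  ((a * b)%:E * cross_tail h n n' <=
   (2^-1 * a ^+ 2)%:E * sample_tail h n + (2^-1 * b ^+ 2)%:E * sample_tail h n')%E.
Proof.
move=> Lh a0 b0; have a2 : 0 <= 2^-1 * a ^+ 2 by rewrite mulr_ge0 ?sqr_ge0.
have b2 : 0 <= 2^-1 * b ^+ 2 by rewrite mulr_ge0 ?sqr_ge0.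
have mX i : measurable_fun setT (fun x : borel K => (\1_D x * (normc (h (varpi ^- i.+1 * (x + u n))) *
     normc (h (varpi ^- i.+1 * (x + u n')))))%:E).
  apply/measurable_EFinP; apply: measurable_funM.
    exact: measurable_indic (measurable_cball _ _).
  by apply: measurable_funM; apply: cmeasurable_normc; exact: L2_meas (scaled_L2 _ _ Lh).
have X0 i (x : borel K) : (0 <= (\1_D x * (normc (h (varpi ^- i.+1 * (x + u n))) *
     normc (h (varpi ^- i.+1 * (x + u n')))))%:E)%E.
  by rewrite lee_fin !mulr_ge0 ?indicE ?normc_ge0.
have ns0 i m : (0 <= \int[mu]_x (\1_D x * normc (h (varpi ^- i.+1 * (x + u m)%R)) ^+ 2)%:E)%E.
  by apply: integral_ge0 => x _; exact: sample_ge0.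
rewrite /cross_tail /sample_tail -!nneseriesZl; last 3 first.
- by move=> i _; exact: ns0.
- by move=> i _; exact: ns0.
- by move=> i _; apply: integral_ge0.
rewrite -nneseriesD; last 2 first.
- by move=> i _ _; rewrite mule_ge0 ?lee_fin.
- by move=> i _ _; rewrite mule_ge0 ?lee_fin.
apply: lee_nneseries => i; first by move=> _ _; rewrite mule_ge0 ?lee_fin ?mulr_ge0// integral_ge0.
move=> _; rewrite -!ge0_integralZl_EFin ?mulr_ge0//; last 4 first.
- by move=> x _; exact: sample_ge0.
- exact: measurable_sample.
- by move=> x _; exact: sample_ge0.
- exact: measurable_sample.
rewrite -ge0_integralD//; last 4 first.
- by move=> x _; rewrite mule_ge0 ?lee_fin// -lee_fin; exact: sample_ge0.
- by apply: measurable_funeM; exact: measurable_sample.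
- by move=> x _; rewrite mule_ge0 ?lee_fin// -lee_fin; exact: sample_ge0.
- by apply: measurable_funeM; exact: measurable_sample.
apply: ge0_le_integral => //.
- by move=> x _; rewrite mule_ge0 ?X0// lee_fin mulr_ge0.
- exact: measurable_funeM.
- by apply: emeasurable_funD; apply: measurable_funeM; exact: measurable_sample.
move=> x _; rewrite -!EFinM -EFinD lee_fin indicE.
have H (s t : R) : a * b * (s * t) <= 2^-1 * a ^+ 2 * s ^+ 2 + 2^-1 * b ^+ 2 * t ^+ 2.
  by have := sqr_ge0 (a * s - b * t); rewrite sqrrB; nra.
by case: (_ \in _); rewrite ?mul1r ?mul0r ?mulr0 ?addr0//.
Qed.

Lemma diagonal_fold h F N (i : nat) : L2 mu h -> level 0 N F ->
  diagonal_energy h F (- i.+1%:Z) = (\sum_(n < q ^ N) (normc (F (u n)) ^+ 2)%:E *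
    \int[mu]_x (\1_D x * normc (h (varpi ^- i.+1 * (x + u n)%R)) ^+ 2)%:E)%E.
Proof.
move=> Lh lF; have [Fi Fs] := lF; have lcF : locally_constant F by exists 0%N, N.
have LS : L2 mu (fun xi => F xi * h (varpi ^ (- i.+1%:Z) * xi)).
  by apply: L2_mul_lc => //; apply: L2_scale => //; exact: expz_varpi_neq0.
rewrite /diagonal_energy (sqI_fold (N := N) LS); last by move=> x /Fs ->; rewrite mul0r.
under eq_integral do rewrite -sumEFin.
rewrite ge0_integral_sum//; last 2 first.
- move=> s; apply/measurable_EFinP; apply: measurable_funM.
    exact: measurable_indic (measurable_cball _ _).
  by apply: cmeasurable_normc2; exact: L2_meas (L2_translate (u s) LS).
- by move=> s x _; rewrite lee_fin mulr_ge0 ?indicE ?sqr_ge0.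
apply: eq_bigr => n _; rewrite -ge0_integralZl_EFin ?sqr_ge0//; last 2 first.
- by move=> x _; exact: sample_ge0.
- exact: measurable_sample.
apply: eq_integral => x _; rewrite -EFinM; congr EFin.
have [Dx|ND] := pselect (frac_ideal 0 x); last by rewrite indicE memNset ?mul0r ?mulr0// cball00E.
by rewrite (level0_value n lF Dx) Normc.normcM exprMn -exprnN mulrCA.
Qed.

Definition outer_tail (h F : K -> R[i]) : \bar R :=
  (\sum_(0 <= i <oo) sqI mu (fun eta => F (varpi ^+ i.+1 * eta) * h eta)%R)%E.

(** The left-hand side is the sum of the diagonal energies at the negative scales. *)
Lemma sample_tail_outer h F N : L2 mu h -> level 0 N F ->
  (\sum_(n < q ^ N) (normc (F (u n)) ^+ 2)%:E * sample_tail h n <= outer_tail h F)%E.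
Proof.
move=> Lh lF; have lcF : locally_constant F by exists 0%N, N.
have ns0 i m : (0 <= \int[mu]_x (\1_D x * normc (h (varpi ^- i.+1 * (x + u m)%R)) ^+ 2)%:E)%E.
  by apply: integral_ge0 => x _; exact: sample_ge0.
apply: (@le_trans _ _ (\sum_(0 <= i <oo) diagonal_energy h F (- i.+1%:Z))%E); last first.
  by apply: lee_nneseries => i *; [exact: sqI_ge0|exact: diagonal_negative_scale].
under [X in (_ <= X)%E]eq_eseriesr do rewrite (diagonal_fold _ Lh lF).
rewrite le_eqVlt; apply/orP; left; apply/eqP.
under eq_bigr => n _ do rewrite /sample_tail -nneseriesZl//.
by rewrite nneseries_sum// => i j *; rewrite mule_ge0 ?lee_fin ?sqr_ge0.
Qed.

(** * The main estimate *)

Lemma esum_int (a : int -> \bar R) : (forall j, 0 <= a j)%E ->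
  (\esum_(j in [set: int]) a j =
   \sum_(0 <= n <oo) a n%:Z + \sum_(0 <= n <oo) a (- n.+1%:Z)%R)%E.
Proof.
move=> a0; rewrite !nneseries_esumT//.
rewrite (esumID (Posz @` setT))//; congr (_ + _)%E.
  rewrite setTI; apply: (@reindex_esum _ _ _ _ _ Posz); split => //.
  by move=> x y _ _ [].
rewrite setTI; apply: (@reindex_esum _ _ _ _ _ (fun n : nat => - n.+1%:Z)); split => //.
- by move=> n _ /= [m _]; lia.
- by move=> x y _ _ /= h; lia.
- move=> [n|n] /= H; first by exfalso; apply: H; exists n.
  by exists n => //; rewrite NegzE.
Qed.

Definition total_energy h F := (\esum_(j in [set: int]) energy h F j)%E.

Definition total_diagonal h F := (\esum_(j in [set: int]) diagonal_energy h F j)%E.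

Lemma energy_ge0 h F j : (0 <= energy h F j)%E.
Proof.
apply: esum_ge0 => k _; rewrite lee_fin mulr_ge0 ?sqr_ge0//.
by rewrite exprz_ge0// ltW// qR_gt0.
Qed.

(** Distinct indices below q^N are incongruent modulo q^j. *)
Lemma off_energy_large h F N j : (N <= j)%N -> off_energy h F (q ^ N) j = 0.
Proof.
move=> Nj; rewrite /off_energy big1// => n _; rewrite big_pred0// => n'.
have small (k : 'I_(q ^ N)) : (k %% q ^ j = k)%N.
  by rewrite modn_small//; apply: leq_trans (ltn_ord k) _; rewrite leq_pexp2l// q_gt0.
by rewrite !small; case: eqVneq => //= nn; apply/negbTE; rewrite eq_sym.
Qed.

Lemma energy_nonneg_total h F N : L2 mu h -> level 0 N F ->
  (\sum_(0 <= j <oo) energy h F j%:Z = \sum_(0 <= j <oo) diagonal_energy h F j%:Z +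
    (Re (\sum_(j < N) off_energy h F (q ^ N) j))%:E)%E.
Proof.
move=> Lh lF.
rewrite (@nneseries_split _ _ 0 N); last by move=> k _; exact: energy_ge0.
rewrite [X in _ = (X + _)%E](@nneseries_split _ _ 0 N); last by move=> k _; exact: sqI_ge0.
rewrite add0n.
under eq_bigr do rewrite (energy_nonneg_scale _ Lh lF).
rewrite big_split /= sumEFin -Re_sum big_mkord -!addeA; congr (_ + _)%E.
rewrite addeC; congr (_ + _)%E; last by rewrite big_mkord.
rewrite -!(@nneseries_addn _ _ N); try (by move=> k; exact: energy_ge0); try (by move=> k; exact: sqI_ge0).
apply: eq_eseriesr => i _; rewrite (energy_nonneg_scale _ Lh lF).
by rewrite off_energy_large ?leq_addl// adde0.
Qed.

Definition off_sum (F : K -> R[i]) (m : nat) (th : nat -> nat -> R[i]) : R[i] :=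
  \sum_(n < m) \sum_(n' < m | n' != n) F (u n) * conjc (F (u n')) * th n n'.

(** The number th n n' stands for the sum over all scales of the cross terms of the pair. *)
Definition approximates_pairs (h F : K -> R[i]) N (th : nat -> nat -> R[i]) :=
  forall n n', (n < q ^ N)%N -> (n' < q ^ N)%N -> n' != n -> F (u n) != 0 -> F (u n') != 0 ->
  ((normc (th n n' - \sum_(j < N | (n %% q ^ j == n' %% q ^ j)%N) pair_integral h j n n'))%:E <=
    cross_tail h n n')%E.

Lemma sum_symmetrized (m : nat) (b v : 'I_m -> R) :
  \sum_n \sum_n' (2^-1 * (b n' * v n) + 2^-1 * (b n * v n')) = (\sum_n b n) * (\sum_n v n).
Proof.
rewrite (eq_bigr (fun n => 2^-1 * ((\sum_i b i) * v n) + 2^-1 * (b n * \sum_i v i))).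
  rewrite big_split /= -!mulr_sumr -mulr_suml; lra.
by move=> n _; rewrite big_split /= -!mulr_sumr -mulr_suml.
Qed.

(** Each pair contributes an error of at most |F (u n)| |F (u n')| times its cross tail. By
cross_tail_le this is at most a term depending on n plus one depending on n', and each of
them occurs for at most support_card F partners. *)
Lemma off_sum_estimate h F N th : L2 mu h -> level 0 N F -> approximates_pairs h F N th ->
  ((normc (\sum_(j < N) off_energy h F (q ^ N) j - off_sum F (q ^ N) th))%:E <=
    (support_card F (q ^ N))%:E * outer_tail h F)%E.
Proof.
move=> Lh lF Hth; set m := (q ^ N)%N; set A := support_card F m.
pose y n := fine (sample_tail h n).
have yE n : sample_tail h n = (y n)%:E by rewrite /y fineK// sample_tail_fin.
have y0 n : 0 <= y n by rewrite fine_ge0// sample_tail_ge0.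
pose w n := normc (F (u n)).
apply: (@le_trans _ _ (A%:E * (\sum_(n < m) w n ^+ 2 * y n)%:E)%E); last first.
  rewrite lee_wpmul2l ?lee_fin ?support_card_ge0//.
  apply: le_trans (sample_tail_outer Lh lF); rewrite -sumEFin.
  by apply: lee_sum => n _; rewrite yE.
rewrite -EFinM lee_fin.
pose b n : R := (F (u n) != 0)%:R; have b0 n : 0 <= b n by exact: ler0n.
pose W n n' := \sum_(j < N | (n %% q ^ j == n' %% q ^ j)%N) pair_integral h j n n'.
have -> : \sum_(j < N) off_energy h F m j - off_sum F m th =
   \sum_(n < m) \sum_(n' < m | n' != n) F (u n) * conjc (F (u n')) * (W n n' - th n n').
  have -> : \sum_(j < N) off_energy h F m j =
     \sum_(n < m) \sum_(n' < m | n' != n) F (u n) * conjc (F (u n')) * W n n'.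
    rewrite exchange_big /=; apply: eq_bigr => n _.
    rewrite (exchange_big_dep (fun n' : 'I_m => n' != n)) /=; last by move=> j n' _ /andP[].
    apply: eq_bigr => n' nn; rewrite /W mulr_sumr; apply: eq_bigl => j.
    by rewrite nn.
  rewrite /off_sum -sumrB; apply: eq_bigr => n _; rewrite -sumrB; apply: eq_bigr => n' _.
  by rewrite mulrBr.
apply: (@le_trans _ _ (\sum_(n < m) \sum_(n' < m) (2^-1 * (b n' * (w n ^+ 2 * y n)) + 2^-1 * (b n * (w n' ^+ 2 * y n'))))).
  apply: le_trans (normc_sum _ _ _) _; apply: ler_sum => n _.
  apply: le_trans (normc_sum _ _ _) _.
  rewrite big_mkcond /=; apply: ler_sum => n' _.
  have rhs0 : 0 <= 2^-1 * (b n' * (w n ^+ 2 * y n)) + 2^-1 * (b n * (w n' ^+ 2 * y n')).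
    by rewrite addr_ge0 ?mulr_ge0 ?b0 ?normc_ge0.
  case: ifP => // nn.
  have [Fn|Fn] := eqVneq (F (u n)) 0; first by rewrite Fn !mul0r Normc.normc0.
  have [Fn'|Fn'] := eqVneq (F (u n')) 0; first by rewrite Fn' conjc0 mulr0 mul0r Normc.normc0.
  have bn : b n = 1 by rewrite /b Fn.
  have bn' : b n' = 1 by rewrite /b Fn'.
  have w0 k : 0 <= w k by exact: normc_ge0.
  rewrite bn bn' !mul1r !Normc.normcM normc_conj -/(w n) -/(w n').
  have := cross_tail_le n n' Lh (w0 n) (w0 n').
  rewrite !yE -!EFinM -EFinD -!mulrA; set z := (_ + _ in X in (_ <= X)%E -> _) => H.
  rewrite -lee_fin; apply: le_trans H; rewrite mulrA EFinM.
  rewrite lee_wpmul2l ?lee_fin ?mulr_ge0//.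
  by rewrite -normc_oppr opprB; exact: Hth.
by rewrite (sum_symmetrized (fun n : 'I_m => b n) (fun n : 'I_m => w n ^+ 2 * y n)).
Qed.

Lemma estimate_arithmetic (Qp Qm Dp Dm t : \bar R) (A x y : R) :
  (0 <= t)%E -> 0 <= A -> (0 <= Dm)%E -> (0 <= Qm)%E -> (Dm <= t)%E -> (Qm <= A%:E * t)%E ->
  Qp = (Dp + x%:E)%E -> (x%:E <= y%:E + A%:E * t)%E -> (y%:E <= x%:E + A%:E * t)%E ->
  (Qp + Qm <= Dp + Dm + y%:E + (2 * A)%:E * t)%E /\
  (Dp + Dm + y%:E <= Qp + Qm + (A + 1)%:E * t)%E.
Proof.
move=> t0 A0 Dm0 Qm0 Dmt Qmt -> xy yx; split.
  apply: (@le_trans _ _ (Dp + (y%:E + A%:E * t) + A%:E * t)%E).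
    by apply: leeD => //; rewrite leeD2l.
  rewrite mulr_natl mulr2n EFinD ge0_muleDl ?lee_fin// -!addeA leeD2l//.
  by rewrite [leRHS]addeCA leeD2l ?leeDr.
apply: (@le_trans _ _ (Dp + t + (x%:E + A%:E * t))%E).
  by rewrite -addeA -[leRHS]addeA; rewrite leeD2l//; apply: leeD.
rewrite EFinD ge0_muleDl ?lee_fin// mul1e.
rewrite -!addeA leeD2l// [leLHS]addeCA leeD2l//.
by rewrite [leLHS]addeC leeDr.
Qed.

(** The nonnegative scales give the diagonal part and the cross terms, and the negative scales
are bounded by support_card F times the outer tail. *)
Lemma main_estimate h F N th : L2 mu h -> level 0 N F -> approximates_pairs h F N th ->
  (total_energy h F <= total_diagonal h F + (Re (off_sum F (q ^ N) th))%:E +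
     (2 * support_card F (q ^ N))%:E * outer_tail h F)%E /\
  (total_diagonal h F + (Re (off_sum F (q ^ N) th))%:E <= total_energy h F +
     (support_card F (q ^ N) + 1)%:E * outer_tail h F)%E.
Proof.
move=> Lh lF Hth; have lcF : locally_constant F by exists 0%N, N.
have He := off_sum_estimate Lh lF Hth; set A := support_card F _ in He *.
set t := outer_tail h F in He *.
have t0 : (0 <= t)%E by apply: nneseries_ge0 => i _ _; exact: sqI_ge0.
have A0 : 0 <= A by exact: support_card_ge0.
set O := \sum_(j < N) _ in He *; set T := off_sum F _ th in He *.
have ReOT : ((Re O)%:E <= (Re T)%:E + A%:E * t)%E.
  apply: (@le_trans _ _ ((Re T)%:E + (normc (O - T))%:E)%E); last by rewrite leeD2l.
  by rewrite -EFinD lee_fin -lerBlDl -ReN -ReD (le_trans (ler_norm _))// Re_le_normc.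
have ReTO : ((Re T)%:E <= (Re O)%:E + A%:E * t)%E.
  apply: (@le_trans _ _ ((Re O)%:E + (normc (O - T))%:E)%E); last by rewrite leeD2l.
  by rewrite -EFinD lee_fin -lerBlDl -normc_oppr opprB -ReN -ReD (le_trans (ler_norm _))// Re_le_normc.
have D0 j : (0 <= diagonal_energy h F j)%E by exact: sqI_ge0.
rewrite /total_energy esum_int; last by move=> j; exact: energy_ge0.
rewrite /total_diagonal esum_int//.
apply: (@estimate_arithmetic _ _ _ _ _ A (Re O)) => //.
- by apply: nneseries_ge0.
- by apply: nneseries_ge0 => i _ _; exact: energy_ge0.
- by apply: lee_nneseries => // i _; exact: diagonal_negative_scale.
- rewrite /t /outer_tail -nneseriesZl; last by move=> i _; exact: sqI_ge0.
  by apply: lee_nneseries => [i _ _|i _]; [exact: energy_ge0|exact: energy_negative_scale].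
- exact: (energy_nonneg_total Lh lF).
Qed.

(** The scales at which n and n' are congruent are exactly those with j <= r. *)
Lemma approximates_pair h N n n' r s : L2 mu h -> (n < q ^ N)%N -> (n' < q ^ N)%N -> n' != n ->
  ~~ (q %| s)%N -> u n' - u n = varpi ^- r * u s ->
  ((normc (correlation_integral h r s n -
     \sum_(j < N | (n %% q ^ j == n' %% q ^ j)%N) pair_integral h j n n'))%:E <= cross_tail h n n')%E.
Proof.
move=> Lh nN n'N nn qs us.
have [|r0 [s0 [qs0 us0 Hr]]] := @coset_rep_pair n n'; first by move=> e; move: nn; rewrite e eqxx.
have [rr _] : r = r0 /\ s = s0 by apply: coset_rep_pair_uniq => //; rewrite -us -us0.
have rN : (r < N)%N.
  by rewrite ltnNge rr -Hr !modn_small// eq_sym.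
rewrite (eq_bigl (fun j : 'I_N => (j < r.+1)%N)); last by move=> j; rewrite Hr rr ltnS.
rewrite -(big_ord_widen N (fun j => pair_integral h j n n') rN).
exact: cross_term_estimate.
Qed.

Lemma pair_integralC h j n n' : L2 mu h -> pair_integral h j n' n = conjc (pair_integral h j n n').
Proof.
move=> Lh; rewrite -cintegralJ; last exact: cintegrable_pair.
by apply: eq_cintegral => x; rewrite !conjcM cindicJ conjcK [X in _ * X]mulrC.
Qed.

Lemma cross_tailC h n n' : cross_tail h n' n = cross_tail h n n'.
Proof.
apply: eq_eseriesr => i _; apply: eq_integral => x _; congr EFin; congr (_ * _).
exact: mulrC.
Qed.

(** * Rescaling *)

Lemma esum_intZ (a : int -> \bar R) (x : R) : 0 <= x -> (forall j, 0 <= a j)%E ->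
  (\esum_(j in [set: int]) (x%:E * a j) = x%:E * \esum_(j in [set: int]) a j)%E.
Proof.
move=> x0 a0; rewrite !esum_int//; last by move=> j; rewrite mule_ge0.
by rewrite !nneseriesZl// ge0_muleDr//; apply: nneseries_ge0.
Qed.

Lemma esum_int_shift (a : int -> \bar R) (k : int) :
  (\esum_(j in [set: int]) a j = \esum_(j in [set: int]) a (j + k)%R)%E.
Proof.
apply: (reindex_esum setT setT (fun j : int => j + k)); split => //.
- by move=> x y _ _ /addIr.
- by move=> j _; exists (j - k); rewrite ?subrK.
Qed.

Lemma qX_ge0 (M : nat) : 0 <= (q ^ M)%:R :> R. Proof. exact: ler0n. Qed.

Lemma total_diagonal_scale h F (M : nat) : L2 mu h -> locally_constant F ->
  total_diagonal h (fun x => F (varpi ^+ M * x)) = ((q ^ M)%:R%:E * total_diagonal h F)%E.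
Proof.
move=> Lh lF; rewrite /total_diagonal (esum_int_shift _ M%:Z) -esum_intZ ?qX_ge0//; last first.
  by move=> j; exact: sqI_ge0.
apply: eq_esum => j _; have v0 : varpi ^+ M != 0 by rewrite expf_neq0// varpi_neq0.
have LS : L2 mu (fun xi => F xi * h (varpi ^ j * xi)).
  by apply: L2_mul_lc => //; apply: L2_scale => //; exact: expz_varpi_neq0.
have := @sqI_affine (varpi ^+ M) 0 _ v0 (L2_meas LS).
rewrite absX abs_varpiE -exprVn invrK -natrX => <-.
congr sqI; apply/funext => x; rewrite addr0 expfzDr ?varpi_neq0// -exprnP -mulrA//.
Qed.

(** A dilation of F by varpi^M shifts the scales by M. *)
Lemma total_energy_scale h F (M : nat) :
  total_energy h (fun x => F (varpi ^+ M * x)) = ((q ^ M)%:R%:E * total_energy h F)%E.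
Proof.
rewrite /total_energy (esum_int_shift _ M%:Z) -esum_intZ ?qX_ge0//; last first.
  by move=> j; exact: energy_ge0.
apply: eq_esum => j _; rewrite /energy -!nneseries_esumT; last 2 first.
- by move=> k; rewrite lee_fin mulr_ge0 ?sqr_ge0// exprz_ge0 ?ler0n.
- by move=> k; rewrite lee_fin mulr_ge0 ?sqr_ge0// exprz_ge0 ?ler0n.
rewrite -nneseriesZl; last by move=> k _; rewrite lee_fin mulr_ge0 ?sqr_ge0// exprz_ge0 ?ler0n.
apply: eq_eseriesr => k _; rewrite -EFinM; congr EFin.
have -> : q%:R ^ (j + M%:Z) = q%:R ^+ M * q%:R ^ j :> R.
  by rewrite expfzDr ?gt_eqF ?qR_gt0// mulrC -exprnP.
rewrite natrX -mulrA; congr (_ * (_ * normc _ ^+ 2)); apply: eq_cintegral => eta; congr (F _ * _ * _).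
by rewrite exprnP mulrA -expfzDr ?varpi_neq0// opprD addrCA subrr addr0.
Qed.

Lemma outer_tail_scale h F (M : nat) :
  outer_tail h (fun x => F (varpi ^+ M * x)) =
  (\sum_(M <= i <oo) sqI mu (fun eta => F (varpi ^+ i.+1 * eta) * h eta)%R)%E.
Proof.
rewrite -(@nneseries_addn _ (fun i => sqI mu (fun eta => F (varpi ^+ i.+1 * eta) * h eta)%R)); last first.
  by move=> i; exact: sqI_ge0.
apply: eq_eseriesr => i _; congr sqI; apply/funext => eta.
by rewrite mulrA -exprD addnC addSn.
Qed.

Lemma level_scale n N F M : level n N F -> (n <= M)%N ->
  level 0 (N + M) (fun x => F (varpi ^+ M * x)).
Proof.
move=> [Fi Fs] nM; split => x.
  move=> z z0; rewrite mulrDr Fi//; apply: (@frac_ideal_sub _ (0 + M%:Z)); first by lia.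
  exact/frac_ideal_shift.
move=> Nx; apply: Fs => h; apply: Nx.
by apply/(@frac_ideal_shift M); apply: frac_ideal_sub h; lia.
Qed.

Lemma support_card_le F m : support_card F m <= m%:R.
Proof.
rewrite /support_card; apply: (@le_trans _ _ (\sum_(n < m) 1)).
  by apply: ler_sum => n _; case: (_ != _); rewrite ?ler01.
by rewrite sumr_const card_ord.
Qed.

Lemma sum_gap_le (a : nat -> R) (l m : nat) : (forall i, 0 <= a i) ->
  \sum_(i < m) (a (i + l)%N - a i) <= \sum_(i < l) a (m + i)%N.
Proof.
move=> a0; elim: m => [|m IH]; first by rewrite big_ord0 sumr_ge0.
rewrite big_ord_recr /=; apply: le_trans (lerD IH (lexx _)) _.
case: l {IH} => [|l]; first by rewrite !big_ord0 addn0 subrr addr0.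
rewrite big_ord_recl /= addn0 big_ord_recr /=.
have -> : \sum_(i < l) a (m.+1 + i)%N = \sum_(i < l) a (m + bump 0 i)%N.
  by apply: eq_bigr => i _; rewrite /bump /= addSnnS.
by rewrite addSnnS; lra.
Qed.

Lemma sqI_sum_sq (I : finType) (P : pred I) (f : I -> K -> R[i]) G :
  (forall k, cmeasurable (f k)) ->
  (forall x, normc (G x) ^+ 2 = \sum_(k | P k) normc (f k x) ^+ 2) ->
  (sqI mu G = \sum_(k | P k) sqI mu (f k))%E.
Proof.
move=> mf Gf; rewrite -[RHS]big_filter -ge0_integral_sum//.
- by apply: eq_integral => x _; rewrite sumEFin big_filter Gf.
- by move=> k; apply/measurable_EFinP; exact: cmeasurable_normc2.
- by move=> k x _; rewrite lee_fin sqr_ge0.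
Qed.

(** F vanishes outside finitely many spheres, so |F (varpi^i .)|^2 is at most a constant times
the difference of the indicators of two balls, and the sum over i telescopes. *)
Lemma outer_tail_lty h F : L2 mu h -> locally_constant F ->
  (exists n0 : nat, forall x, frac_ideal n0%:Z x -> F x = 0) -> (outer_tail h F < +oo)%E.
Proof.
move=> Lh lF [n0 F0]; have [n [N [Fi Fs]]] := lF; have [C HC] := locally_constant_bounded lF.
have [B B0 HB] : exists2 B, 0 <= B & forall x, normc (F x) ^+ 2 <= B.
  have C0 : 0 <= C by apply: le_trans (HC 0); exact: normc_ge0.
  by exists (C ^+ 2) => [|x]; rewrite ?sqr_ge0// ler_pXn2r ?nnegrE ?normc_ge0.
pose f i (eta : K) := cindic (cball 0 (n0%:Z - i.+1%:Z)) eta * h eta.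
have Lf i : L2 mu (f i) by apply: L2_indic_mul => //; exact: measurable_cball.
pose a i := nrm mu (f i).
have a0 i : 0 <= a i by exact: nrm_ge0.
have aH i : a i <= nrm mu h.
  rewrite -lee_fin -!L2_fin//; apply: sqI_le; [exact: L2_meas (Lf i)|exact: L2_meas Lh|].
  by move=> x; rewrite Normc.normcM -[leRHS]mul1r ler_wpM2r ?normc_ge0// cindic_normc_le1.
pose l := (N + n0)%N.
have LG i : L2 mu (fun eta => F (varpi ^+ i.+1 * eta) * h eta).
  by have := L2_mul_lc (locally_constant_scale i.+1%:Z lF) Lh.
have outer_le i : (sqI mu (fun eta => F (varpi ^+ i.+1 * eta) * h eta)%R <=
    (B * (a (i + l)%N - a i))%:E)%E.
  rewrite mulrBr EFinB leeBrDr// !EFinM -!L2_fin//.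
  rewrite -!ge0_integralZl_EFin //; try (by move=> x _; rewrite lee_fin sqr_ge0);
    try (by apply/measurable_EFinP; apply: cmeasurable_normc2; exact: L2_meas (Lf _)).
  rewrite -ge0_integralD//; last 4 first.
  - by move=> x _; rewrite lee_fin sqr_ge0.
  - by apply/measurable_EFinP; apply: cmeasurable_normc2; exact: L2_meas (LG i).
  - by move=> x _; rewrite -EFinM lee_fin mulr_ge0 ?sqr_ge0.
  - by apply: measurable_funeM; apply/measurable_EFinP; apply: cmeasurable_normc2; exact: L2_meas (Lf _).
  apply: ge0_le_integral => //.
  - by move=> x _; rewrite -EFinM -EFinD lee_fin addr_ge0 ?sqr_ge0// mulr_ge0 ?sqr_ge0.
  - apply: emeasurable_funD; first by apply/measurable_EFinP; apply: cmeasurable_normc2; exact: L2_meas (LG i).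
    by apply: measurable_funeM; apply/measurable_EFinP; apply: cmeasurable_normc2; exact: L2_meas (Lf _).
  - by apply: measurable_funeM; apply/measurable_EFinP; apply: cmeasurable_normc2; exact: L2_meas (Lf _).
  move=> x _; rewrite -!EFinM -EFinD lee_fin /f !Normc.normcM !exprMn.
  have S M : frac_ideal (M - i.+1%:Z) x <-> frac_ideal M (varpi ^+ i.+1 * x).
    by rewrite -{2}(subrK i.+1%:Z M); split => h'; apply/(@frac_ideal_shift i.+1).
  have hx := sqr_ge0 (normc (h x)).
  have [Ax|NA] := pselect (frac_ideal (n0%:Z - (i + l).+1%:Z) x); last first.
    have NB : ~ frac_ideal (n0%:Z - i.+1%:Z) x.
      by move=> Bx; apply: NA; apply: frac_ideal_sub Bx; lia.
    rewrite Fs; last first.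
      by move=> h'; apply: NA; move: ((S (- N%:Z)).2 h'); apply: frac_ideal_sub; rewrite /l; lia.
    rewrite !cindicE !memNset ?Normc.normc0 ?expr0n ?mul0r ?mulr0 ?addr0//; by rewrite /cball /= subr0.
  have -> : cindic (cball 0 (n0%:Z - (i + l).+1%:Z)) x = 1 :> R[i].
    by rewrite cindicE mem_set// /cball /= subr0.
  rewrite Normc.normc1 expr1n mul1r.
  have [Bx|NB] := pselect (frac_ideal (n0%:Z - i.+1%:Z) x).
    rewrite F0; last exact/S.
    by rewrite Normc.normc0 expr0n mul0r add0r cindicE mem_set ?Normc.normc1 ?expr1n ?mul1r// /cball /= subr0.
  rewrite cindicE memNset ?Normc.normc0 ?expr0n ?mul0r ?mulr0 ?addr0; last by rewrite /cball /= subr0.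
  by rewrite ler_wpM2r.
apply: (@le_lt_trans _ _ (B * (l%:R * nrm mu h))%:E); last exact: ltry.
apply: lime_le; first by apply: is_cvg_nneseries => i _ _; exact: sqI_ge0.
apply: nearW => m; rewrite big_mkord.
apply: (@le_trans _ _ (\sum_(i < m) (B * (a (i + l)%N - a i))%:E)%E).
  by apply: lee_sum => i _; exact: outer_le.
rewrite sumEFin lee_fin -mulr_sumr ler_wpM2l//.
apply: le_trans (sum_gap_le l m a0) _.
apply: (@le_trans _ _ (\sum_(i < l) nrm mu h)); first by apply: ler_sum => i _; exact: aH.
by rewrite sumr_const card_ord mulr_natl.
Qed.

(** By outer_tail_scale, this is the tail of a convergent series. *)
Lemma outer_tail_small h F : L2 mu h -> locally_constant F ->
  (exists n0 : nat, forall x, frac_ideal n0%:Z x -> F x = 0) ->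
  forall e : R, 0 < e -> exists M0, forall M, (M0 <= M)%N ->
  (outer_tail h (fun x => F (varpi ^+ M * x)%R) < e%:E)%E.
Proof.
move=> Lh lF F0 e e0.
have := nneseries_tail_cvg (outer_tail_lty Lh lF F0) (fun i _ => sqI_ge0 mu _).
move=> /(ecvg0P _) H; have [|M0 HM] := H _ e e0.
  by move=> n; apply: nneseries_ge0 => i _ _; exact: sqI_ge0.
by exists M0 => M /HM; rewrite outer_tail_scale.
Qed.

(** * The whole family *)

Context {L : nat} {Psi : 'I_L -> K -> R[i]}.
Hypothesis Psi_L2 : forall l, L2 mu (Psi l).

Definition hat (l : 'I_L) : K -> R[i] := fourier mu chi (Psi l).

Lemma hat_L2 l : L2 mu (hat l). Proof. exact: fourier_L2. Qed.

Definition frame_sum (f : K -> R[i]) : \bar R :=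
  (\sum_(l < L) \esum_(j in [set: int]) \esum_(k in [set: nat])
       ((normc (inner mu f (aff (Psi l) j k)) ^+ 2)%R)%:E)%E.

Definition calderon_sum (xi : borel K) : \bar R :=
  (\sum_(l < L) \esum_(j in [set: int]) ((normc (hat l (varpi ^ (- j) * xi)) ^+ 2)%R)%:E)%E.

Definition family_energy F := (\sum_(l < L) total_energy (hat l) F)%E.
Definition family_diagonal F := (\sum_(l < L) total_diagonal (hat l) F)%E.
Definition family_tail F := (\sum_(l < L) outer_tail (hat l) F)%E.

Lemma frame_sum_invF F : locally_constant F -> frame_sum (invF F) = family_energy F.
Proof.
move=> lF; apply: eq_bigr => l _; apply: eq_esum => j _; apply: eq_esum => k _.
by rewrite coefficient_sq.
Qed.

Lemma calderon_sumE xi : calderon_sum xi = (\sum_(l < L)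
  (\sum_(0 <= n <oo) (normc (hat l (varpi ^ n%:Z * xi)) ^+ 2)%:E +
   \sum_(0 <= n <oo) (normc (hat l (varpi ^ (- n.+1%:Z) * xi)) ^+ 2)%:E))%E.
Proof.
apply: eq_bigr => l _.
rewrite -(esum_int (a := fun j => (normc (hat l (varpi ^ j * xi)) ^+ 2)%:E)); last first.
  by move=> j; rewrite lee_fin sqr_ge0.
rewrite [RHS](reindex_esum setT setT (fun j : int => - j)) //; split.
Qed.

Lemma measurable_hat l (j : int) :
  measurable_fun setT (fun xi : borel K => (normc (hat l (varpi ^ j * xi)) ^+ 2)%:E).
Proof.
apply/measurable_EFinP; apply: cmeasurable_normc2.
by have := L2_meas (L2_scale (expz_varpi_neq0 j) (hat_L2 l)).
Qed.

Lemma measurable_calderon_sum : measurable_fun setT calderon_sum.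
Proof.
rewrite (funext calderon_sumE); apply: emeasurable_sum => l.
apply: emeasurable_funD; apply: ge0_emeasurable_sum => // k *; rewrite ?lee_fin ?sqr_ge0//;
  exact: measurable_hat.
Qed.

Lemma calderon_sum_ge0 xi : (0 <= calderon_sum xi)%E.
Proof.
by apply: sume_ge0 => l _; apply: esum_ge0 => j _; rewrite lee_fin sqr_ge0.
Qed.

Lemma family_diagonalE F : locally_constant F ->
  (family_diagonal F = \int[mu]_xi ((normc (F xi) ^+ 2)%:E * calderon_sum xi))%E.
Proof.
move=> lF; have mF : measurable_fun setT (fun xi : borel K => (normc (F xi) ^+ 2)%:E).
  by apply/measurable_EFinP; apply: cmeasurable_normc2; exact: L2_meas (locally_constant_L2 lF).
pose g l (j : int) (xi : borel K) := ((normc (F xi) ^+ 2)%:E * (normc (hat l (varpi ^ j * xi)) ^+ 2)%:E)%E.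
have mg l j : measurable_fun setT (g l j) by apply: emeasurable_funM => //; exact: measurable_hat.
have g0 l j xi : (0 <= g l j xi)%E by rewrite mule_ge0 ?lee_fin ?sqr_ge0.
have dE l j : diagonal_energy (hat l) F j = (\int[mu]_xi g l j xi)%E.
  by apply: eq_integral => xi _; rewrite /g -EFinM Normc.normcM exprMn.
have n0 l (e : nat -> int) xi : (0 <= \sum_(0 <= n <oo) g l (e n) xi)%E by apply: nneseries_ge0.
have mn l (e : nat -> int) : measurable_fun setT (fun xi => \sum_(0 <= n <oo) g l (e n) xi)%E.
  by apply: ge0_emeasurable_sum => // k _; exact: mg.
rewrite (eq_integral (fun xi => \sum_(l < L) (\sum_(0 <= n <oo) g l n%:Z xi + \sum_(0 <= n <oo) g l (- n.+1%:Z)%R xi))%E).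
  rewrite ge0_integral_sum//; last 2 first.
  - by move=> l; apply: emeasurable_funD; exact: mn.
  - by move=> l xi _; rewrite adde_ge0.
  apply: eq_bigr => l _; rewrite ge0_integralD//; try exact: mn.
  rewrite !integral_nneseries// /total_diagonal esum_int; last by move=> j; exact: sqI_ge0.
  by congr (_ + _)%E; apply: eq_eseriesr => n _; rewrite dE.
move=> xi _; rewrite calderon_sumE ge0_sume_distrr; last first.
  by move=> l _; rewrite adde_ge0// nneseries_ge0// => n _ _; rewrite lee_fin sqr_ge0.
apply: eq_bigr => l _; rewrite ge0_muleDr; try by apply: nneseries_ge0 => n _ _; rewrite lee_fin sqr_ge0.
by rewrite !nneseriesZl// => n _; rewrite lee_fin sqr_ge0.
Qed.

Lemma off_sum_sum F m (th : 'I_L -> nat -> nat -> R[i]) :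
  off_sum F m (fun n n' => \sum_(l < L) th l n n') = \sum_(l < L) off_sum F m (th l).
Proof.
rewrite /off_sum exchange_big /=; apply: eq_bigr => n _.
rewrite exchange_big /=; apply: eq_bigr => n' _.
by rewrite mulr_sumr.
Qed.

Lemma family_tail_ge0 F : (0 <= family_tail F)%E.
Proof. by apply: sume_ge0 => l _; apply: nneseries_ge0 => i _ _; exact: sqI_ge0. Qed.

Lemma family_estimate F N (th : 'I_L -> nat -> nat -> R[i]) : level 0 N F ->
  (forall l, approximates_pairs (hat l) F N (th l)) ->
  let x := Re (off_sum F (q ^ N) (fun n n' => \sum_(l < L) th l n n')) in
  (family_energy F <= family_diagonal F + x%:E +
     (2 * support_card F (q ^ N))%:E * family_tail F)%E /\
  (family_diagonal F + x%:E <= family_energy F +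
     (support_card F (q ^ N) + 1)%:E * family_tail F)%E.
Proof.
move=> lF Hth x; have H l := main_estimate (hat_L2 l) lF (Hth l).
have xE : x%:E = (\sum_(l < L) (Re (off_sum F (q ^ N) (th l)))%:E)%E.
  by rewrite sumEFin -Re_sum -off_sum_sum.
have t0 l : (0 <= outer_tail (hat l) F)%E by apply: nneseries_ge0 => i _ _; exact: sqI_ge0.
rewrite xE /family_energy /family_diagonal /family_tail !ge0_sume_distrr// -!big_split /=.
by split; apply: lee_sum => l _; case: (H l).
Qed.

Lemma family_scale F (M : nat) : locally_constant F ->
  (family_energy (fun x => F (varpi ^+ M * x)%R) = (q ^ M)%:R%:E * family_energy F)%E /\
  (family_diagonal (fun x => F (varpi ^+ M * x)%R) = (q ^ M)%:R%:E * family_diagonal F)%E.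
Proof.
move=> lF; rewrite /family_energy /family_diagonal !ge0_sume_distrr; last 2 first.
- by move=> l _; apply: esum_ge0 => j _; exact: sqI_ge0.
- by move=> l _; apply: esum_ge0 => j _; exact: energy_ge0.
split; apply: eq_bigr => l _; first exact: total_energy_scale.
by apply: total_diagonal_scale => //; exact: hat_L2.
Qed.

Lemma family_tail_small F : locally_constant F ->
  (exists n0 : nat, forall x, frac_ideal n0%:Z x -> F x = 0) ->
  forall e : R, 0 < e -> exists M0, forall M, (M0 <= M)%N ->
  (family_tail (fun x => F (varpi ^+ M * x)%R) <= e%:E)%E.
Proof.
(* The division is by L.+1, which is positive for every L. *)
move=> lF F0 e e0; have eL : 0 < e / L.+1%:R by rewrite divr_gt0.
have /boolp.choice[M0 HM] := fun l => outer_tail_small (hat_L2 l) lF F0 eL.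
exists (\sum_(l < L) M0 l)%N => M MM; rewrite /family_tail.
apply: (@le_trans _ _ (\sum_(l < L) (e / L.+1%:R)%:E)%E).
  apply: lee_sum => l _; apply/ltW/HM; apply: leq_trans MM.
  by rewrite (bigD1 l)//= leq_addr.
rewrite sumEFin lee_fin sumr_const card_ord -[leLHS]mulr_natr mulrAC ler_pdivrMr//.
by rewrite ler_pM2l// ler_nat.
Qed.

Definition family_correlation (s : nat) (y : K) : R[i] := \sum_(l < L) correlation (hat l) s y.

Lemma correlation_integral_ball h r s n : L2 mu h ->
  correlation_integral h r s n = (q ^ r)%:R%:C%C *
   conjc (cintegral mu (fun y => cindic (cball (varpi ^+ r * u n) r%:Z) y * correlation h s y)).
Proof.
move=> Lh; have v0 : varpi ^+ r != 0 by rewrite expf_neq0// varpi_neq0.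
have cB : cintegrable mu (fun y => cindic (cball (varpi ^+ r * u n) r%:Z) y * correlation h s y).
  apply: (@cintegrable_bounded_mul _ _ 1); last exact: cintegrable_correlation.
  - exact: cmeasurable_indic (measurable_cball _ _).
  - by move=> x; exact: cindic_normc_le1.
have := cintegral_affine (varpi ^+ r * u n) v0 cB.
rewrite absX abs_varpiE -exprVn invrK -natrX => E.
rewrite /correlation_integral -[X in X * conjc _]conjc_real -conjcM -E; congr conjc.
apply: eq_cintegral => x; rewrite -mulrDr; congr (_ * _).
rewrite !cindicE !cballE subr0 -mulrBr addrK.
congr (if _ then _ else _); apply: asbool_equiv_eq.
by have := @frac_ideal_shift r 0 x; rewrite add0r; exact: iff_sym.
Qed.

Lemma cmeasurable_family_correlation s : cmeasurable (family_correlation s).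
Proof.
apply: cmeasurable_sum => l; by have [] := correlationP s (hat_L2 l).
Qed.

Lemma cintegrable_family_correlation s : cintegrable mu (family_correlation s).
Proof. by apply: cintegrable_sum => l; apply: cintegrable_correlation; exact: hat_L2. Qed.

Lemma family_correlation_integral r s n :
  \sum_(l < L) correlation_integral (hat l) r s n = (q ^ r)%:R%:C%C *
   conjc (cintegral mu (fun y => cindic (cball (varpi ^+ r * u n) r%:Z) y * family_correlation s y)).
Proof.
rewrite (eq_bigr _ (fun l _ => correlation_integral_ball r s n (hat_L2 l))) -mulr_sumr; congr (_ * _).
transitivity (conjc (\sum_(l < L) cintegral mu (fun y => cindic (cball (varpi ^+ r * u n) r%:Z) y * correlation (hat l) s y))).
  by apply: esym; exact: rmorph_sum.
rewrite -cintegral_sum; last first.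
  move=> l; apply: (@cintegrable_bounded_mul _ _ 1); last exact: cintegrable_correlation (hat_L2 l).
  - exact: cmeasurable_indic (measurable_cball _ _).
  - by move=> x; exact: cindic_normc_le1.
congr (conjc _).
apply: eq_cintegral => y.
by rewrite /family_correlation [RHS]mulr_sumr.
Qed.

Lemma ae_family_correlation s : {ae mu, forall xi : borel K,
  t_ mu p varpi eps chi Psi s xi = family_correlation s xi}.
Proof.
have : {ae mu, forall xi : borel K, forall l,
    limn (series (fun i => correlation_term (hat l) s i xi : R[i]^o)) = correlation (hat l) s xi}.
  by apply: filter_forall => l; exact: ae_correlation (hat_L2 l).
by apply: filterS => xi H; apply: eq_bigr => l _; exact: H.
Qed.

Lemma t_condition_family : t_condition mu p varpi eps chi Psi <->
  forall s, ~~ (q %| s)%N -> {ae mu, forall xi : borel K, family_correlation s xi = 0}.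
Proof.
split => H; last first.
  move=> s; rewrite -qE => qs.
  by apply: filterS2 (H s qs) (ae_family_correlation s) => xi <- ->.
move=> s qs; have qs' : ~~ (p ^ c %| s)%N by rewrite -qE.
by apply: filterS2 (H s qs') (ae_family_correlation s) => xi <- <-.
Qed.

(** * Sufficiency *)

Lemma nrm_cball a M : nrm mu (cindic (R:=R) (cball a M)) = abs varpi ^ M.
Proof.
apply: (@complexI R); rewrite -inner_nrm; last exact: cball_L2.
rewrite -(cintegral_cball a M); apply: eq_cintegral => x.
by rewrite cindicJ cindic_sq.
Qed.

Lemma family_diagonal_calderon F : locally_constant F ->
  {ae mu, forall xi : borel K, calderon_sum xi = 1%E} -> family_diagonal F = (nrm mu F)%:E.
Proof.
move=> lF H; rewrite family_diagonalE// -L2_fin; last exact: locally_constant_L2.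
have mF : measurable_fun setT (fun xi : borel K => (normc (F xi) ^+ 2)%:E).
  by apply/measurable_EFinP; apply: cmeasurable_normc2; exact: L2_meas (locally_constant_L2 lF).
apply: ae_eq_integral => //.
  by apply: emeasurable_funM => //; exact: measurable_calderon_sum.
by apply: filterS H => xi -> _; rewrite mule1.
Qed.

(** Without correlations, the main estimate for F (varpi^M .) compares energy and diagonal
directly. Divided by q^M, the number of values of F (varpi^M .) is at most q^N, and the
outer tail tends to 0. *)
Lemma sufficiency F : {ae mu, forall xi : borel K, calderon_sum xi = 1%E} ->
  (forall s, ~~ (q %| s)%N -> {ae mu, forall xi : borel K, family_correlation s xi = 0}) ->
  locally_constant F -> (exists n0 : nat, forall x, frac_ideal n0%:Z x -> F x = 0) ->
  frame_sum (invF F) = (nrm mu F)%:E.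
Proof.
move=> H1 H2 lF F0; rewrite frame_sum_invF// -(family_diagonal_calderon lF H1).
have [n [N lnF]] := lF.
have /boolp.choice[rs Hrs] : forall nn : nat * nat, exists rs : nat * nat, nn.1 <> nn.2 ->
    ~~ (q %| rs.2)%N /\ u nn.2 - u nn.1 = varpi ^- rs.1 * u rs.2.
  move=> [n1 n2] /=; have [->|nn] := eqVneq n1 n2; first by exists (0%N, 0%N).
  by have [r [s [? ? _]]] := coset_rep_pair (elimN eqP nn); exists (r, s).
pose th l n n' := correlation_integral (hat l) (rs (n, n')).1 (rs (n, n')).2 n.
have th0 n1 n2 : n2 != n1 -> \sum_(l < L) th l n1 n2 = 0.
  move=> nn; have [//|qs _] := Hrs (n1, n2).
    by move=> /= e; move: nn; rewrite e eqxx.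
  rewrite family_correlation_integral (_ : cintegral mu _ = 0) ?conjc0 ?mulr0//.
  rewrite -(cintegral0 mu); apply: cintegral_ae_eq.
  - by apply: cmeasurableM; [exact: cmeasurable_indic (measurable_cball _ _)|exact: cmeasurable_family_correlation].
  - exact: cmeasurable_cst.
  - by apply: filterS (H2 _ qs) => y ->; rewrite mulr0.
have est e : 0 < e -> exists M : nat, exists A : R, exists t : \bar R,
    [/\ 0 <= A <= (q ^ M)%:R * (q ^ N)%:R, (0 <= t)%E, (t <= e%:E)%E,
     ((q ^ M)%:R%:E * family_energy F <= (q ^ M)%:R%:E * family_diagonal F + (2 * A)%:E * t)%E &
     ((q ^ M)%:R%:E * family_diagonal F <= (q ^ M)%:R%:E * family_energy F + (A + 1)%:E * t)%E].
  move=> e0; have [M0 HM] := family_tail_small lF F0 e0; pose M := (M0 + n)%N.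
  have lM : level 0 (N + M) (fun x => F (varpi ^+ M * x)) by apply: level_scale lnF _; rewrite leq_addl.
  have [E D] := family_scale M lF.
  have [] := family_estimate (th := th) lM.
    move=> l n1 n2 n1N n2N nn _ _.
    have [|qs us] := Hrs (n1, n2); first by move=> /= e'; move: nn; rewrite e' eqxx.
    exact: approximates_pair (hat_L2 l) n1N n2N nn qs us.
  have -> : off_sum (fun x => F (varpi ^+ M * x)) (q ^ (N + M)) (fun n1 n2 => \sum_(l < L) th l n1 n2) = 0.
    by rewrite /off_sum big1// => n1 _; rewrite big1// => n2 nn; rewrite th0// mulr0.
  rewrite E D adde0 => h1 h2; exists M, (support_card (fun x => F (varpi ^+ M * x)) (q ^ (N + M))), (family_tail (fun x => F (varpi ^+ M * x))).
  split => //; last 2 first.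
  - exact: family_tail_ge0.
  - by apply: HM; rewrite leq_addr.
  by rewrite support_card_ge0 -natrM -expnD addnC support_card_le.
have nonneg F' : (0 <= family_energy F')%E /\ (0 <= family_diagonal F')%E.
  split; apply: sume_ge0 => l _; apply: esum_ge0 => j _; [exact: energy_ge0|exact: sqI_ge0].
have [E0 D0] := nonneg F.
have qN0 : 0 < (q ^ N)%:R :> R by rewrite ltr0n expn_gt0 q_gt0.
have Q1 : 1 <= (q ^ N)%:R :> R by rewrite ler1n expn_gt0 q_gt0.
pose B : R := 2 * (q ^ N)%:R + 1.
have B0 : 0 < B by rewrite /B; lra.
have qM0 (M : nat) : 0 < (q ^ M)%:R :> R by rewrite ltr0n expn_gt0 q_gt0.
have qM1 (M : nat) : 1 <= (q ^ M)%:R :> R by rewrite ler1n expn_gt0 q_gt0.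
have bnd M A t e : 0 <= A <= (q ^ M)%:R * (q ^ N)%:R -> (0 <= t)%E -> (t <= e%:E)%E -> 0 <= e ->
    ((2 * A)%:E * t <= (q ^ M)%:R%:E * (B * e)%:E)%E /\ ((A + 1)%:E * t <= (q ^ M)%:R%:E * (B * e)%:E)%E.
  move=> /andP[A0 AM] t0 te e0.
  have q0 := qM0 M; have q1 := qM1 M.
  have h (C : R) : 0 <= C -> C <= (q ^ M)%:R * B -> (C%:E * t <= (q ^ M)%:R%:E * (B * e)%:E)%E.
    move=> C0 CB; apply: (@le_trans _ _ (C%:E * e%:E)%E); first by rewrite lee_wpmul2l ?lee_fin.
    by rewrite -!EFinM lee_fin mulrA ler_wpM2r.
  have h1 : (q ^ M)%:R * B = 2 * ((q ^ M)%:R * (q ^ N)%:R) + (q ^ M)%:R by rewrite /B; ring.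
  split; apply: h; rewrite ?h1; nra.
apply/eqP; rewrite eq_le; apply/andP; split; apply/lee_addgt0Pr => e e0.
  have [|M [A [t [AM t0 te h _]]]] := est (e / B); first by rewrite divr_gt0.
  have [b1 _] := bnd M A t _ AM t0 te (ltW (divr_gt0 e0 B0)).
  rewrite [B * _]mulrC divfK ?gt_eqF// in b1.
  have := le_trans h (leeD2l _ b1); rewrite -ge0_muleDr ?lee_fin ?(ltW e0)//.
  by rewrite lee_pmul2l// lte_fin.
have [|M [A [t [AM t0 te _ h]]]] := est (e / B); first by rewrite divr_gt0.
have [_ b1] := bnd M A t _ AM t0 te (ltW (divr_gt0 e0 B0)).
rewrite [B * _]mulrC divfK ?gt_eqF// in b1.
have := le_trans h (leeD2l _ b1); rewrite -ge0_muleDr ?lee_fin ?(ltW e0)//.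
by rewrite lee_pmul2l// lte_fin.
Qed.

Definition system (i : 'I_L * int * nat) : K -> R[i] := aff (Psi i.1.1) i.1.2 i.2.

Lemma L2_system i : L2 mu (system i). Proof. exact: L2_aff. Qed.

Lemma frame_sum_esum f : frame_sum f =
  \esum_(i in [set: 'I_L * int * nat]) ((normc (inner mu f (system i)) ^+ 2)%R)%:E.
Proof.
have a0 l j k : (0 <= ((normc (inner mu f (aff (Psi l) j k)) ^+ 2)%R)%:E)%E by rewrite lee_fin sqr_ge0.
rewrite /frame_sum -esum_ord; last by move=> l; apply: esum_ge0 => j _; apply: esum_ge0.
rewrite (esum_pair (a := fun l j => \esum_(k in [set: nat]) ((normc (inner mu f (aff (Psi l) j k)) ^+ 2)%R)%:E)); last first.
  by move=> l j; apply: esum_ge0.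
by rewrite (esum_pair (a := fun (lj : 'I_L * int) k => ((normc (inner mu f (aff (Psi lj.1) lj.2 k)) ^+ 2)%R)%:E)).
Qed.

Lemma tight_frameE : tight_frame mu p varpi eps Psi <->
  forall f, L2 mu f -> frame_sum f = (nrm mu f)%:E.
Proof.
split => [H f Lf|H]; last first.
  by move=> f /cLfun2P Lf; rewrite cLnorm2_sq (L2_fin Lf) -H.
by rewrite -(L2_fin Lf) -cLnorm2_sq; apply: esym; apply: H; exact/cLfun2P.
Qed.

(** Cutting F off near 0 costs little, because small balls around 0 have small measure. *)
Lemma punctured_dense f : L2 mu f -> forall d : R, 0 < d ->
  exists2 F, locally_constant F /\ (exists n0 : nat, forall x, frac_ideal n0%:Z x -> F x = 0) &
    nrm mu (fun x => f x - invF F x) < d.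
Proof.
move=> Lf d d0; have d4 : 0 < d / 4 by rewrite divr_gt0.
have [_ /(_ _ d4)[g lg fg]] := locally_constant_dense Lf.
have [F lF gF] := invF_onto lg.
have [C HC] := locally_constant_bounded lF.
have C0 : 0 < C ^+ 2 + 1 by rewrite ltr_wpDl// sqr_ge0.
have [n Hn] := expr_lt_small (abs_ge0 varpi) abs_varpi_lt1 (divr_gt0 d4 C0).
pose P x := cindic (cball 0 n%:Z) x * F x.
have lP : locally_constant P by exact: locally_constant_mul_cball.
pose F1 x := F x - P x; have lF1 : locally_constant F1 by exact: locally_constantB.
exists F1.
  split => //; exists n => x nx; rewrite /F1 /P cindicE mem_set ?mul1r ?subrr//.
  by rewrite /cball /= subr0.
have LP := locally_constant_L2 lP.
have nP : nrm mu P <= C ^+ 2 * abs varpi ^ n%:Z.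
  have LC := L2Z C%:C%C (cball_L2 0 n%:Z).
  have -> : C ^+ 2 * abs varpi ^ n%:Z = nrm mu (fun x => C%:C%C * cindic (cball 0 n%:Z) x).
    rewrite nrmZ ?nrm_cball//; last exact: cball_L2.
    by rewrite normc_real (@real_normK _ _ (num_real _)).
  rewrite -lee_fin -!L2_fin//; apply: sqI_le; [exact: L2_meas LP|exact: L2_meas LC|].
  move=> x; rewrite !Normc.normcM [leRHS]mulrC ler_wpM2l ?normc_ge0//.
  by rewrite normc_real (le_trans (HC x))// ler_norm.
have Lg := locally_constant_L2 lg; have LI := locally_constant_L2 (locally_constant_invF lF1).
have Pd : nrm mu (fun x => g x - invF F1 x) < d / 4.
  have -> : (fun x => g x - invF F1 x) = invF P.
    by apply/funext => x; rewrite gF /F1 invFB// opprB addrC subrK.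
  rewrite nrm_invF//; apply: le_lt_trans nP _.
  move: Hn; rewrite ltr_pdivlMr//; apply: le_lt_trans.
  by rewrite -exprnP mulrC mulrDr mulr1 lerDl exprn_ge0// abs_ge0.
have -> : (fun x => f x - invF F1 x) = (fun x => (f x - g x) + (g x - invF F1 x)).
  by apply/funext => x; rewrite addrA subrK.
apply: le_lt_trans (nrmD_le (L2B Lf Lg) (L2B Lg LI) ltr01) _; rewrite invr1; lra.
Qed.

Lemma sufficiency_frame : {ae mu, forall xi : borel K, calderon_sum xi = 1%E} ->
  (forall s, ~~ (q %| s)%N -> {ae mu, forall xi : borel K, family_correlation s xi = 0}) ->
  forall f, L2 mu f -> frame_sum f = (nrm mu f)%:E.
Proof.
move=> H1 H2 f Lf; rewrite frame_sum_esum.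
pose V (g : K -> R[i]) := exists2 F, locally_constant F /\
  (exists n0 : nat, forall x, frac_ideal n0%:Z x -> F x = 0) & g = invF F.
apply: (@frame_dense _ _ _ _ system L2_system V) => //.
- by move=> g [F [lF _] ->]; apply: locally_constant_L2; exact: locally_constant_invF.
- by move=> g [F [lF F0] ->]; rewrite -frame_sum_esum nrm_invF//; exact: sufficiency.
- move=> g Lg d d0; have [F HF fd] := punctured_dense Lg d0.
  by exists (invF F) => //; exists F.
Qed.

(** * Functions determined by their integrals over balls *)

Lemma mu_point (z : K) : mu [set z] = 0%E.
Proof.
apply/eqP; rewrite eq_le measure_ge0 andbT; apply/lee_addgt0Pr => e e0; rewrite add0e.
have [n Hn] := expr_lt_small (abs_ge0 varpi) abs_varpi_lt1 e0.
apply: (@le_trans _ _ (mu (cball z n%:Z))); last by rewrite mu_cball lee_fin -exprnP ltW.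
apply: le_measure; rewrite ?inE; last by move=> _ ->; rewrite /cball /= subrr; exact: frac_ideal0.
  case: K_local => _ _ td _; apply: closed_measurable; exact: totally_disconnected_closed1.
exact: measurable_cball.
Qed.

(** Inside one ball, the sets over which the two integrals agree form a lambda-system containing
the smaller balls. Countably many of these balls cover the complement of the two points. *)
Lemma ae_eq_balls (f g : borel K -> \bar R) (z1 z2 : K) :
  measurable_fun setT f -> measurable_fun setT g ->
  (forall a (n : nat), ~ cball a n z1 -> ~ cball a n z2 ->
    [/\ mu.-integrable (cball a n) f, mu.-integrable (cball a n) g &
    (\int[mu]_(x in cball a n%:Z) f x = \int[mu]_(x in cball a n%:Z) g x)%E]) ->
  {ae mu, forall x : borel K, f x = g x}.
Proof.
move=> mf mg H.
have local a (n : nat) : ~ cball a n z1 -> ~ cball a n z2 ->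
    ae_eq mu (cball a n) f g.
  move=> a1 a2; have [i1 i2 e12] := H a n a1 a2; set W : set (borel K) := cball a n in i1 i2 e12 *.
  have mW : measurable W by exact: measurable_cball.
  have key (A : set (borel K)) : measurable A ->
     (\int[mu]_(x in A `&` W) f x = \int[mu]_(x in A `&` W) g x)%E.
    move: A; apply: (@borel_ind (fun A => (\int[mu]_(x in A `&` W) f x = \int[mu]_(x in A `&` W) g x)%E)).
    - by rewrite setTI.
    - move=> B bB; have : balls (B `&` W) by apply: ballsI => //; right; exists a, n.
      case=> [->|[b [m BW]]]; first by rewrite !integral_set0.
      have bW z : cball b m z -> W z by rewrite /cball -BW => -[].
      have [_ _] := H b m (fun h => a1 (bW _ h)) (fun h => a2 (bW _ h)).
      by rewrite BW.
    - move=> A mA eA.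
      have mAW : measurable (A `&` W) by exact: measurableI.
      have mAW' : measurable (~` A `&` W) by apply: measurableI => //; exact: measurableC.
      have WE : W = (A `&` W) `|` (~` A `&` W) by rewrite -setIUl setUv setTI.
      have dj : [disjoint A `&` W & ~` A `&` W].
        by apply/disj_setPS => x [[Ax _] [NAx _]].
      have sp k : measurable_fun setT k -> (\int[mu]_(x in W) k x =
         \int[mu]_(x in A `&` W) k x + \int[mu]_(x in ~` A `&` W) k x)%E.
        by move=> mk; rewrite {1}WE integral_setU// -WE; exact: measurable_funTS.
      have fin : (\int[mu]_(x in A `&` W) f x)%E \is a fin_num.
        by apply: integrable_fin_num => //; apply: integrableS i1.
      move: e12; rewrite !sp// -eA ![(\int[mu]_(x in A `&` W) f x + _)%E]addeC.
      move=> /(congr1 (fun z : \bar R => z - \int[mu]_(x in A `&` W) f x)%E).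
      by rewrite !addeK.
    - move=> F mF tF eF; rewrite setI_bigcupl.
      have mFW k : measurable (F k `&` W) by exact: measurableI.
      have tFW : trivIset setT (fun k => F k `&` W) by exact: trivIset_setIr.
      have sub : \bigcup_k (F k `&` W) `<=` W by move=> x [k _ []].
      have mU : measurable (\bigcup_k (F k `&` W)) by exact: bigcupT_measurable.
      rewrite !integral_bigcup//; try exact: integrableS sub _.
      by apply: eq_eseriesr => k _; exact: eF.
  apply: (integral_ae_eq mW i1); first exact: measurable_funTS.
  by move=> E EW mE; have := key E mE; rewrite setIidl.
pose W (n k : nat) := cball (varpi ^+ n * u k) n.
have aeW' : {ae mu, forall x : borel K, forall n k, ~ W n k z1 -> ~ W n k z2 -> W n k x -> f x = g x}.
  apply: ae_foralln => n; apply: ae_foralln => k.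
  have [h1|h1] := pselect (W n k z1); first by apply: aeW.
  have [h2|h2] := pselect (W n k z2); first by apply: aeW.
  by apply: filterS (local _ _ h1 h2) => x Hx _ _; exact: Hx.
have aez z : {ae mu, forall x : borel K, x <> z}.
  exists [set z]; split; first by case: K_local => _ _ td _; apply: closed_measurable; exact: totally_disconnected_closed1.
    exact: mu_point.
  by move=> x /= /contrapT.
apply: filterS3 aeW' (aez z1) (aez z2) => x Hx x1 x2.
have far z : x <> z -> exists n : nat, forall m : nat, (n <= m)%N -> ~ frac_ideal m%:Z (x - z).
  move=> xz; have d0 : 0 < abs (x - z) by apply: abs_gt0; rewrite subr_eq0; apply/eqP.
  have [n Hn] := expr_lt_small (abs_ge0 varpi) abs_varpi_lt1 d0.
  exists n => m nm hm; have : frac_ideal n%:Z (x - z) by apply: frac_ideal_sub hm; rewrite lez_nat.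
  by rewrite /frac_ideal /= -exprnP leNgt Hn.
have [n1 H1] := far _ x1; have [n2 H2] := far _ x2; pose n := (n1 + n2)%N.
have [N xN] := frac_ideal_exhaust x; have [k _ xk] := ball_cover n xN.
have avoid z : ~ frac_ideal n%:Z (x - z) -> ~ W n k z.
  move=> nz Wz; apply: nz; have -> : x - z = (x - varpi ^+ n * u k) - (z - varpi ^+ n * u k) by ring.
  by apply: frac_idealD => //; exact: frac_idealN.
by apply: (Hx n k) => //; apply: avoid; [apply: H1|apply: H2]; rewrite ?leq_addr ?leq_addl.
Qed.

(** * Necessity *)

Section TwoBalls.
Variables (a : K) (n : nat) (s : nat) (omega : R[i]).
Hypothesis qs : ~~ (q %| s)%N.
Hypothesis a_avoid : ~ frac_ideal n%:Z a.
Hypothesis as_avoid : omega != 0 -> ~ frac_ideal n%:Z (a + u s).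
Hypothesis tf : forall f, L2 mu f -> frame_sum f = (nrm mu f)%:E.

Lemma us_large : ~ frac_ideal 0 (u s).
Proof.
move=> h; have s0 : s = 0%N by apply: coset_rep_uniq; rewrite coset_rep0 subr0.
by move: qs; rewrite s0 dvdn0.
Qed.

(** The test function: omega = 0 isolates the Calderon sum, and the other values of omega detect
the correlation. *)
Definition two_balls (x : K) : R[i] :=
  cindic (cball a n) x + omega * cindic (cball (a + u s) n) x.

Lemma locally_constant_two_balls : locally_constant two_balls.
Proof.
apply: locally_constantD; first exact: locally_constant_cball.
by apply: locally_constantZ; exact: locally_constant_cball.
Qed.

Lemma two_balls_near0 x : frac_ideal n%:Z x -> two_balls x = 0.
Proof.
have H b : ~ frac_ideal n%:Z b -> frac_ideal n%:Z x -> cindic (cball b n) x = 0 :> R[i].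
  move=> nb nx; rewrite cindicE memNset// /cball /= => h; apply: nb.
  by rewrite -(subKr x b); apply: frac_idealD => //; exact: frac_idealN.
move=> nx; rewrite /two_balls H// add0r; have [->|o0] := eqVneq omega 0; first by rewrite mul0r.
by rewrite H ?mulr0//; exact: as_avoid.
Qed.

Lemma normc_disjoint (b b' : bool) : ~~ (b && b') ->
  normc ((if b then 1 else 0) + omega * (if b' then 1 else 0)) ^+ 2 =
  b%:R + normc omega ^+ 2 * b'%:R.
Proof.
by case: b; case: b' => //= _; rewrite ?mulr1 ?mulr0 ?addr0 ?add0r ?Normc.normc1 ?Normc.normc0 ?expr1n ?expr0n.
Qed.

Lemma normc_two_balls x : normc (two_balls x) ^+ 2 =
  \1_(cball a n) x + normc omega ^+ 2 * \1_(cball (a + u s) n) x.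
Proof.
rewrite /two_balls !cindicE normc_disjoint ?indicE//.
apply/negP => /andP[]; rewrite !inE /cball /= => h1 h2; apply: us_large.
apply: (@frac_ideal_sub _ n%:Z) => //.
have -> : u s = (x - a) - (x - (a + u s)) by ring.
by apply: frac_idealD => //; exact: frac_idealN.
Qed.

Section Rescaled.
Variables (M N : nat).
Hypothesis nM : (n <= M)%N.
Hypothesis N_bound : forall x, cball a n x -> frac_ideal (- N%:Z) x.

Let S (k : 'I_(q ^ (M + N))) : bool := `[< cball a n (varpi ^+ M * u k) >].

Lemma sum_sub_balls x :
  \sum_(k < q ^ (M + N) | S k) \1_(cball (varpi ^+ M * u k) M) x = \1_(cball a n) x :> R.
Proof.
have sub k : frac_ideal M%:Z (x - varpi ^+ M * u k) ->
    cball a n x <-> cball a n (varpi ^+ M * u k).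
  move=> h; rewrite -{1}(subrK (varpi ^+ M * u k) x) addrC; apply: cball_invariant.
  by apply: frac_ideal_sub h; rewrite lez_nat.
have [ax|nax] := pselect (cball a n x).
  have [k kN Hk] := ball_cover M (N_bound ax).
  rewrite (bigD1 (Ordinal kN))/=; last by apply/asboolP => /=; apply/(sub k Hk).
  rewrite big1 ?addr0; first by rewrite !indicE !mem_set.
  move=> k' /andP[_ kk']; rewrite indicE cballE; case: asboolP => // h.
  by move/eqP: kk'; case; apply/val_inj; exact: ball_unique h Hk.
rewrite big1; first by rewrite indicE memNset.
move=> k /asboolP Sk; rewrite indicE cballE; case: asboolP => // /sub h.
by exfalso; apply: nax; apply/h.
Qed.

Lemma indic_scale b x : \1_(cball (varpi ^+ M * b) M) (varpi ^+ M * x) = \1_(cball b 0) x :> R.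
Proof.
rewrite !indicE !cballE -mulrBr; congr ((nat_of_bool _)%:R); apply: asbool_equiv_eq.
by have := @frac_ideal_shift M 0 (x - b); rewrite add0r.
Qed.

Let w := varpi ^- M * u s.

Let wE : varpi ^+ M * w = u s.
Proof. by rewrite /w mulVKf// expf_neq0// varpi_neq0. Qed.

(** The k-th piece of two_balls (varpi^M .), carried by two cosets of D. *)
Definition small_pair (k : nat) (x : K) : R[i] :=
  cindic (cball (u k) 0) x + omega * cindic (cball (u k + w) 0) x.

Let w_large : ~ frac_ideal 0 w.
Proof.
move=> h; apply: us_large; rewrite -wE; apply: (@frac_ideal_sub _ (0 + M%:Z)); first by lia.
exact/frac_ideal_shift.
Qed.

Let disjoint_pair k x : ~~ ((x \in cball (u k) 0) && (x \in cball (u k + w) 0)).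
Proof.
apply/negP => /andP[]; rewrite !inE /cball /= => h1 h2; apply: w_large.
have -> : w = (x - u k) - (x - (u k + w)) by ring.
by apply: frac_idealD => //; exact: frac_idealN.
Qed.

Lemma normc_small_pair k x : normc (small_pair k x) ^+ 2 =
  \1_(cball (u k) 0) x + normc omega ^+ 2 * \1_(cball (u k + w) 0) x.
Proof. by rewrite /small_pair !cindicE normc_disjoint ?indicE. Qed.

Lemma sum_small_pairs x :
  normc (two_balls (varpi ^+ M * x)) ^+ 2 = \sum_(k < q ^ (M + N) | S k) normc (small_pair k x) ^+ 2.
Proof.
rewrite normc_two_balls; under eq_bigr do rewrite normc_small_pair.
rewrite big_split /= -mulr_sumr -sum_sub_balls; congr (_ + _ * _).
  by apply: eq_bigr => k _; rewrite indic_scale.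
have -> : \1_(cball (a + u s) n) (varpi ^+ M * x) = \1_(cball a n) (varpi ^+ M * (x - w)) :> R.
  rewrite !indicE !cballE; congr ((nat_of_bool `[< frac_ideal _ _ >])%:R).
  by rewrite mulrBr wE; ring.
rewrite -sum_sub_balls; apply: eq_bigr => k _; rewrite indic_scale.
by rewrite !indicE !cballE opprD addrA addrAC.
Qed.

Lemma locally_constant_small_pair k : locally_constant (small_pair k).
Proof.
apply: locally_constantD; first exact: locally_constant_cball.
by apply: locally_constantZ; exact: locally_constant_cball.
Qed.

Definition ball_correlation (k : nat) : R[i] :=
  cintegral mu (fun y => cindic (cball (varpi ^+ M * u k) M) y * family_correlation s y).

(** A piece has at most two nonzero values, so the error is bounded by its outer tail with a
constant independent of M. *)
Lemma small_pair_estimate k :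
  let x := (q ^ M)%:R * (2 * Re (omega * ball_correlation k)) in
  ((nrm mu (small_pair k))%:E <= family_diagonal (small_pair k) + x%:E +
     4%:E * family_tail (small_pair k))%E /\
  (family_diagonal (small_pair k) + x%:E <= (nrm mu (small_pair k))%:E +
     4%:E * family_tail (small_pair k))%E.
Proof.
move=> x; have lf := locally_constant_small_pair k.
have [k' uk'] : exists k', u k' = u k + w.
  have [k' Ek'] := coset_repD k (q ^ M * s); exists k'; rewrite Ek'; congr (_ + _).
  by rewrite -[(q ^ M * s)%N]addn0 coset_rep_shift ?expn_gt0 ?q_gt0// coset_rep0 addr0.
have kk' : k != k'.
  apply/eqP => e; apply: w_large; move: uk'; rewrite -e => /eqP.
  by rewrite -subr_eq0 opprD addrA subrr add0r oppr_eq0 => /eqP ->; exact: frac_ideal0.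
pose N' := (k + k')%N; pose m := (q ^ N')%N.
have qN : (N' < m)%N by rewrite ltn_expl// q_gt1.
have km : (k < m)%N by apply: leq_ltn_trans qN; rewrite leq_addr.
have k'm : (k' < m)%N by apply: leq_ltn_trans qN; rewrite leq_addl.
have value j : small_pair k (u j) = (j == k)%:R + omega * (j == k')%:R.
  have E i : cindic (cball (u i) 0) (u j) = (j == i)%:R :> R[i].
    rewrite cindicE cballE; case: asboolP => [/coset_rep_uniq ->|h]; first by rewrite eqxx.
    by case: eqP => // ji; exfalso; apply: h; rewrite ji subrr; exact: frac_ideal0.
  by rewrite /small_pair -uk' !E.
have vk : small_pair k (u k) = 1 by rewrite value eqxx (negbTE kk') mulr0 addr0.
have vk' : small_pair k (u k') = omega by rewrite value eqxx eq_sym (negbTE kk') mulr1 add0r.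
have v0 j : j != k -> j != k' -> small_pair k (u j) = 0.
  by move=> /negbTE h1 /negbTE h2; rewrite value h1 h2 mulr0 addr0.
have lev : level 0 N' (small_pair k).
  split => [y z z0|y Ny].
    by congr (_ + _ * _); rewrite !cindicE; congr (if _ then _ else _);
      apply/idP/idP; rewrite !inE => /(cball_invariant _ _ z0).
  have out j : (j < m)%N -> cindic (cball (u j) 0) y = 0 :> R[i].
    move=> jm; rewrite cindicE memNset// => h; apply: Ny.
    rewrite -(subrK (u j) y); apply: frac_idealD; last exact: coset_rep_bound.
    by apply: frac_ideal_sub h; lia.
  by rewrite /small_pair -uk' !out// mulr0 addr0.
have A2 : support_card (small_pair k) m <= 2.
  apply: (@le_trans _ _ (\sum_(j < m) ((val j == k)%:R + (val j == k')%:R))).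
    apply: ler_sum => j _; have [jk|jk] := eqVneq (val j) k; first by apply: (@le_trans _ _ 1); [case: (_ != 0); rewrite ?ler01|rewrite lerDl ler0n].
    have [jk'|jk'] := eqVneq (val j) k'; first by rewrite add0r; case: (_ != _); rewrite ?ler01.
    by rewrite v0// eqxx addr0.
  have cnt i (im : (i < m)%N) : \sum_(j < m) (val j == i)%:R = 1 :> R.
    by rewrite (bigD1 (Ordinal im))//= eqxx big1 ?addr0// => j; rewrite -val_eqE /= => /negbTE ->.
  by rewrite big_split /= !cnt.
pose Z l := correlation_integral (hat l) M s k.
pose th (l : 'I_L) (n1 n2 : nat) : R[i] := if n1 == k then Z l else conjc (Z l).
have Hth l : approximates_pairs (hat l) (small_pair k) N' (th l).
  move=> n1 n2 n1m n2m n12 f1 f2.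
  have in2 j : small_pair k (u j) != 0 -> j = k \/ j = k'.
    move=> fj; have [jk|jk] := eqVneq j k; [by left|right].
    by apply/eqP; apply: contraNT fj => jk'; rewrite v0.
  have uw : u k' - u k = varpi ^- M * u s by rewrite uk' addrC addKr.
  have kk : k' != k by rewrite eq_sym.
  have base := approximates_pair (N := N') (hat_L2 l) km k'm kk qs uw.
  case: (in2 _ f1) n12 => ->; case: (in2 _ f2) => -> n12.
  - by exfalso; move: n12; rewrite eqxx.
  - by rewrite /th eqxx.
  - rewrite /th eq_sym (negbTE kk') cross_tailC.
    rewrite (eq_bigl (fun j : 'I_N' => (k %% q ^ j == k' %% q ^ j)%N)); last by move=> j; rewrite eq_sym.
    rewrite (eq_bigr (fun j : 'I_N' => conjc (pair_integral (hat l) j k k'))); last first.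
      by move=> j _; rewrite pair_integralC//; exact: hat_L2.
    have <- : conjc (\sum_(j < N' | (k %% q ^ j == k' %% q ^ j)%N) pair_integral (hat l) j k k') =
       \sum_(j < N' | (k %% q ^ j == k' %% q ^ j)%N) conjc (pair_integral (hat l) j k k').
      exact: rmorph_sum.
    by rewrite -conjcB normc_conj.
  - by exfalso; move: n12; rewrite eqxx.
have [] := family_estimate lev Hth.
have -> : Re (off_sum (small_pair k) m (fun n1 n2 => \sum_(l < L) th l n1 n2)) = x.
  pose TH n1 n2 := \sum_(l < L) th l n1 n2.
  have THk : TH k k' = (q ^ M)%:R%:C%C * conjc (ball_correlation k).
    by rewrite /TH /th eqxx family_correlation_integral.
  have THk' : TH k' k = conjc (TH k k').
    rewrite /TH /th eqxx eq_sym (negbTE kk'); apply: esym; exact: rmorph_sum.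
  have -> : off_sum (small_pair k) m TH = conjc omega * TH k k' + omega * TH k' k.
    rewrite /off_sum (bigD1 (Ordinal km))//= (bigD1 (Ordinal k'm))//=; last by rewrite -val_eqE /= eq_sym.
    rewrite vk vk' mul1r [X in _ + X + _]big1 ?addr0; last first.
      by move=> j /andP[j1 j2]; rewrite v0 ?conjc0 ?mulr0 ?mul0r.
    congr (_ + _); rewrite (bigD1 (Ordinal k'm))/=; last by rewrite -val_eqE /= eq_sym.
    rewrite (bigD1 (Ordinal km))/=; last by rewrite -val_eqE.
    rewrite vk vk' conjc1 mulr1 big1 ?addr0; last first.
      by move=> j /andP[j1 j2]; rewrite v0 ?conjc0 ?mulr0 ?mul0r.
    rewrite [X in _ + X]big1 ?addr0// => j /andP[j1 j2].
    by rewrite big1// => j' _; rewrite v0 ?mul0r.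
  rewrite THk' THk conjcM conjcK conjc_real /x.
  by case: (omega) (ball_correlation k) => [w1 w2] [b1 b2] /=; ring.
have t0 := family_tail_ge0 (small_pair k).
have -> : family_energy (small_pair k) = (nrm mu (small_pair k))%:E.
  rewrite -frame_sum_invF// tf ?nrm_invF//.
  by apply: locally_constant_L2; exact: locally_constant_invF.
move=> h1 h2; split.
  apply: le_trans h1 _; rewrite leeD2l// lee_wpmul2r// lee_fin; rewrite -/m; move: A2; lra.
apply: le_trans h2 _; rewrite leeD2l// lee_wpmul2r// lee_fin; rewrite -/m; move: A2; lra.
Qed.

Let G (x : K) : R[i] := two_balls (varpi ^+ M * x).

Let lG : locally_constant G.
Proof. exact: (locally_constant_scale M%:Z locally_constant_two_balls). Qed.

Let sqI_pairs (h : K -> R[i]) : cmeasurable h ->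
  (sqI mu (fun x => G x * h x)%R = \sum_(k < q ^ (M + N) | S k) sqI mu (fun x => small_pair k x * h x)%R)%E.
Proof.
move=> mh; apply: sqI_sum_sq => [k|x].
  by apply: cmeasurableM => //; exact: L2_meas (locally_constant_L2 (locally_constant_small_pair k)).
rewrite Normc.normcM exprMn sum_small_pairs mulr_suml.
by apply: eq_bigr => k _; rewrite Normc.normcM exprMn.
Qed.

Lemma sum_nrm_pairs : \sum_(k < q ^ (M + N) | S k) nrm mu (small_pair k) = nrm mu G.
Proof.
have LP k := locally_constant_L2 (locally_constant_small_pair k).
apply: (@EFin_inj R); rewrite -sumEFin -(L2_fin (locally_constant_L2 lG)).
transitivity (sqI mu (fun x => G x * 1)); last by congr sqI; apply/funext => x; rewrite mulr1.
rewrite sqI_pairs; last exact: cmeasurable_cst.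
apply: eq_bigr => k _; rewrite -(L2_fin (LP k)).
by congr sqI; apply/funext => x; rewrite mulr1.
Qed.

Lemma sum_diagonal_pairs :
  (\sum_(k < q ^ (M + N) | S k) family_diagonal (small_pair k) = family_diagonal G)%E.
Proof.
rewrite exchange_big /=; apply: eq_bigr => l _.
rewrite /total_diagonal -esum_sum; last by move=> j k _ _; exact: sqI_ge0.
apply: eq_esum => j _; rewrite /diagonal_energy sqI_pairs//.
by have := L2_meas (L2_scale (expz_varpi_neq0 j) (hat_L2 l)).
Qed.

Lemma sum_tail_pairs :
  (\sum_(k < q ^ (M + N) | S k) family_tail (small_pair k) = family_tail G)%E.
Proof.
rewrite exchange_big /=; apply: eq_bigr => l _.
rewrite /outer_tail -nneseries_sum; last by move=> k i _; exact: sqI_ge0.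
apply: eq_eseriesr => i _.
have v0 : varpi ^- i.+1 != 0 by rewrite invr_eq0 expf_neq0// varpi_neq0.
have v0' : varpi ^+ i.+1 != 0 by rewrite expf_neq0// varpi_neq0.
have E g : cmeasurable g -> sqI mu (fun eta => g (varpi ^+ i.+1 * eta) * hat l eta) =
    ((abs (varpi ^+ i.+1))^-1%:E * sqI mu (fun y => g y * hat l (varpi ^- i.+1 * y))%R)%E.
  move=> mg; rewrite -(@sqI_affine _ 0)//.
    by congr sqI; apply/funext => eta; rewrite addr0 mulKf.
  apply: cmeasurableM => //; exact: L2_meas (L2_scale v0 (hat_L2 l)).
have mP k := L2_meas (locally_constant_L2 (locally_constant_small_pair k)).
rewrite E; last exact: L2_meas (locally_constant_L2 lG).
under eq_bigr do rewrite E//.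
rewrite -ge0_sume_distrr; last by move=> k _; exact: sqI_ge0.
by rewrite sqI_pairs//; exact: L2_meas (L2_scale v0 (hat_L2 l)).
Qed.

Lemma sum_correlation_pairs : \sum_(k < q ^ (M + N) | S k) ball_correlation k =
  cintegral mu (fun y => cindic (cball a n) y * family_correlation s y).
Proof.
rewrite -cintegral_sum; last first.
  move=> k; apply: (@cintegrable_bounded_mul _ _ 1); last exact: cintegrable_family_correlation.
  - exact: cmeasurable_indic (measurable_cball _ _).
  - by move=> x; exact: cindic_normc_le1.
apply: eq_cintegral => y; rewrite -mulr_suml; congr (_ * _).
by rewrite /cindic -sum_sub_balls rmorph_sum.
Qed.

Definition total_correlation : R[i] :=
  cintegral mu (fun y => cindic (cball a n) y * family_correlation s y).

Lemma two_balls_estimate :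
  let x := 2 * Re (omega * total_correlation) in
  ((q ^ M)%:R%:E * (nrm mu two_balls)%:E <= (q ^ M)%:R%:E * (family_diagonal two_balls + x%:E) +
     4%:E * family_tail G)%E /\
  ((q ^ M)%:R%:E * (family_diagonal two_balls + x%:E) <= (q ^ M)%:R%:E * (nrm mu two_balls)%:E +
     4%:E * family_tail G)%E.
Proof.
move=> x; have H k := small_pair_estimate k.
have v0 : varpi ^+ M != 0 by rewrite expf_neq0// varpi_neq0.
have D0 F : (0 <= family_diagonal F)%E.
  by apply: sume_ge0 => l _; apply: esum_ge0 => j _; exact: sqI_ge0.
have -> : ((q ^ M)%:R%:E * (nrm mu two_balls)%:E = \sum_(k < q ^ (M + N) | S k) (nrm mu (small_pair k))%:E)%E.
  rewrite sumEFin sum_nrm_pairs -EFinM; congr EFin.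
  have := @sqI_affine (varpi ^+ M) 0 _ v0 (L2_meas (locally_constant_L2 locally_constant_two_balls)).
  rewrite absX abs_varpiE -exprVn invrK -natrX (L2_fin (locally_constant_L2 locally_constant_two_balls)) -EFinM.
  rewrite /nrm; under eq_fun do rewrite addr0.
  by move=> /(congr1 fine).
have -> : ((q ^ M)%:R%:E * (family_diagonal two_balls + x%:E) = \sum_(k < q ^ (M + N) | S k)
   (family_diagonal (small_pair k) + ((q ^ M)%:R * (2 * Re (omega * ball_correlation k)))%:E))%E.
  rewrite muleDr ?fin_num_adde_defl//.
  rewrite big_split /= sum_diagonal_pairs (family_scale M locally_constant_two_balls).2; congr (_ + _)%E.
  rewrite sumEFin -EFinM -!mulr_sumr; congr (_ * (_ * _))%:E.
  by rewrite -Re_sum -mulr_sumr sum_correlation_pairs.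
rewrite -sum_tail_pairs ge0_sume_distrr; last by move=> k _; exact: family_tail_ge0.
rewrite -!big_split /=.
by split; apply: lee_sum => k _; case: (H k).
Qed.

End Rescaled.

(** Summed over the pieces, the errors add up to the outer tail of the whole function, which
tends to 0 with M, while the main terms carry the factor q^M. *)
Lemma necessity_identity :
  (nrm mu two_balls)%:E = (family_diagonal two_balls + (2 * Re (omega * total_correlation))%:E)%E.
Proof.
have [N HN] : exists N : nat, forall x, cball a n x -> frac_ideal (- N%:Z) x.
  have [N1 aN] := frac_ideal_exhaust a; exists N1 => x ax.
  by rewrite -(subrK a x); apply: frac_idealD => //; apply: frac_ideal_sub ax; lia.
have est (e : R) : 0 < e -> exists M : nat, exists t : \bar R, [/\ (0 <= t)%E, (t <= e%:E)%E,
  ((q ^ M)%:R%:E * (nrm mu two_balls)%:E <= (q ^ M)%:R%:E * (family_diagonal two_balls + (2 * Re (omega * total_correlation))%:E) + 4%:E * t)%E &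
  ((q ^ M)%:R%:E * (family_diagonal two_balls + (2 * Re (omega * total_correlation))%:E) <= (q ^ M)%:R%:E * (nrm mu two_balls)%:E + 4%:E * t)%E].
  move=> e0; have [|M0 HM] := family_tail_small locally_constant_two_balls _ e0.
    by exists n => x; exact: two_balls_near0.
  exists (M0 + n)%N, (family_tail (fun x => two_balls (varpi ^+ (M0 + n) * x))).
  have [h1 h2] := two_balls_estimate (leq_addl M0 n) HN.
  split => //; first exact: family_tail_ge0.
  by apply: HM; rewrite leq_addr.
set Y := (family_diagonal _ + _)%E in est *.
have bnd (M : nat) (t : \bar R) (e : R) : 0 < e -> (0 <= t)%E -> (t <= (e / 4)%:E)%E -> (4%:E * t <= (q ^ M)%:R%:E * e%:E)%E.
  move=> e0 t0 te; have q1 : 1 <= (q ^ M)%:R :> R by rewrite ler1n expn_gt0 q_gt0.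
  apply: (@le_trans _ _ (4%:E * (e / 4)%:E)%E); first by rewrite lee_wpmul2l.
  by rewrite -!EFinM lee_fin mulrC divfK// ler_peMl// ltW.
have qM0 (M : nat) : 0 < (q ^ M)%:R :> R by rewrite ltr0n expn_gt0 q_gt0.
apply/eqP; rewrite eq_le; apply/andP; split; apply/lee_addgt0Pr => e e0.
  have [|M [t [t0 te h _]]] := est (e / 4); first by rewrite divr_gt0.
  have := le_trans h (leeD2l _ (bnd M t e e0 t0 te)).
  by rewrite -muleDr ?fin_num_adde_defl// lee_pmul2l ?lte_fin.
have [|M [t [t0 te _ h]]] := est (e / 4); first by rewrite divr_gt0.
have := le_trans h (leeD2l _ (bnd M t e e0 t0 te)).
by rewrite -muleDr ?fin_num_adde_defl// lee_pmul2l ?lte_fin.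
Qed.

End TwoBalls.

Section Necessity.
Hypothesis tf : forall f, L2 mu f -> frame_sum f = (nrm mu f)%:E.

Lemma family_diagonal_ball a (n : nat) :
  (family_diagonal (cindic (cball a n%:Z)) = \int[mu]_(x in cball a n%:Z) calderon_sum x)%E.
Proof.
rewrite family_diagonalE; last exact: locally_constant_cball.
rewrite [RHS]integral_mkcond; apply: eq_integral => x _; rewrite patchE cindicE.
by case: ifP => _; rewrite ?Normc.normc1 ?Normc.normc0 ?expr1n ?expr0n ?mul1e ?mul0e.
Qed.

Lemma ball_avoids0 a (n : nat) : ~ cball a n%:Z 0 -> ~ frac_ideal n%:Z a.
Proof. by rewrite /cball /= sub0r => H h; apply: H; exact: frac_idealN. Qed.

(** With omega = 0 the identity computes the integral of the Calderon sum over any ball that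
avoids 0. *)
Lemma necessity_calderon : {ae mu, forall xi : borel K, calderon_sum xi = 1%E}.
Proof.
have mB a (n : nat) : measurable (cball a n%:Z : set (borel K)) by exact: measurable_cball.
have muB a (n : nat) : mu (cball a n%:Z) = (abs varpi ^ n%:Z)%:E := mu_cball a n%:Z.
apply: (@ae_eq_balls _ (fun=> 1%E) 0 0) => //; first exact: measurable_calderon_sum.
move=> a n a0 _.
(* For omega = 0 any s not divisible by q will do. *)
have q1 : ~~ (q %| 1)%N by rewrite dvdn1 gtn_eqF// q_gt1.
have := @necessity_identity a n 1 0 q1 (ball_avoids0 a0) _ tf.
rewrite eqxx => /(_ (fun h => False_ind _ (notF h))).
have -> : two_balls a n 1 0 = cindic (cball a n%:Z).
  by apply/funext => x; rewrite /two_balls mul0r addr0.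
rewrite mul0r mulr0 adde0 nrm_cball family_diagonal_ball => I1.
have I2 : (\int[mu]_(x in cball a n%:Z) 1%:E = (abs varpi ^ n%:Z)%:E)%E.
  by rewrite integral_cst// mul1e; exact: muB.
split; last by rewrite -I1 -I2.
  apply/integrableP; split; first by apply: measurable_funTS; exact: measurable_calderon_sum.
  under eq_integral do rewrite gee0_abs ?calderon_sum_ge0//.
  by rewrite -I1 ltry.
apply/integrableP; split => //.
by under eq_integral do rewrite abse1; rewrite I2 ltry.
Qed.

(** Since the Calderon sum is 1, the identity leaves only the correlation; omega = 1 and omega =
-i extract the real and the imaginary part of its integral. *)
Lemma necessity_correlation s : ~~ (q %| s)%N ->
  {ae mu, forall xi : borel K, family_correlation s xi = 0}.
Proof.
move=> qs; have cal := necessity_calderon.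
have zero a (n : nat) : ~ cball a n%:Z 0 -> ~ cball a n%:Z (- u s) ->
    cintegral mu (fun y => cindic (cball a n%:Z) y * family_correlation s y) = 0.
  move=> a0 as0.
  have as0' : ~ frac_ideal n%:Z (a + u s).
    by move=> h; apply: as0; rewrite /cball /= -opprD addrC; exact: frac_idealN.
  have H omega : Re (omega * total_correlation a n s) = 0.
    have := @necessity_identity a n s omega qs (ball_avoids0 a0) (fun=> as0') tf.
    rewrite family_diagonal_calderon//; last exact: locally_constant_two_balls.
    by rewrite -EFinD => -[]; lra.
  move: (H 1) (H (- 'i)%C); rewrite -/(total_correlation a n s).
  case: (total_correlation a n s) => t1 t2 /= h1 h2.
  by congr Complex; lra.
have [mRe mIm] := cmeasurable_family_correlation s.
have [iRe iIm] := cintegrable_family_correlation s.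
have mB a (n : nat) : measurable (cball a n%:Z : set (borel K)) by exact: measurable_cball.
have part (P : R[i] -> R) : measurable_fun setT (fun x : borel K => P (family_correlation s x)) ->
    mu.-integrable setT (fun x : borel K => (P (family_correlation s x))%:E) ->
    (forall a (n : nat), P (cintegral mu (fun y => cindic (cball a n%:Z) y * family_correlation s y)) =
      Rintegral mu setT (fun y : borel K => P (cindic (cball a n%:Z) y * family_correlation s y))) ->
    P 0 = 0 -> (forall b, P (1 * b) = P b) -> (forall b, P (0 * b) = 0) ->
    {ae mu, forall xi : borel K, P (family_correlation s xi) = 0}.
  move=> mP iP cP P0 P1 P00.
  have : {ae mu, forall xi : borel K, (P (family_correlation s xi))%:E = 0%E}.
    apply: (@ae_eq_balls _ (fun=> 0%E) 0 (- u s)) => //; first exact/measurable_EFinP.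
    move=> a n a0 as0.
    have iB : mu.-integrable (cball a n%:Z : set (borel K)) (fun x : borel K => (P (family_correlation s x))%:E).
      by apply: integrableS iP.
    split => //; first exact: integrable0.
    rewrite integral0; have := zero a n a0 as0 => /(congr1 P); rewrite cP P0 /Rintegral => e0.
    rewrite -(fineK (integrable_fin_num (mB a n) iB)); congr EFin; rewrite -[RHS]e0; congr fine.
    rewrite integral_mkcond; apply: eq_integral => x _; rewrite patchE cindicE.
    by case: ifP => _; rewrite ?P1 ?P00.
  by apply: filterS => xi [].
have := part (@complex.Re R) mRe iRe (fun _ _ => erefl) erefl (fun b => congr1 _ (mul1r b)) (fun b => congr1 _ (mul0r b)).
have := part (@complex.Im R) mIm iIm (fun _ _ => erefl) erefl (fun b => congr1 _ (mul1r b)) (fun b => congr1 _ (mul0r b)).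
by apply: filterS2 => xi; case: (family_correlation s xi) => t1 t2 /= -> ->.
Qed.

End Necessity.

Lemma tight_frame_iff : tight_frame mu p varpi eps Psi <->
  calderon_condition mu varpi chi Psi /\ t_condition mu p varpi eps chi Psi.
Proof.
split => [/tight_frameE tf|[H1 /t_condition_family H2]].
  split; first exact: necessity_calderon.
  by apply/t_condition_family => s qs; exact: necessity_correlation.
by apply/tight_frameE; exact: sufficiency_frame.
Qed.

Lemma cLnorm2_eq1 f : L2 mu f -> cLnorm mu 2 f = 1%E <-> nrm mu f = 1.
Proof.
move=> Lf; have E := L2_fin Lf; rewrite -cLnorm2_sq in E.
have : (0 <= cLnorm mu 2 f)%E by exact: Lnorm_ge0.
move: E; case: (cLnorm mu 2 f) => [r|//|//]; rewrite lee_fin.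
move=> E r0; have [<-] : (r ^+ 2)%:E = (nrm mu f)%:E by rewrite -E expr2.
split => [[->]|/eqP]; first by rewrite expr1n.
by rewrite sqrp_eq1// => /eqP ->.
Qed.

(** Dilations and translations preserve norms, so the system consists of unit vectors if and
only if the generators do. *)
Lemma basic_wavelets_iff : basic_wavelets mu p varpi eps Psi <->
  (forall l, nrm mu (Psi l) = 1) /\ tight_frame mu p varpi eps Psi.
Proof.
have sysE : basic_wavelets mu p varpi eps Psi <-> orthonormal_basis mu system.
  by [].
have nsys i : nrm mu (system i) = nrm mu (Psi i.1.1) by exact: nrm_aff.
split => [/sysE ob|[n1 /tight_frameE tf]].
  split => [l|].
    have [_ /(_ (l, 0, 0%N) (l, 0, 0%N)) + _] := ob.
    by rewrite eqxx inner_nrm ?nsys; [case|exact: L2_system].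
  apply/tight_frameE => f Lf; rewrite frame_sum_esum.
  exact: (orthonormal_basis_tight_frame L2_system).
apply/sysE; apply: (tight_frame_orthonormal_basis L2_system) => [f Lf|i].
  by rewrite -frame_sum_esum; exact: tf.
by rewrite nsys.
Qed.

End LocalField.

Theorem theorem3p3 (R : realType) (p c : nat) (K : topologicalFieldType)
    (mu : {measure set (borel K) -> \bar R}) (abs : K -> R)
    (varpi : K) (eps : 'I_c -> K) (chi : K -> R[i])
    (L : nat) (Psi : 'I_L -> K -> R[i])
    (K_local : local_field p K)
    (mu_haar : haar_measure mu)
    (absP : is_absolute_value mu abs)
    (mu_integers : mu (integers abs) = 1%E)
    (varpiP : prime_element abs varpi)
    (c_gt0 : (0 < c)%N)
    (residueP : residue_field_card abs (p ^ c)%N)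
    (epsP : residue_basis abs p eps)
    (chiP : standard_character p varpi eps chi)
    (L_gt0 : (0 < L)%N)
    (PsiP : forall l, cLfun mu 2 (Psi l)) :
  (tight_frame mu p varpi eps Psi <->
     calderon_condition mu varpi chi Psi /\
     t_condition mu p varpi eps chi Psi) /\
  (basic_wavelets mu p varpi eps Psi <->
     [/\ forall l, cLnorm mu 2 (Psi l) = 1%E,
         calderon_condition mu varpi chi Psi &
         t_condition mu p varpi eps chi Psi]).
Proof.
have Psi_L2 l : L2 mu (Psi l) by exact/cLfun2P.
have H1 := tight_frame_iff K_local mu_haar absP varpiP residueP c_gt0 erefl epsP chiP
  mu_integers Psi_L2.
split => //.
have H2 := basic_wavelets_iff K_local mu_haar absP varpiP residueP c_gt0 erefl epsP
  mu_integers Psi_L2.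
have H3 l := cLnorm2_eq1 (Psi_L2 l).
split => [/H2[n1 /H1[? ?]]|[n1 h1 h2]]; first by split => // l; exact/H3.
by apply/H2; split; [move=> l; exact/H3|exact/H1].
Qed.
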